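(* Let $n\equiv3\pmod4$. Given any $\xi\in E_1$ with $\xi\not\equiv0$, there exists $\varphi_{-1}\in E_{-1}$ such that $$J_2(\xi+\varphi_{-1})<\frac{(n+1)^2}{4}\,\omega_n^{2/n}.$$
   Context: All integrals are over the unit round sphere $(\mathbb{S}^n,g_{\rm st})$, oriented, with volume element $dV$ and total volume $\omega_n$. $\Omega^p$ is the space of smooth real $p$-forms, with pointwise inner product and Hodge star related by $\alpha\wedge *\beta=\langle\alpha,\beta\rangle\,dV$. The curl operator is $\mathrm{curl}=*d:\Omega^{\frac{n-1}{2}}\to\Omega^{\frac{n-1}{2}}$, and $E_{\pm1}=\{\alpha\in\Omega^{\frac{n-1}{2}}:\mathrm{curl}\,\alpha=\pm\frac{n+1}{2}\alpha\}$. For $\alpha\in\Omega^{\frac{n-1}{2}}$, $$J_2(\alpha)=\frac{\Big(\int|\mathrm{curl}\,\alpha|^{\frac{2n}{n+1}}\,dV\Big)^{\frac{n+1}{n}}}{\inf_{\phi\in\Omega^{\frac{n-3}{2}}}\Big(\int|\alpha-d\phi|^{\frac{2n}{n-1}}\,dV\Big)^{\frac{n-1}{n}}}.$$ *)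

(* Defs.v *)
From HB Require Import structures.
From mathcomp Require Import all_boot all_order all_algebra.
From mathcomp Require Import all_classical all_reals all_analysis.
Set Implicit Arguments.
Unset Strict Implicit.
Unset Printing Implicit Defensive.
Import Order.TTheory GRing.Theory Num.Theory.
Import numFieldNormedType.Exports.
Local Open Scope classical_set_scope.
Local Open Scope ring_scope.

(* Differential forms on the unit sphere S^n of R^(n+1), treated extrinsically:
   T_x S^n is the hyperplane orthogonal to x, and a p-tuple of vectors is the
   tuple of rows of a p x (n+1) matrix. *)

Section EuclideanSpace.
Variables (R : realType) (N : nat).
Implicit Types (u v x y : 'rV[R]_N).

Definition dotp u v : R := (u *m v^T) 0 0.

(* The library norm `|x| on row vectors is the sup norm. *)
Definition enorm x : R := Num.sqrt (dotp x x).

Definition sphere : set 'rV[R]_N := [set x | enorm x = 1].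

Definition tangent p x (W : 'M[R]_(p, N)) : Prop := W *m x^T = 0.

Definition tproj x v : 'rV[R]_N := v - dotp v x *: x.

Definition retract y : 'rV[R]_N := (enorm y)^-1 *: y.

End EuclideanSpace.

Arguments sphere {R N}.

Section LebesgueIntegral.
Variable R : realType.

(* Integral over R^N against Lebesgue measure, as an iterated integral; by
   Tonelli this is the integral against the product measure for the nonnegative
   Borel functions to which it is applied. *)
Fixpoint integral_rV N : ('rV[R]_N -> \bar R) -> \bar R :=
  match N return ('rV[R]_N -> \bar R) -> \bar R with
  | 0 => fun f => f 0
  | M.+1 => fun f =>
      (\int[@lebesgue_measure R]_(t in [set: R])
         integral_rV (fun v : 'rV[R]_M => f (row_mx (t%:M : 'rV[R]_1) v)))%E
  end.

(* Integral over S^n for the surface measure: the measure of A `<=` S^n is n+1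
   times the Lebesgue measure of the cone {r a | a in A, 0 <= r < 1}. *)
Definition integral_sphere n (f : 'rV[R]_n.+1 -> R) : R :=
  n.+1%:R * fine (integral_rV (fun y : 'rV[R]_n.+1 =>
    (if enorm y < 1 then f (retract y) else 0)%:E)).

Definition sphere_volume n : R := integral_sphere (fun _ : 'rV[R]_n.+1 => 1).

(* C^oo on R^N \ {0}: all iterated directional derivatives are differentiable. *)
Definition smooth_off0 N (f : 'rV[R]_N -> R) : Prop :=
  forall (s : seq 'rV[R]_N) (y : 'rV[R]_N), y != 0 ->
    differentiable (foldr (fun v (g : 'rV[R]_N -> R) => 'D_v g) f s) y.

End LebesgueIntegral.

Section Forms.
Variables (R : realType) (n : nat).

(* Carrier of the p-forms on S^n: only the values alpha x W for x on the sphere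
   and rows of W tangent at x are meaningful (see [dform_eq]). *)
Definition dform p := 'rV[R]_n.+1 -> 'M[R]_(p, n.+1) -> R.

Definition dform_eq p (alpha beta : dform p) : Prop :=
  forall x W, sphere x -> tangent x W -> alpha x W = beta x W.

Definition alternating_at p (x : 'rV[R]_n.+1) (a : 'M[R]_(p, n.+1) -> R) : Prop :=
  (forall (i : 'I_p) (b c : R) (A B C : 'M[R]_(p, n.+1)),
      tangent x A -> tangent x B -> tangent x C ->
      row i A = b *: row i B + c *: row i C ->
      row' i B = row' i A -> row' i C = row' i A ->
      a A = b * a B + c * a C) /\
  (forall (i j : 'I_p) (A : 'M[R]_(p, n.+1)),
      tangent x A -> i != j -> row i A = row j A -> a A = 0).

(* Pullback of a form on S^n to R^(n+1) \ {0} by the retraction y |-> y/|y|. *)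
Definition pullback p (alpha : dform p) : dform p := fun y W =>
  alpha (retract y) (\matrix_(i < p) ('D_(row i W) (@retract R n.+1) y)).

(* Omega^p.  As the retraction is smooth and is the identity on S^n, alpha is
   smooth on S^n iff its pullback has smooth coefficients. *)
Definition smooth_dform p : set (dform p) := [set alpha |
  (forall x, sphere x -> alternating_at x (alpha x)) /\
  (forall W, smooth_off0 (fun y => pullback alpha y W))].

(* Exterior derivative Omega^(q-1) -> Omega^q: the formula for d on R^(n+1),
   applied to the pullback by the retraction and to tangent vectors of S^n.
   Since q is a parameter, d : Omega^p -> Omega^(p+1) is the instance q = p+1. *)
Definition extd q (alpha : dform q.-1) : dform q := fun x W =>
  \sum_(k < q) (-1) ^+ k * 'D_(row k W) (fun y => pullback alpha y (row' k W)) x.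

(* Tangential projections at x of the canonical basis vectors e_(i 0), e_(i 1)...
   The projections of e_0, ..., e_n are a Parseval frame of T_x S^n, so full
   contractions over them agree with contractions over an orthonormal basis. *)
Definition frame p (x : 'rV[R]_n.+1) (i : {ffun 'I_p -> 'I_n.+1}) :
    'M[R]_(p, n.+1) :=
  \matrix_(k < p) tproj x (delta_mx 0 (i k)).

(* Pointwise inner product, for which e^1 /\ ... /\ e^p is a unit covector. *)
Definition dform_dot p (alpha beta : dform p) (x : 'rV[R]_n.+1) : R :=
  (p`!%:R)^-1 * \sum_(i : {ffun 'I_p -> 'I_n.+1})
    alpha x (frame x i) * beta x (frame x i).

Definition dform_norm p (alpha : dform p) (x : 'rV[R]_n.+1) : R :=
  Num.sqrt (dform_dot alpha alpha x).

(* The Riemannian volume form, dV_x(v_1, ..., v_n) = +- det(x, v_1, ..., v_n);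
   the boolean o selects one of the two orientations of S^n (false: outward
   normal first).  The number m of vectors is meant to be n. *)
Definition volume_form (o : bool) m : dform m := fun x V =>
  (-1) ^+ o * \det (conform_mx (0 : 'M[R]_n.+1) (col_mx x V)).

(* Hodge star Omega^p -> Omega^q, meant for p + q = n: in an orthonormal basis
   of T_x S^n, ( *beta)(w) = \sum_(I increasing) beta(e_I) dV(e_I, w), i.e.
   alpha /\ *beta = <alpha, beta> dV. *)
Definition hodge (o : bool) p q (beta : dform p) : dform q := fun x W =>
  (p`!%:R)^-1 * \sum_(i : {ffun 'I_p -> 'I_n.+1})
    beta x (frame x i) * volume_form o x (col_mx (frame x i) W).

(* curl = *d : Omega^p -> Omega^p, meant for n = 2 p + 1. *)
Definition curl (o : bool) p (alpha : dform p) : dform p :=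
  hodge o (extd (q := p.+1) alpha).

End Forms.

Section Conformal.
Variables (R : realType) (n : nat).

(* (n-1)/2, for n odd *)
Definition middeg : nat := n.-1./2.

(* E_1 and E_(-1) are [eigenforms o 1] and [eigenforms o (-1)]. *)
Definition eigenforms (o : bool) (s : R) : set (dform R n middeg) := [set alpha |
  smooth_dform alpha /\
  dform_eq (curl o alpha) (fun x W => s * (n.+1%:R / 2) * alpha x W)].

(* Here middeg.-1 = (n-3)/2 and [extd phi] has degree middeg. *)
Definition J2 (o : bool) (alpha : dform R n middeg) : R :=
  (integral_sphere (fun x =>
     dform_norm (curl o alpha) x `^ (2 * n%:R / n.+1%:R)))
    `^ (n.+1%:R / n%:R)
  / inf [set (integral_sphere (fun x =>
               dform_norm (alpha - extd phi) x `^ (2 * n%:R / n.-1%:R)))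
               `^ (n.-1%:R / n%:R)
        | phi in @smooth_dform R n middeg.-1].

End Conformal.

(* Main.v *)
Require Import Defs.
From mathcomp Require Import all_boot all_order all_algebra.
From mathcomp Require Import all_classical all_reals all_analysis.
From mathcomp Require Import measurable_realfun zify ring lra.
Set Implicit Arguments.
Unset Strict Implicit.
Unset Printing Implicit Defensive.
Import Order.TTheory GRing.Theory Num.Theory.
Import numFieldNormedType.Exports.
Local Open Scope classical_set_scope.
Local Open Scope ring_scope.

(** The form [phi] is a mirror image of [xi].  Write [n = 2 p + 1], [m = (n+1)/2],
    [q = 2 n / (n+1)], and let [Q] be an orthogonal matrix of determinant -1.
    Pulling back by [Q] commutes with the exterior derivative and anticommutes
    with the Hodge star, so it anticommutes with the curl [curl_isopull]; hence
    [phi = + Q^* xi] and [phi = - Q^* xi] belong to [E_(-1)].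

    Since [curl (xi + phi) = m (xi - phi)], the numerator of the quotient is
    [m^2 ||xi - phi||_q^2].  By Stokes [integral_exact_dot_curl], exact forms are
    orthogonal to eigenforms of the curl, so
    [int <xi + phi - d psi, xi + phi> = int |xi + phi|^2], and Hoelder's inequality
    bounds the denominator from below by
    [(int |xi + phi|^2)^2 / ||xi + phi||_q^2] [denominator_bound].  As [q < 2], the
    power mean inequality gives [||u||_q^2 <= V^(1/n) int |u|^2], where [V] is the
    volume of the sphere, and altogether the quotient is at most
    [m^2 V^(2/n) (int |xi - phi|^2) / (int |xi + phi|^2)].

    The ratio of the two integrals is [(A - 2 c) / (A + 2 c)], where
    [c = int <xi, phi>], and the sign of [phi] can be chosen so that [0 <= c].
    This proves the weak inequality.  It is strict unless [c = 0] and
    [|xi + phi|], [|xi - phi|] are both constant, the equality case of the power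
    mean inequality [power_mean]; then [<xi, phi>] is constant too, and its
    integral [c] being zero, it vanishes [quotient_bound].  So it is enough to
    find [Q] such that [<xi, Q^* xi>] is nonzero at one point.  At a point where
    [xi] is nonzero, the sum of these inner products over the reflections in the
    [n] vectors of an orthonormal basis of the tangent space is
    [(n - 2 p) |xi|^2 = |xi|^2], so one of them is nonzero [exists_reflection].

    Stokes' theorem is proved extrinsically.  An integral over the sphere is a
    limit of integrals over the ambient space of the integrand, extended along
    rays and multiplied by a radial cutoff [integral_annulus_cvg].  The integral
    of a derivative of a function of compact support vanishes, by translation
    invariance [integralR_rV_derive], and a radial cutoff contributes nothing to
    the divergence of a field tangent to the spheres [radial_divergence].  The
    integrand [d psi /\ d eta] is such a divergence because mixed second
    derivatives cancel [integral_exact_wedge]. *)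

(** * Integrals over the line of functions with bounded support *)

Section LineIntegral.
Variable R : realType.
Notation mu := (@lebesgue_measure R).
Implicit Types (f g : R -> R) (K L : R).

Definition bounded_supp1 K L f :=
  (forall t, `|f t| <= K) /\ (forall t, L < `|t| -> f t = 0).

Lemma integrable_box K L : mu.-integrable setT (EFin \o (fun t => K * \1_(`[-L, L] : set R) t)).
Proof.
have -> : EFin \o (fun t => K * \1_(`[-L, L] : set R) t) =
          (fun t => K%:E * (\1_([set` `[(-L)%R, L]] : set R) t)%:E)%E.
  by apply/funext => t; rewrite /= EFinM.
apply: integrableZl => //; exact: integrable_indic_itv.
Qed.

Lemma bounded_supp1_le K L f t : 0 <= K -> bounded_supp1 K L f ->
  `|f t| <= K * \1_(`[-L, L] : set R) t.
Proof.
move=> K0 [fK fL]; rewrite indicE.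
have [tL|tL] := boolP (t \in _); first by rewrite mulr1.
rewrite mulr0 fL ?normr0// ltNge; apply: contra tL => tL.
by rewrite inE/= in_itv/= -ler_norml.
Qed.

Lemma integrable_bounded_supp1 K L f : measurable_fun setT f -> bounded_supp1 K L f ->
  mu.-integrable setT (EFin \o f).
Proof.
move=> mf fb.
have K0 : 0 <= K by apply: le_trans (fb.1 0).
apply: le_integrable (integrable_box K L) => //; first exact/measurable_EFinP.
move=> t _; rewrite /= lee_fin (le_trans (bounded_supp1_le t K0 fb))//.
exact: ler_norm.
Qed.

Lemma Rintegral_box K L : 0 <= L ->
  (\int[mu]_(t in setT) (K * \1_(`[-L, L] : set R) t) = K * (L *+ 2))%R.
Proof.
move=> L0; rewrite RintegralZl//; last exact: integrable_indic_itv.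
congr (_ * _); rewrite /Rintegral integral_indic// setIT. rewrite [X in fine X](_ : _ = if ((-L)%:E < L%:E)%E then (L%:E - (-L)%:E)%E else 0%E); last exact: (lebesgue_measure_itv `[-L, L]).
rewrite lte_fin; case: ltP => /= h; first by rewrite opprK.
have -> : L = 0 by apply/eqP; rewrite eq_le L0 andbT; lra.
by rewrite mul0rn.
Qed.

Lemma Rintegral1_le K L f : 0 <= L -> measurable_fun setT f -> bounded_supp1 K L f ->
  `|\int[mu]_(t in setT) f t| <= K * (L *+ 2).
Proof.
move=> L0 mf fb; have K0 : 0 <= K by apply: le_trans (fb.1 0).
have fi := integrable_bounded_supp1 mf fb.
rewrite (le_trans (le_normr_Rintegral _ fi))// -Rintegral_box//.
apply: le_Rintegral => //; first exact: (integrable_norm fi).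
  exact: integrable_box.
by move=> t _; exact: bounded_supp1_le.
Qed.

(** Dominated convergence: the constant [K] on [[-L, L]] dominates every term. *)
Lemma Rintegral1_cvg K L (f_ : nat -> R -> R) f :
  (forall k, measurable_fun setT (f_ k)) -> (forall k, bounded_supp1 K L (f_ k)) ->
  (forall t, f_ k t @[k --> \oo] --> f t) ->
  measurable_fun setT f /\
  (\int[mu]_(t in setT) f_ k t)%R @[k --> \oo] --> (\int[mu]_(t in setT) f t)%R.
Proof.
move=> mf fb fcvg.
have K0 : 0 <= K by apply: le_trans ((fb 0%N).1 0).
have mfl : measurable_fun setT f.
  by apply: (measurable_fun_cvg mf) => t _; exact: fcvg.
split=> //.
have mE k : measurable_fun setT (EFin \o f_ k) by exact/measurable_EFinP.
have mEl : measurable_fun setT (EFin \o f) by exact/measurable_EFinP.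
have [|||||fi _ c] := @dominated_convergence _ _ R mu setT measurableT
   (fun k => EFin \o f_ k) (EFin \o f)
   (EFin \o (fun t => K * \1_(`[-L, L] : set R) t)).
- exact: mE.
- exact: mEl.
- by apply: aeW => t _; apply: cvg_EFin; [exact: nearW|exact: fcvg].
- exact: integrable_box.
- by apply: aeW => t k _; rewrite /= lee_fin; exact: bounded_supp1_le.
apply: fine_cvg; rewrite fineK; first exact: c.
exact: integrable_fin_num.
Qed.

End LineIntegral.

(** * The iterated Lebesgue integral *)

Section IteratedIntegral.
Variable R : realType.
Notation mu := (@lebesgue_measure R).
Implicit Types (K L : R).

Lemma mx_norm_leP m N (x : 'M[R]_(m, N)) e : 0 <= e ->
  (`|x| <= e) <-> (forall i j, `|x i j| <= e).
Proof.
move=> e0; have -> : `|x| = mx_norm x by [].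
rewrite mx_normrE; split=> [xe i j|h].
  by rewrite (le_trans _ xe)//; exact: (le_bigmax _ (fun ij => `|x ij.1 ij.2|) (i, j)).
by apply/bigmax_leP; split=> // -[i j] _ /=.
Qed.

Lemma mx_norm_ge m N (x : 'M[R]_(m, N)) i j : `|x i j| <= `|x|.
Proof. by move: i j; apply/mx_norm_leP. Qed.

Definition rV_cons M (t : R) (v : 'rV[R]_M) : 'rV[R]_M.+1 :=
  row_mx (t%:M : 'rV[R]_1) v.

Lemma rV_cons0 M t (v : 'rV[R]_M) : rV_cons t v 0 0 = t.
Proof.
have -> : (0 : 'I_M.+1) = lshift M (0 : 'I_1) by exact: val_inj.
by rewrite [LHS](row_mxEl (t%:M : 'rV[R]_1) v) mxE eqxx mulr1n.
Qed.

Lemma rV_consS M t (v : 'rV[R]_M) j : rV_cons t v 0 (lift ord0 j) = v 0 j.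
Proof.
have -> : lift ord0 j = rshift 1 j by exact: val_inj.
by rewrite [LHS](row_mxEr (t%:M : 'rV[R]_1) v).
Qed.

Lemma rV_consD M s t (u v : 'rV[R]_M) :
  rV_cons s u + rV_cons t v = rV_cons (s + t) (u + v).
Proof.
apply/rowP => j; rewrite mxE; have [k ->|->] := unliftP ord0 j.
  by rewrite !rV_consS mxE.
by rewrite !rV_cons0.
Qed.

Lemma rV_consN M s (u : 'rV[R]_M) : - rV_cons s u = rV_cons (- s) (- u).
Proof.
apply/rowP => j; rewrite mxE; have [k ->|->] := unliftP ord0 j.
  by rewrite !rV_consS mxE.
by rewrite !rV_cons0.
Qed.

Lemma rV_cons_norm M s (u : 'rV[R]_M) : `|s| <= `|rV_cons s u| /\ `|u| <= `|rV_cons s u|.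
Proof.
split; first by rewrite -[X in `|X| <= _](rV_cons0 s u) mx_norm_ge.
by apply/mx_norm_leP => // i j; rewrite ord1 -(rV_consS s) mx_norm_ge.
Qed.

Lemma rV_cons_norm_le M s (u : 'rV[R]_M) : `|rV_cons s u| <= Num.max `|s| `|u|.
Proof.
apply/mx_norm_leP => [|i j]; first by rewrite le_max normr_ge0.
rewrite ord1; have [k ->|->] := unliftP ord0 j.
  by rewrite rV_consS le_max mx_norm_ge orbT.
by rewrite rV_cons0 le_max lexx.
Qed.

Lemma rV_cons_continuousl M (v : 'rV[R]_M) : continuous (fun t => rV_cons t v).
Proof.
move=> t; apply/cvgrPdist_le => e e0; near=> s.
have -> : rV_cons t v - rV_cons s v = rV_cons (t - s) 0.
  by rewrite rV_consN rV_consD subrr.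
rewrite (le_trans (rV_cons_norm_le _ _))// normr0 ge_max (ltW e0) andbT.
near: s; apply: (@cvgr_dist_le _ _ _ _ _ id) => //; exact: cvg_id.
Unshelve. all: by end_near. Qed.

Lemma rV_cons_continuousr M t : continuous (@rV_cons M t).
Proof.
move=> v; apply/(@cvgrPdist_le _ _ _ (nbhs v)) => e e0; near=> w.
have -> : rV_cons t v - rV_cons t w = rV_cons 0 (v - w).
  by rewrite rV_consN rV_consD subrr.
rewrite (le_trans (rV_cons_norm_le _ _))// normr0 ge_max (ltW e0)/=.
near: w; apply: (@cvgr_dist_le _ _ _ _ _ id) => //; exact: cvg_id.
Unshelve. all: by end_near. Qed.

(** A real-valued version of the extended-real iterated integral [integral_rV],
    with which it agrees on bounded functions of bounded support [integral_rVE]. *)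
Fixpoint integralR_rV N : ('rV[R]_N -> R) -> R :=
  match N return ('rV[R]_N -> R) -> R with
  | 0 => fun f => f 0
  | M.+1 => fun f =>
      \int[mu]_(t in setT) integralR_rV (fun v : 'rV[R]_M => f (rV_cons t v))
  end.

(** What makes every step of the iterated integral well behaved.  The property
    holds for continuous functions of bounded support and passes to linear
    combinations and bounded limits, so that iterated integrals can be handled one
    variable at a time. *)
Fixpoint iter_measurable N : ('rV[R]_N -> R) -> Prop :=
  match N return ('rV[R]_N -> R) -> Prop with
  | 0 => fun f => True
  | M.+1 => fun f =>
      (forall t, iter_measurable (fun v : 'rV[R]_M => f (rV_cons t v))) /\
      measurable_fun setT (fun t => integralR_rV (fun v : 'rV[R]_M => f (rV_cons t v)))
  end.

Definition bounded_supp N K L (f : 'rV[R]_N -> R) :=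
  (forall v, `|f v| <= K) /\ (forall v, L < `|v| -> f v = 0).

Lemma bounded_supp_cons M K L (f : 'rV[R]_M.+1 -> R) t :
  bounded_supp K L f -> bounded_supp K L (fun v => f (rV_cons t v)).
Proof.
move=> [fK fL]; split=> // v Lv; apply: fL.
by rewrite (lt_le_trans Lv)//; have [] := rV_cons_norm t v.
Qed.

Lemma integralR_rV0 N : integralR_rV (fun _ : 'rV[R]_N => 0) = 0.
Proof.
elim: N => //= M IH; under eq_Rintegral do rewrite IH.
by rewrite Rintegral_cst// mul0r.
Qed.

Lemma integralR_rV_le N K L (f : 'rV[R]_N -> R) : 0 <= L ->
  iter_measurable f -> bounded_supp K L f ->
  `|integralR_rV f| <= K * (L *+ 2) ^+ N.
Proof.
move=> L0; elim: N f => [|M IH] f /=.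
  by move=> _ [fK _]; rewrite expr0 mulr1.
move=> [mf mg] fb; rewrite exprSr mulrA.
apply: Rintegral1_le => //; split=> [t|t Lt].
  by apply: IH; [exact: mf|exact: bounded_supp_cons].
rewrite -[RHS](integralR_rV0 M); congr integralR_rV; apply/funext => v.
apply: fb.2; rewrite (lt_le_trans Lt)//.
by have [] := rV_cons_norm t v.
Qed.

Lemma integralR_rV_supp1 M K L (f : 'rV[R]_M.+1 -> R) : 0 <= L ->
  iter_measurable f -> bounded_supp K L f ->
  bounded_supp1 (K * (L *+ 2) ^+ M) L
    (fun t => integralR_rV (fun v : 'rV[R]_M => f (rV_cons t v))).
Proof.
move=> L0 [mf mg] fb; split=> [t|t Lt].
  by apply: integralR_rV_le => //; [exact: mf|exact: bounded_supp_cons].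
rewrite -[RHS](integralR_rV0 M); congr integralR_rV; apply/funext => v.
apply: fb.2; rewrite (lt_le_trans Lt)//.
by have [] := rV_cons_norm t v.
Qed.

Lemma integralR_rV_integrable M K L (f : 'rV[R]_M.+1 -> R) : 0 <= L ->
  iter_measurable f -> bounded_supp K L f ->
  mu.-integrable setT
    (EFin \o (fun t => integralR_rV (fun v : 'rV[R]_M => f (rV_cons t v)))).
Proof.
move=> L0 mf fb; apply: integrable_bounded_supp1 (integralR_rV_supp1 L0 mf fb).
exact: mf.2.
Qed.

Lemma integral_rVE N K L (f : 'rV[R]_N -> R) : 0 <= L ->
  iter_measurable f -> bounded_supp K L f ->
  integral_rV (fun v => (f v)%:E) = (integralR_rV f)%:E.
Proof.
move=> L0; elim: N f => [//|M IH] f mf fb.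
have fi := integralR_rV_integrable L0 mf fb.
rewrite /= /Rintegral fineK; last exact: integrable_fin_num.
apply: eq_integral => t _; apply: IH; first exact: mf.1.
exact: (bounded_supp_cons t fb).
Qed.

Lemma iter_measurable_lin N K1 K2 L a b (f g : 'rV[R]_N -> R) : 0 <= L ->
  iter_measurable f -> bounded_supp K1 L f ->
  iter_measurable g -> bounded_supp K2 L g ->
  iter_measurable (fun v => a * f v + b * g v) /\
  integralR_rV (fun v => a * f v + b * g v) =
    a * integralR_rV f + b * integralR_rV g.
Proof.
move=> L0; elim: N f g => [//|M IH] f g mf fb mg gb /=.
have H t := IH _ _ (mf.1 t) (bounded_supp_cons t fb) (mg.1 t) (bounded_supp_cons t gb).
have fi := integralR_rV_integrable L0 mf fb.
have gi := integralR_rV_integrable L0 mg gb.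
split.
  split=> [t|]; first exact: (H t).1.
  under eq_fun do rewrite (H _).2.
  by apply: measurable_funD; apply: measurable_funM => //; [exact: mf.2|exact: mg.2].
under eq_Rintegral do rewrite (H _).2.
have afi : mu.-integrable setT (EFin \o (fun t => a * integralR_rV (fun v => f (rV_cons t v)))).
  exact: (integrableZl measurableT a fi).
have bgi : mu.-integrable setT (EFin \o (fun t => b * integralR_rV (fun v => g (rV_cons t v)))).
  exact: (integrableZl measurableT b gi).
by rewrite RintegralD// !RintegralZl.
Qed.

(** Dominated convergence, one variable at a time. *)
Lemma integralR_rV_cvg N K L (f_ : nat -> 'rV[R]_N -> R) f : 0 <= L ->
  (forall k, iter_measurable (f_ k)) -> (forall k, bounded_supp K L (f_ k)) ->
  (forall t, f_ k t @[k --> \oo] --> f t) ->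
  iter_measurable f /\ integralR_rV (f_ k) @[k --> \oo] --> integralR_rV f.
Proof.
move=> L0; elim: N f_ f => [|M IH] f_ f mf fb fcvg /=; first by split.
have H t := IH _ _ (fun k => (mf k).1 t) (fun k => bounded_supp_cons t (fb k))
  (fun v => fcvg (rV_cons t v)).
have [mg ?] := Rintegral1_cvg (fun k => (mf k).2)
   (fun k => integralR_rV_supp1 L0 (mf k) (fb k)) (fun t => (H t).2).
by split=> //; split=> // t; exact: (H t).1.
Qed.

Lemma integralR_rV_mono N K1 K2 L (f g : 'rV[R]_N -> R) : 0 <= L ->
  iter_measurable f -> bounded_supp K1 L f ->
  iter_measurable g -> bounded_supp K2 L g ->
  (forall v, f v <= g v) -> integralR_rV f <= integralR_rV g.
Proof.
move=> L0; elim: N f g => [|M IH] f g mf fb mg gb fg /=; first exact: fg.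
apply: (le_Rintegral measurableT (integralR_rV_integrable L0 mf fb)
  (integralR_rV_integrable L0 mg gb)).
- move=> t _; apply: IH => //; [exact: mf.1| |exact: mg.1|].
  + exact: bounded_supp_cons fb.
  + exact: bounded_supp_cons gb.
Qed.

(** On the line, continuity can be tested along sequences, which is the form in
    which dominated convergence delivers it. *)
Lemma seq_continuous (g : R -> R) p :
  (forall u : nat -> R, u k @[k --> \oo] --> p -> g (u k) @[k --> \oo] --> g p) ->
  g x @[x --> p] --> g p.
Proof.
move=> h; apply/left_right_continuousP; split.
  by apply/cvg_at_leftP => u [_]; exact: h.
by apply/cvg_at_rightP => u [_]; exact: h.
Qed.

Lemma continuous_cons M (f : 'rV[R]_M.+1 -> R) t :
  continuous f -> continuous (fun v : 'rV[R]_M => f (rV_cons t v)).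
Proof.
by move=> cf v; apply: continuous_comp; [exact: rV_cons_continuousr|exact: cf].
Qed.

Lemma integralR_slice_continuous M K L (f : 'rV[R]_M.+1 -> R) : 0 <= L ->
  continuous f -> bounded_supp K L f ->
  (forall t, iter_measurable (fun v : 'rV[R]_M => f (rV_cons t v))) ->
  continuous (fun t => integralR_rV (fun v : 'rV[R]_M => f (rV_cons t v))).
Proof.
move=> L0 cf fb mf t; apply: seq_continuous => u ut.
apply: (integralR_rV_cvg L0 (fun k => mf (u k))
          (fun k => bounded_supp_cons (u k) fb) _).2 => v.
have c : rV_cons (u k) v @[k --> \oo] --> rV_cons t v.
  exact: (cvg_comp _ _ ut (@rV_cons_continuousl _ v t)).
exact: (cvg_comp _ _ c (cf _)).
Qed.

(** Each partial integral is again continuous, by dominated convergence, hence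
    measurable. *)
Lemma iter_measurable_continuous N K L (f : 'rV[R]_N -> R) : 0 <= L ->
  continuous f -> bounded_supp K L f -> iter_measurable f.
Proof.
move=> L0; elim: N f => [//|M IH] f cf fb /=.
have H t : iter_measurable (fun v : 'rV[R]_M => f (rV_cons t v)).
  by apply: IH; [exact: continuous_cons|exact: bounded_supp_cons].
split=> //; apply: continuous_measurable_fun.
exact: integralR_slice_continuous fb H.
Qed.

End IteratedIntegral.

(** * Translation invariance, and integrals of derivatives *)

Section Translation.
Variable R : realType.
Notation mu := (@lebesgue_measure R).
Implicit Types (K L : R).

Lemma ge0_Rintegral_translate (g : R -> R) c :
  continuous g -> (forall t, 0 <= g t) ->
  \int[mu]_(t in setT) g (t + c) = \int[mu]_(t in setT) g t.
Proof.
move=> cg g0.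
have dF (t : R) : is_derive t 1 (fun s : R => s + c) (1 : R).
  by apply: is_derive_eq; rewrite addr0.
have F1 : derive1 (fun s : R => s + c) = cst 1.
  by apply/funext => t; rewrite derive1E derive_val.
rewrite /Rintegral (@increasing_ge0_integration_by_substitutionT _ (fun s => s + c) g)//.
- by congr fine; apply: eq_integral => t _; rewrite F1 /= mulr1.
- by move=> s t st; rewrite ltrD2r.
- by rewrite F1; exact: cst_continuous.
- by rewrite F1; exact: is_cvg_cst.
- by rewrite F1; exact: is_cvg_cst.
- by apply: cvg_addrr_Ny.
- by apply: cvg_addrr.
Qed.

(** The change of variables for nonnegative functions is applied to the positive
    and negative parts. *)
Lemma Rintegral_translate K L (g : R -> R) c :
  continuous g -> bounded_supp1 K L g ->
  \int[mu]_(t in setT) g (t + c) = \int[mu]_(t in setT) g t.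
Proof.
move=> cg [gK gL].
pose gp (t : R) : R := 2^-1 * (`|g t| + g t); pose gn (t : R) : R := 2^-1 * (`|g t| - g t).
have cnorm : continuous (fun t => `|g t|).
  by move=> t; apply: (continuous_comp (cg t)); exact: norm_continuous.
have cp : continuous gp.
  by move=> t; apply: cvgMr; apply: cvgD; [exact: cnorm|exact: cg].
have cn : continuous gn.
  by move=> t; apply: cvgMr; apply: cvgB; [exact: cnorm|exact: cg].
have gE t : g t = gp t - gn t by rewrite /gp /gn; lra.
have p0 t : 0 <= gp t by rewrite /gp; have := ler_norm (- g t); rewrite normrN; lra.
have n0 t : 0 <= gn t by rewrite /gn; have := ler_norm (g t); lra.
have bp : bounded_supp1 K L gp.
  split=> [t|t /gL gt0]; last by rewrite /gp gt0 normr0 addr0 mulr0.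
  by rewrite ger0_norm// /gp; have := ler_norm (g t); have := gK t; lra.
have bn : bounded_supp1 K L gn.
  split=> [t|t /gL gt0]; last by rewrite /gn gt0 normr0 subr0 mulr0.
  by rewrite ger0_norm// /gn; have := ler_norm (- g t); rewrite normrN; have := gK t; lra.
have bs f : bounded_supp1 K L f -> bounded_supp1 K (L + `|c|) (fun t => f (t + c)).
  move=> [fK fL]; split=> // t tL; apply: fL.
  have : `|t| <= `|t + c| + `|c| by rewrite -{1}(addrK c t) (le_trans (ler_normB _ _)).
  lra.
have cs (f : R -> R) : continuous f -> continuous (fun t => f (t + c)).
  move=> cf t; have tc : s + c @[s --> t] --> t + c.
    by apply: cvgD; [exact: cvg_id|exact: cvg_cst].
  exact: (cvg_comp _ _ tc (cf _)).
have mc (f : R -> R) : continuous f -> measurable_fun setT f.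
  by move=> cf; exact: continuous_measurable_fun.
rewrite (_ : (fun t => g (t + c)) = (fun t => gp (t + c) - gn (t + c))); last exact/funext.
rewrite (_ : (fun t => g t) = (fun t => gp t - gn t)); last exact/funext.
have ip := integrable_bounded_supp1 (mc _ cp) bp.
have in_ := integrable_bounded_supp1 (mc _ cn) bn.
have ipc := integrable_bounded_supp1 (mc _ (cs _ cp)) (bs _ bp).
have inc := integrable_bounded_supp1 (mc _ (cs _ cn)) (bs _ bn).
rewrite (RintegralB measurableT ipc inc) (RintegralB measurableT ip in_).
by rewrite !ge0_Rintegral_translate.
Qed.

Lemma integralR_rV_translate N K L (f : 'rV[R]_N -> R) w : 0 <= L ->
  continuous f -> bounded_supp K L f ->
  integralR_rV (fun v => f (v + w)) = integralR_rV f.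
Proof.
move=> L0; elim: N f w => [|M IH] f w cf fb /=.
  by congr f; apply/rowP => -[].
have {1}-> : w = rV_cons (w 0 0) (\row_j w 0 (lift ord0 j)).
  apply/rowP => j; have [k ->|->] := unliftP ord0 j; last by rewrite rV_cons0.
  by rewrite rV_consS mxE.
under eq_Rintegral.
  move=> t _; under eq_fun do rewrite rV_consD.
  rewrite (IH (fun v => f (rV_cons (t + w 0 0) v))).
  over.
  exact: continuous_cons.
  exact: bounded_supp_cons.
have mf := iter_measurable_continuous L0 cf fb.
rewrite (@Rintegral_translate _ _ (fun t => integralR_rV (fun v => f (rV_cons t v))) _ _ (integralR_rV_supp1 L0 mf fb))//.
exact: integralR_slice_continuous fb mf.1.
Qed.

Lemma continuous_bounded_supp N L (f : 'rV[R]_N -> R) : continuous f ->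
  (forall v, L < `|v| -> f v = 0) -> exists K, bounded_supp K L f.
Proof.
move=> cf fL; have [L0|L0] := leP 0 L; last first.
  exists 0; split=> // v; rewrite fL ?normr0//; exact: lt_le_trans L0 _.
pose A := [set v : 'rV[R]_N | `|v| <= L].
have A0 : A !=set0 by exists 0; rewrite /A/= normr0.
have cA : compact A.
  apply: bounded_closed_compact.
    exists L; split; first exact: num_real.
    by move=> x Lx v /= vL; rewrite (le_trans vL)// ltW.
  rewrite (_ : A = [set v | (0:R) <= L - `|v|]); last first.
    by apply/seteqP; split=> v /=; rewrite /A/= subr_ge0.
  apply: (@closed_comp _ _ (fun v : 'rV[R]_N => L - `|v|) [set x | 0 <= x]).
    move=> v _; apply: continuousB; first exact: cst_continuous.
    exact: norm_continuous.
  exact: closed_ge.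
have cn : {within A, continuous (fun v => `|f v|)}.
  apply: continuous_subspaceT => v.
  by apply: (continuous_comp (cf v)); exact: norm_continuous.
have [c _ cP] := EVT_max_rV A0 cA cn.
exists `|f c|; split=> // v; have [vL|vL] := leP `|v| L.
  by apply: cP; rewrite inE.
by rewrite fL// normr0.
Qed.

Lemma derive_line N (G : 'rV[R]_N -> R) v w (s : R) : derivable G (v + s *: w) w ->
  is_derive s 1 (fun t => G (v + t *: w)) ('D_w G (v + s *: w)).
Proof.
have E : (fun h : R => h^-1 *: (((fun t => G (v + t *: w)) \o shift s) (h *: 1) -
   G (v + s *: w))) =
  (fun h => h^-1 *: ((G \o shift (v + s *: w)) (h *: w) - G (v + s *: w))).
  apply/funext => h /=; congr (_ *: (G _ - _)).
  by rewrite [h *: 1]mulr1 scalerDl addrCA.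
by move=> dG; apply: DeriveDef; rewrite /derivable /derive E.
Qed.

Lemma derive_bound N (G : 'rV[R]_N -> R) K v w (h : R) :
  (forall v, derivable G v w) -> (forall v, `|'D_w G v| <= K) ->
  `|G (v + h *: w) - G v| <= K * `|h|.
Proof.
move=> dG bG.
have dl (s : R) : is_derive s 1 (fun t => G (v + t *: w)) ('D_w G (v + s *: w)).
  exact: derive_line.
have cl (a b : R) : {within `[a, b], continuous (fun t => G (v + t *: w))}.
  apply: continuous_subspaceT => s; apply: differentiable_continuous.
  exact/derivable1_diffP.
have G0 : G v = G (v + 0 *: w) by rewrite scale0r addr0.
have [h0|h0] := leP 0 h.
  have [c _ e] := MVT_segment h0 (fun s _ => dl s) (cl 0 h).
  by rewrite G0 e subr0 normrM ler_wpM2r.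
have [c _ e] := MVT_segment (ltW h0) (fun s _ => dl s) (cl h 0).
by rewrite G0 distrC e sub0r normrM normrN ler_wpM2r.
Qed.

Lemma derive_seq N (G : 'rV[R]_N -> R) v w : derivable G v w ->
  (harmonic k)^-1 * (G (v + harmonic k *: w) - G v) @[k --> \oo] --> 'D_w G v.
Proof.
move=> dG.
have hc : (@harmonic R k) @[k --> \oo] --> (0 : R)^'.
  move=> P [e /= e0 eP]; have := @cvg_harmonic R.
  move/cvgrPdist_lt => /(_ _ e0) [m _ mP]; exists m => // k /mP/= kP.
  by apply: eP => //=; rewrite /harmonic /= invr_eq0 pnatr_eq0.
have := cvg_comp _ _ hc dG.
by apply: cvg_trans; apply: near_eq_cvg; apply: nearW => k /=; rewrite [_ + v]addrC.
Qed.

(** The difference quotients of [G] along [w] have integral zero by translation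
    invariance, and by the mean value inequality they converge boundedly to the
    derivative. *)
Lemma integralR_rV_derive N K L (G : 'rV[R]_N -> R) w : 0 <= L ->
  continuous G -> (forall v, L < `|v| -> G v = 0) ->
  (forall v, derivable G v w) -> (forall v, `|'D_w G v| <= K) ->
  integralR_rV (fun v => 'D_w G v) = 0.
Proof.
move=> L0 cG GL dG bG.
pose h k : R := harmonic k.
have h0 k : 0 < h k by rewrite /h /harmonic /= invr_gt0.
have h1 k : h k <= 1 by rewrite /h /harmonic /= invf_le1// ler1n.
pose q k v := (h k)^-1 * G (v + h k *: w) + (- (h k)^-1) * G v.
have [K' bG'] := continuous_bounded_supp cG GL.
pose L' := L + `|w|.
have L'0 : 0 <= L' by rewrite addr_ge0.
have LL' : L <= L' by rewrite lerDl.
have ws k v : L' < `|v| -> L < `|v + h k *: w|.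
  move=> Lv; have : `|v| <= `|v + h k *: w| + `|h k *: w|.
    by rewrite -{1}(addrK (h k *: w) v) (le_trans (ler_normB _ _)).
  rewrite normrZ (gtr0_norm (h0 k)) => vw.
  have : h k * `|w| <= `|w| by rewrite ler_piMl.
  by rewrite /L' in Lv *; lra.
have ct k : continuous (fun v => G (v + h k *: w)).
  move=> v; have tc : u + h k *: w @[u --> v] --> v + h k *: w.
    exact: (@cvgD _ _ _ (nbhs v) _ id (cst (h k *: w)) _ _ (@cvg_id _ _) (cvg_cst _)).
  exact: (cvg_comp _ _ tc (cG _)).
have bt k : bounded_supp K' L' (fun v => G (v + h k *: w)).
  by split=> [v|v /(ws k)]; [exact: bG'.1|exact: GL].
have bG'' : bounded_supp K' L' G.
  by split=> [v|v Lv]; [exact: bG'.1|apply: GL; exact: le_lt_trans Lv].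
have lin k := iter_measurable_lin (h k)^-1 (- (h k)^-1) L'0
  (iter_measurable_continuous L'0 (ct k) (bt k)) (bt k)
  (iter_measurable_continuous L'0 cG bG'') bG''.
have bq k : bounded_supp K L' (q k).
  split=> v; last first.
    by move=> Lv; rewrite /q (bt k).2// bG''.2// !mulr0 addr0.
  rewrite /q mulNr -mulrBr normrM gtr0_norm ?invr_gt0// mulrC ler_pdivrMr//.
  by rewrite -{2}(gtr0_norm (h0 k)); exact: derive_bound.
have cq v : q k v @[k --> \oo] --> 'D_w G v.
  have := derive_seq (dG v); apply: cvg_trans; apply: near_eq_cvg; apply: nearW => k.
  by rewrite /q mulNr mulrBr.
have [_ lim] := integralR_rV_cvg L'0 (fun k => (lin k).1) bq cq.
have q0 : (fun k => integralR_rV (q k)) = cst 0.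
  apply/funext => k; rewrite (lin k).2 (integralR_rV_translate _ L0 cG bG').
  by rewrite mulNr subrr.
rewrite -(cvg_lim _ lim)// q0; exact: lim_cst.
Qed.

Lemma Rintegral_gt0 K L (g : R -> R) t0 : continuous g -> bounded_supp1 K L g ->
  (forall t, 0 <= g t) -> 0 < g t0 -> 0 < \int[mu]_(t in setT) g t.
Proof.
move=> cg bg g0 gt0.
have := cg t0; move/cvgrPdist_lt => /(_ (g t0 / 2)); rewrite divr_gt0// => /(_ isT).
move=> /nbhs_ballP[d /= d0 dP].
pose I : set R := [set` `[t0, t0 + d / 2]].
have ii : mu.-integrable setT (EFin \o (fun t => g t0 / 2 * \1_I t)).
  have -> : EFin \o (fun t => g t0 / 2 * \1_I t) =
          (fun t => (g t0 / 2)%:E * (\1_I t)%:E)%E.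
    by apply/funext => t; rewrite /= EFinM.
  by apply: integrableZl => //; exact: integrable_indic_itv.
have : \int[mu]_(t in setT) (g t0 / 2 * \1_I t) <= \int[mu]_(t in setT) g t.
  apply: le_Rintegral => //.
    by apply: integrable_bounded_supp1 bg; exact: continuous_measurable_fun.
  move=> t _; rewrite indicE; have [tI|_] := boolP (t \in I); last by rewrite mulr0.
  have := dP t; rewrite /ball /= => H; rewrite mulr1.
  move: tI; rewrite inE /I /= in_itv/= => /andP[t1 t2].
  have /H : `|t0 - t| < d by rewrite distrC ger0_norm ?subr_ge0//; lra.
  by rewrite ltr_norml => /andP[? ?]; lra.
apply: lt_le_trans; rewrite RintegralZl//; last exact: integrable_indic_itv.
have mI : measurable I by exact: measurable_itv.
rewrite mulr_gt0// ?divr_gt0// /Rintegral integral_indic// ?setIT ?setTI.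
have muI : lebesgue_measure I = (d / 2)%:E.
  apply: (etrans (lebesgue_measure_itv `[t0, t0 + d / 2])).
  by rewrite /= lte_fin ltrDl divr_gt0// -EFinB addrAC subrr add0r.
by rewrite [X in fine X](_ : _ = (d / 2)%:E) //= divr_gt0.
Qed.

Lemma integralR_rV_gt0 N K L (f : 'rV[R]_N -> R) v0 : 0 <= L ->
  continuous f -> bounded_supp K L f ->
  (forall v, 0 <= f v) -> 0 < f v0 -> 0 < integralR_rV f.
Proof.
move=> L0; elim: N f v0 => [|M IH] f v0 cf fb f0 fv0 /=.
  by rewrite (_ : 0 = v0)//; apply/rowP => -[].
have mf := iter_measurable_continuous L0 cf fb.
apply: (@Rintegral_gt0 _ _ _ (v0 0 0)) (integralR_rV_supp1 L0 mf fb) _ _.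
- exact: integralR_slice_continuous fb mf.1.
- have b0 : bounded_supp 0 L (fun _ : 'rV[R]_M => 0).
    by split=> // v; rewrite normr0.
  have m0 : iter_measurable (fun _ : 'rV[R]_M => 0 : R).
    by apply: (iter_measurable_continuous L0 _ b0); exact: cst_continuous.
  move=> t; rewrite -(integralR_rV0 R M).
  by apply: (integralR_rV_mono L0 m0 b0 (mf.1 t) (bounded_supp_cons t fb)).
- apply: (IH _ (\row_j v0 0 (lift ord0 j))) => //.
  + exact: continuous_cons.
  + exact: bounded_supp_cons.
  + rewrite (_ : rV_cons _ _ = v0)//.
    apply/rowP => j; have [k ->|->] := unliftP ord0 j; last by rewrite rV_cons0.
    by rewrite rV_consS mxE.
Qed.

End Translation.

(** * Euclidean geometry and the radial retraction *)

Section Euclid.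
Variables (R : realType) (N : nat).
Implicit Types (u v w x y : 'rV[R]_N).

Lemma dotpE u v : dotp u v = \sum_j u 0 j * v 0 j.
Proof. by rewrite /dotp mxE; apply: eq_bigr => j _; rewrite mxE. Qed.

Lemma dotpC u v : dotp u v = dotp v u.
Proof. by rewrite !dotpE; apply: eq_bigr => j _; rewrite mulrC. Qed.

Lemma dotpDl u v w : dotp (u + v) w = dotp u w + dotp v w.
Proof. by rewrite /dotp mulmxDl mxE. Qed.

Lemma dotpZl a u v : dotp (a *: u) v = a * dotp u v.
Proof. by rewrite /dotp -scalemxAl mxE. Qed.

Lemma dotpDr u v w : dotp w (u + v) = dotp w u + dotp w v.
Proof. by rewrite dotpC dotpDl !(dotpC w). Qed.

Lemma dotpZr a u v : dotp u (a *: v) = a * dotp u v.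
Proof. by rewrite dotpC dotpZl dotpC. Qed.

Lemma dotp_delta y j : dotp y (delta_mx 0 j) = y 0 j.
Proof.
rewrite dotpE (bigD1 j)//= mxE !eqxx mulr1 big1 ?addr0// => i ij.
by rewrite mxE (negbTE ij) andbF mulr0.
Qed.

Lemma dotpp_ge0 y : 0 <= dotp y y.
Proof. by rewrite dotpE sumr_ge0// => j _; rewrite -expr2 sqr_ge0. Qed.

Lemma dotpp_eq0 y : (dotp y y == 0) = (y == 0).
Proof.
apply/eqP/eqP => [|->]; last by rewrite -(scale0r (0 : 'rV_N)) dotpZl mul0r.
rewrite dotpE => /eqP; rewrite psumr_eq0; last by move=> j _; rewrite -expr2 sqr_ge0.
move=> /allP h; apply/rowP => j; rewrite mxE.
by have := h j (mem_index_enum _); rewrite /= -expr2 sqrf_eq0 => /eqP.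
Qed.

Lemma dotpp_gt0 y : y != 0 -> 0 < dotp y y.
Proof. by move=> y0; rewrite lt_def dotpp_eq0 y0 dotpp_ge0. Qed.

Lemma enorm_sqr y : enorm y ^+ 2 = dotp y y.
Proof. by rewrite sqr_sqrtr// dotpp_ge0. Qed.

Lemma enorm_ge0 y : 0 <= enorm y.
Proof. exact: sqrtr_ge0. Qed.

Lemma enorm_gt0 y : y != 0 -> 0 < enorm y.
Proof. by move=> y0; rewrite sqrtr_gt0 dotpp_gt0. Qed.

Lemma enorm0 : enorm (0 : 'rV[R]_N) = 0.
Proof. by rewrite /enorm (eqP (_ : dotp 0 0 == 0)) ?dotpp_eq0// sqrtr0. Qed.

Lemma enormZ a y : enorm (a *: y) = `|a| * enorm y.
Proof. by rewrite /enorm dotpZl dotpZr mulrA -expr2 sqrtrM ?sqr_ge0// sqrtr_sqr. Qed.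

Lemma sphere_neq0 x : sphere x -> x != 0.
Proof. by move=> /= x1; rewrite -dotpp_eq0 -enorm_sqr x1 expr1n oner_neq0. Qed.

Lemma sphere_dotp x : sphere x -> dotp x x = 1.
Proof. by move=> /= x1; rewrite -enorm_sqr x1 expr1n. Qed.

Lemma sphere_delta j : sphere (delta_mx 0 j : 'rV[R]_N).
Proof. by rewrite /sphere /= /enorm dotp_delta mxE !eqxx sqrtr1. Qed.

Lemma retract_sphere y : y != 0 -> sphere (retract y).
Proof.
move=> y0; rewrite /sphere /= /retract enormZ ger0_norm ?invr_ge0 ?enorm_ge0//.
by rewrite mulVf// gt_eqF// enorm_gt0.
Qed.

Lemma retractK x : sphere x -> retract x = x.
Proof. by rewrite /sphere /= => x1; rewrite /retract x1 invr1 scale1r. Qed.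

Lemma retract0 : retract (0 : 'rV[R]_N) = 0.
Proof. by rewrite /retract scaler0. Qed.

Lemma norm_le_enorm y : `|y| <= enorm y.
Proof.
apply/mx_norm_leP => [|i j]; first exact: enorm_ge0.
rewrite ord1 -sqrtr_sqr ler_wsqrtr// dotpE (bigD1 j)//= -expr2 lerDl.
by rewrite sumr_ge0// => k _; rewrite -expr2 sqr_ge0.
Qed.

Lemma norm_gt1_dotp y : 1 < `|y| -> 1 < dotp y y.
Proof.
move=> y1; rewrite -enorm_sqr expr_gt1//; last exact: enorm_ge0.
exact: lt_le_trans (norm_le_enorm y).
Qed.

Lemma differentiable_dotpp y : differentiable (fun y => dotp y y) y.
Proof.
rewrite (_ : (fun y => _) = \sum_j (fun y : 'rV[R]_N => y 0 j * y 0 j)).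
  apply: differentiable_sum => j.
  by apply: differentiableM; exact: differentiable_coord.
by apply/funext => x; rewrite dotpE fct_sumE.
Qed.

Lemma continuous_dotpp : continuous (fun y => dotp y y).
Proof. by move=> y; exact: differentiable_continuous (differentiable_dotpp y). Qed.

Lemma continuous_enorm : continuous (@enorm R N).
Proof.
by move=> y; exact: (cvg_comp _ _ (continuous_dotpp (x := y)) (@sqrt_continuous _ _)).
Qed.

(** The forms are pulled back to the complement of the origin; this is what lets
    identities valid there be differentiated. *)
Lemma near_neq0 y : y != 0 -> \forall z \near y, z != 0.
Proof.
move=> y0; have h : \forall z \near y, 0 < enorm z.
  by apply: (cvgr_gt _ (@continuous_enorm y)); exact: enorm_gt0.
by apply: filterS h => z; apply: contraTneq => ->; rewrite enorm0 ltxx.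
Qed.

Lemma continuous_retract y : y != 0 -> {for y, continuous (@retract R N)}.
Proof.
move=> y0; apply: (@cvgZ _ _ _ (nbhs y)); last exact: cvg_id.
by apply: (@cvgV _ _ (nbhs y)); [rewrite gt_eqF// enorm_gt0|exact: continuous_enorm].
Qed.

Lemma is_derive_comp1 (g : R -> R) (f : 'rV[R]_N -> R) y w dg :
  is_derive (f y) 1 g dg -> differentiable f y ->
  is_derive y w (g \o f) (dg * 'D_w f y).
Proof.
move=> dgf df.
have dg' : differentiable g (f y) by apply/derivable1_diffP.
have dc : differentiable (g \o f) y by exact: differentiable_comp.
apply: DeriveDef; first exact: diff_derivable.
have dlin (c : R) : 'd g (f y) c = c * dg.
  have -> : c = c *: (1 : R) by rewrite /GRing.scale/= mulr1.
  by rewrite linearZ /= -deriveE// derive_val /GRing.scale/= mulr1.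
by rewrite deriveE// diff_comp//= dlin mulrC -deriveE.
Qed.

Lemma derive_dotpp y w : 'D_w (fun y => dotp y y) y = 2 * dotp y w.
Proof.
apply: cvg_lim => //.
have E : \forall h \near (0 : R)^', 2 * dotp y w + h * dotp w w =
   h^-1 *: (((fun y => dotp y y) \o shift y) (h *: w) - dotp y y).
  near=> h; have h0 : h != 0 by near: h; exact: nbhs_dnbhs_neq.
  rewrite /= !(dotpDl, dotpDr, dotpZl, dotpZr) (dotpC w y) /GRing.scale/=.
  by field.
apply: cvg_trans (near_eq_cvg E) _.
have : (2 * dotp y w + h * dotp w w) @[h --> (0:R)] --> 2 * dotp y w + 0 * dotp w w.
  by apply: cvgD; [exact: cvg_cst|apply: cvgMr_tmp; exact: cvg_id].
by rewrite mul0r addr0; apply: cvg_trans; apply: cvg_app; exact: cvg_within.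
Unshelve. all: by end_near. Qed.

Lemma is_derive_enorm y w : y != 0 ->
  is_derive y w (@enorm R N) (dotp y w / enorm y).
Proof.
move=> y0; have d0 := dotpp_gt0 y0.
have := is_derive_comp1 (f := fun z => dotp z z) w (is_derive1_sqrt d0) (differentiable_dotpp y).
rewrite derive_dotpp => D; suff -> : dotp y w / enorm y =
  (2 * Num.sqrt (dotp y y))^-1 * (2 * dotp y w) by [].
by rewrite -[Num.sqrt _]/(enorm y); field; rewrite gt_eqF// enorm_gt0.
Qed.

Lemma is_derive_retract y w : y != 0 ->
  is_derive y w (@retract R N) ((enorm y)^-1 *: tproj (retract y) w).
Proof.
move=> y0; have e0 : enorm y != 0 by rewrite gt_eqF// enorm_gt0.
have dj j : is_derive y w (fun z => (@retract R N z) 0 j)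
    (((enorm y)^-1 *: tproj (retract y) w) 0 j).
  have -> : (fun z => (@retract R N z) 0 j) =
     (fun z => (enorm z)^-1) * (fun z : 'rV[R]_N => z 0 j).
    by apply/funext => z; rewrite /retract mxE.
  have dc : is_derive y w (fun z : 'rV[R]_N => z 0 j) (w 0 j).
    apply: DeriveDef; first by apply: diff_derivable; exact: differentiable_coord.
    apply: cvg_lim => //.
    have E : \forall h \near (0 : R)^', w 0 j =
       h^-1 *: (((fun z : 'rV[R]_N => z 0 j) \o shift y) (h *: w) - y 0 j).
      near=> h; have h0 : h != 0 by near: h; exact: nbhs_dnbhs_neq.
      by rewrite /= !mxE addrK /GRing.scale/= mulKf.
    by apply: cvg_trans (near_eq_cvg E) _; exact: cvg_cst.
  have dv : is_derive y w (fun z => (enorm z)^-1) (- (enorm y) ^- 2 *: (dotp y w / enorm y)).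
    have de := is_derive_enorm w y0.
    apply: DeriveDef; first by apply: derivableV => //.
    by rewrite deriveV//; rewrite derive_val.
  apply: is_derive_eq; rewrite /tproj !mxE /retract dotpZr (dotpC w) /GRing.scale/=.
  by field.
apply: DeriveDef.
  apply/derivable_mxP => i j; rewrite ord1.
  by have := dj j.
rewrite derive_mx; last by apply/derivable_mxP => i j; rewrite ord1; have := dj j.
by apply/rowP => j; rewrite !mxE; have := dj j => d; rewrite derive_val !mxE.
Unshelve. all: by end_near. Qed.

End Euclid.

(** * Cutoff functions of class C^1 *)

Section C1.
Variable R : realType.
Implicit Types (f g : R -> R) (s u : R).

Definition C1 f := exists df : R -> R,
  continuous df /\ forall s : R, is_derive s (1 : R) f (df s).

Lemma is_derive1_continuous f (s df : R) : is_derive s (1 : R) f df -> {for s, continuous f}.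
Proof. by move=> d; apply: differentiable_continuous; apply/derivable1_diffP. Qed.

Lemma C1_continuous f : C1 f -> continuous f.
Proof. by move=> [df [_ d]] s; exact: is_derive1_continuous (d s). Qed.

Lemma C1_comp f g : C1 f -> C1 g -> C1 (f \o g).
Proof.
move=> [df [cf f']] cg; have cg0 := C1_continuous cg; case: cg => dg [cg g'].
exists (fun s => df (g s) * dg s); split=> s.
  apply: cvgM; last exact: cg.
  exact: (cvg_comp _ _ (cg0 s) (cf (g s))).
exact: (@is_derive1_comp _ f g s _ _ (f' _) (g' _)).
Qed.

Lemma C1_mul f g : C1 f -> C1 g -> C1 (fun s => f s * g s).
Proof.
move=> Cf Cg; have cf0 := C1_continuous Cf; have cg0 := C1_continuous Cg.
case: Cf => df [cf f']; case: Cg => dg [cg g'].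
exists (fun s => f s * dg s + g s * df s); split=> s.
  by apply: cvgD; apply: cvgM; [exact: cf0|exact: cg|exact: cg0|exact: cf].
have [? ?] := (f' s, g' s).
by apply: is_derive_eq.
Qed.

Lemma C1_affine (a b : R) : C1 (fun s => a * s + b).
Proof.
exists (cst a); split=> s; first exact: cst_continuous.
by apply: is_derive_eq; rewrite /GRing.scale/=; ring.
Qed.

Lemma C1_exp p : C1 (fun s => s ^+ p).
Proof.
elim: p => [|p IH].
  rewrite (_ : (fun s => _) = (fun s => 0 * s + 1)); first exact: C1_affine.
  by apply/funext => s; rewrite expr0 mul0r add0r.
rewrite (_ : (fun s => _) = (fun s => (1 * s + 0) * s ^+ p)).
  by apply: C1_mul => //; exact: C1_affine.
by apply/funext => s; rewrite exprS mul1r addr0.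
Qed.

Definition pospart u : R := (`|u| + u) / 2.

Lemma pospart_ge0 u : 0 <= u -> pospart u = u.
Proof. by move=> u0; rewrite /pospart ger0_norm//; lra. Qed.

Lemma pospart_le0 u : u <= 0 -> pospart u = 0.
Proof. by move=> u0; rewrite /pospart ler0_norm//; lra. Qed.

Lemma continuous_pospart : continuous pospart.
Proof.
move=> u; apply: cvgMr_tmp; apply: cvgD; last exact: cvg_id.
exact: norm_continuous.
Qed.

(** The simplest function of class C^1 vanishing exactly on a half-line; all
    cutoffs below are built from it by composition and product. *)
Definition sqpos u : R := pospart u ^+ 2.

Lemma sqpos_ge0 u : 0 <= sqpos u. Proof. exact: sqr_ge0. Qed.

Lemma sqpos_le0 u : u <= 0 -> sqpos u = 0.
Proof. by move=> u0; rewrite /sqpos pospart_le0// expr0n. Qed.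

Lemma sqposE u : 0 <= u -> sqpos u = u ^+ 2.
Proof. by move=> u0; rewrite /sqpos pospart_ge0. Qed.

Lemma sqpos_mono u s : u <= s -> sqpos u <= sqpos s.
Proof.
move=> us; have [u0|u0] := leP u 0; first by rewrite sqpos_le0// sqpos_ge0.
by rewrite !sqposE ?ler_sqr ?nnegrE// ?ltW// (lt_le_trans u0).
Qed.

Lemma sqpos_bound u h : `|sqpos (u + h) - sqpos u - 2 * pospart u * h| <= h ^+ 2.
Proof.
rewrite ler_norml /sqpos; have [u0|u0] := leP 0 u.
  rewrite (pospart_ge0 u0); have [v0|v0] := leP 0 (u + h).
    by rewrite pospart_ge0//; nra.
  by rewrite (pospart_le0 (ltW v0)); nra.
rewrite (pospart_le0 (ltW u0)); have [v0|v0] := leP 0 (u + h).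
  by rewrite pospart_ge0//; nra.
by rewrite (pospart_le0 (ltW v0)); nra.
Qed.

Lemma C1_sqpos : C1 sqpos.
Proof.
exists (fun u => 2 * pospart u); split=> u.
  by apply: cvgMl_tmp; exact: continuous_pospart.
have lim : h^-1 *: ((sqpos \o shift u) (h *: 1) - sqpos u) @[h --> 0^'] --> 2 * pospart u.
  apply/cvgrPdist_le => e e0; near=> h.
  have h0 : h != 0 by near: h; exact: nbhs_dnbhs_neq.
  have he : `|h| <= e by near: h; exact: dnbhs0_le.
  apply: le_trans he; rewrite /= distrC.
  have -> : h^-1 *: (sqpos (h *: 1 + u) - sqpos u) - 2 * pospart u =
     h^-1 * (sqpos (u + h) - sqpos u - 2 * pospart u * h).
    by rewrite /GRing.scale/= mulr1 (addrC h); field.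
  rewrite normrM normfV mulrC ler_pdivrMr ?normr_gt0//.
  by rewrite -expr2 -normrX (ger0_norm (sqr_ge0 h)) sqpos_bound.
apply: DeriveDef; first by apply/cvg_ex; exists (2 * pospart u).
exact: cvg_lim.
Unshelve. all: by end_near. Qed.

(** A C^1 step from 0 (for [u <= 0]) to 1 (for [1 <= u]): the inner expression is
    [1 - (1 - u)^2] on the left of 1 and is constant after it. *)
Definition step u : R := sqpos (1 - sqpos (1 - u)).

Lemma step_le0 u : u <= 0 -> step u = 0.
Proof.
move=> u0; rewrite /step sqpos_le0// sqposE; last by lra.
by nra.
Qed.

Lemma step_ge1 u : 1 <= u -> step u = 1.
Proof.
move=> u1; rewrite /step (sqpos_le0 (_ : 1 - u <= 0)); last by lra.
by rewrite subr0 sqposE// expr1n.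
Qed.

Lemma step_ge0 u : 0 <= step u. Proof. exact: sqpos_ge0. Qed.

Lemma step_mono u s : u <= s -> step u <= step s.
Proof. by move=> us; rewrite sqpos_mono// lerD2l lerN2 sqpos_mono// lerD2l lerN2. Qed.

Lemma step_le1 u : step u <= 1.
Proof.
have [u1|/ltW u1] := leP u 1; last by rewrite step_ge1.
by rewrite -(step_ge1 (lexx 1)) step_mono.
Qed.

Lemma C1_step : C1 step.
Proof.
have E (a b : R) : (fun s => a - sqpos s) = (fun s => -1 * s + a) \o sqpos.
  by apply/funext => s /=; ring.
rewrite (_ : step = sqpos \o ((fun s => -1 * s + 1) \o (sqpos \o (fun s => -1 * s + 1)))).
  by do !apply: C1_comp; do ?[exact: C1_sqpos|exact: C1_affine].
apply/funext => s; rewrite /step /=; congr sqpos.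
by rewrite !mulN1r addrC (addrC (- s)).
Qed.

(** As [k] grows, these functions, supported in the interval from [1/k] to 1,
    increase to the indicator of the open interval from 0 to 1. *)
Definition bump01 k s : R := step (k * s - 1) * step (k * (1 - s)).

Lemma bump01_ge0 k s : 0 <= bump01 k s. Proof. by rewrite mulr_ge0 ?step_ge0. Qed.

Lemma bump01_le1 k s : bump01 k s <= 1.
Proof. by rewrite mulr_ile1 ?step_ge0 ?step_le1. Qed.

Lemma bump01_small k s : 0 < k -> s <= k^-1 -> bump01 k s = 0.
Proof.
move=> k0 sk; rewrite /bump01 step_le0 ?mul0r// subr_le0.
by rewrite -(mulfV (lt0r_neq0 k0)) ler_pM2l.
Qed.

Lemma bump01_ge1 k s : 0 < k -> 1 <= s -> bump01 k s = 0.
Proof. by move=> k0 s1; rewrite /bump01 [X in _ * X]step_le0 ?mulr0// pmulr_rle0// subr_le0. Qed.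

Lemma bump01_eq1 k s : 2 <= k * s -> 1 <= k * (1 - s) -> bump01 k s = 1.
Proof. by move=> h1 h2; rewrite /bump01 !step_ge1 ?mulr1//; lra. Qed.

Lemma bump01_mono k l s : 0 <= k -> k <= l -> 0 <= s -> bump01 k s <= bump01 l s.
Proof.
move=> k0 kl s0; have [s1|s1] := leP s 1; last first.
  by rewrite /bump01 [X in _ * X <= _]step_le0 ?mulr0 ?bump01_ge0//; nra.
rewrite ler_pM ?step_ge0// step_mono//; first by rewrite lerD2r ler_wpM2r.
by rewrite ler_wpM2r// subr_ge0.
Qed.

Lemma C1_bump01 k : C1 (bump01 k).
Proof.
rewrite (_ : bump01 k = (fun s => (step \o (fun s => k * s + (-1))) s *
                               (step \o (fun s => - k * s + k)) s)).
  by apply: C1_mul; apply: C1_comp; do ?[exact: C1_step|exact: C1_affine].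
by apply/funext => s; rewrite /bump01 /=; congr (_ * step _); ring.
Qed.

End C1.

(** * The divergence theorem with a radial cutoff *)

Section Radial.
Variables (R : realType) (N : nat).
Implicit Types (v w x y : 'rV[R]_N) (H : 'rV[R]_N -> R) (rho : R -> R).

Lemma continuous_dotpl w : continuous (fun z => dotp z w).
Proof.
rewrite (_ : (fun z => _) = \sum_j (fun z : 'rV[R]_N => z 0 j * w 0 j)).
  move=> y; apply: differentiable_continuous; apply: differentiable_sum => j.
  by apply: differentiableM => //; exact: differentiable_coord.
by apply/funext => z; rewrite dotpE fct_sumE.
Qed.

Lemma near0_dotp (e : R) : 0 < e -> \forall z \near (0 : 'rV[R]_N), dotp z z < e.
Proof.
move=> e0; apply: (cvgr_lt _ (@continuous_dotpp R N 0)).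
by rewrite (eqP (_ : dotp 0 0 == 0)) ?dotpp_eq0.
Qed.

Lemma continuous_radial rho e H : 0 < e -> continuous rho ->
  (forall s, s < e -> rho s = 0) ->
  (forall y, y != 0 -> {for y, continuous H}) ->
  continuous (fun y => rho (dotp y y) * H y).
Proof.
move=> e0 cr r0 cH y; have [->|y0] := eqVneq y 0.
  rewrite /continuous_at r0; last by rewrite (eqP (_ : dotp 0 0 == 0)) ?dotpp_eq0.
  have E : \forall z \near (0 : 'rV[R]_N), cst 0 z = rho (dotp z z) * H z.
    by near=> z; rewrite r0 ?mul0r//; near: z; exact: near0_dotp.
  by rewrite mul0r; apply: cvg_trans (near_eq_cvg E) _; exact: (@cvg_cst _ _ _ (nbhs _)).
apply: (@cvgM _ _ (nbhs y)); last exact: cH.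
exact: (cvg_comp _ _ (@continuous_dotpp R N y) (cr _)).
Unshelve. all: by end_near. Qed.

(** The formula persists at the origin, where [H] may be singular, because the
    cutoff vanishes nearby. *)
Lemma is_derive_radial rho (drho : R -> R) e H y w : 0 < e ->
  (forall s : R, is_derive s (1 : R) rho (drho s)) ->
  (forall s, s < e -> rho s = 0) ->
  (y != 0 -> derivable H y w) ->
  is_derive y w (fun z => rho (dotp z z) * H z)
    (drho (dotp y y) * (2 * dotp y w) * H y + rho (dotp y y) * 'D_w H y).
Proof.
move=> e0 dr r0 dH; have [y0|y0] := eqVneq y 0.
  have d0 : dotp y y = 0 by apply/eqP; rewrite dotpp_eq0 y0.
  have -> : dotp y w = 0.
    by rewrite y0 -(scale0r (0 : 'rV[R]_N)) dotpZl mul0r.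
  rewrite d0 (r0 0)// !(mulr0, mul0r) addr0.
  apply: (@near_eq_is_derive _ _ _ (cst 0)).
  rewrite y0; near=> z; rewrite r0 ?mul0r//.
  near: z; exact: near0_dotp.
have D1 := is_derive_comp1 (f := fun z => dotp z z) w (dr (dotp y y)) (differentiable_dotpp y).
rewrite derive_dotpp in D1.
have D2 := derivableP (dH y0).
have := is_deriveM D1 D2; rewrite /GRing.scale/= => D.
rewrite (_ : _ + _ = rho (dotp y y) * 'D_w H y + H y * (drho (dotp y y) * (2 * dotp y w))) //.
by ring.
Unshelve. all: by end_near. Qed.

Lemma is_derive_vanish rho (drho : R -> R) (A : set R) s : open A ->
  (forall s : R, is_derive s (1 : R) rho (drho s)) ->
  (forall s, A s -> rho s = 0) -> A s -> drho s = 0.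
Proof.
move=> oA dr r0 As; have := dr s => D.
have D0 : is_derive s (1 : R) rho 0.
  apply: (@near_eq_is_derive _ _ _ (cst 0)).
  by near=> z; rewrite r0//; near: z; exact: open_nbhs_nbhs.
by rewrite -(@derive_val _ _ _ _ _ _ _ D) (@derive_val _ _ _ _ _ _ _ D0).
Unshelve. all: by end_near. Qed.

Lemma integralR_rV_sum0 (I : Type) (r : seq I) (F : I -> 'rV[R]_N -> R) L : 0 <= L ->
  (forall i, iter_measurable (F i)) -> (forall i, exists K, bounded_supp K L (F i)) ->
  (forall i, integralR_rV (F i) = 0) ->
  [/\ iter_measurable (fun v => \sum_(i <- r) F i v),
      exists K, bounded_supp K L (fun v => \sum_(i <- r) F i v) &
      integralR_rV (fun v => \sum_(i <- r) F i v) = 0].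
Proof.
move=> L0 mF bF iF; elim: r => [|i r [m [K b] j]].
  rewrite (_ : (fun v => _) = fun=> 0); last by apply/funext => v; rewrite big_nil.
  have b0 : bounded_supp 0 L (fun _ : 'rV[R]_N => 0).
    by split=> // v; rewrite normr0.
  split; [|by exists 0|exact: integralR_rV0].
  by apply: (iter_measurable_continuous L0 _ b0); exact: cst_continuous.
have [K' b'] := bF i.
rewrite (_ : (fun v => _) = fun v => 1 * F i v + 1 * \sum_(i <- r) F i v); last first.
  by apply/funext => v; rewrite big_cons !mul1r.
have [m' e] := iter_measurable_lin 1 1 L0 (mF i) b' m b.
split=> //; last by rewrite e iF j !mulr0 addr0.
exists (K' + K); split=> v.
  by rewrite !mul1r (le_trans (ler_normD _ _))// lerD//; [exact: b'.1|exact: b.1].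
by move=> Lv; rewrite b'.2// b.2// !mulr0 addr0.
Qed.

(** The gradient of a radial cutoff is radial, so a cutoff does not disturb the
    divergence of a field [\sum_i H_i w_i] tangent to the spheres: the extra terms
    [2 rho' <y, w_i> H_i] add up to zero, and what remains is a sum of derivatives
    of functions of compact support. *)
Lemma radial_divergence (I : finType) (H : I -> 'rV[R]_N -> R) (w : I -> 'rV[R]_N) rho e :
  0 < e -> C1 rho -> (forall s, s < e -> rho s = 0) -> (forall s, 1 <= s -> rho s = 0) ->
  (forall i y, y != 0 -> differentiable (H i) y) ->
  (forall i y, y != 0 -> {for y, continuous (fun z => 'D_(w i) (H i) z)}) ->
  (forall y, y != 0 -> \sum_i dotp y (w i) * H i y = 0) ->
  integralR_rV (fun y => rho (dotp y y) * \sum_i 'D_(w i) (H i) y) = 0.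
Proof.
move=> e0 Cr r0 r1 dH cdH tan; have cr := C1_continuous Cr; case: Cr => drho [cdr dr].
have dr0 s : s < e -> drho s = 0.
  by apply: (is_derive_vanish (A := [set s | s < e])) dr r0; exact: open_lt.
have dr1 s : 1 < s -> drho s = 0.
  apply: (is_derive_vanish (A := [set s | 1 < s])) dr _; first exact: open_gt.
  by move=> t /ltW; exact: r1.
pose G i y := rho (dotp y y) * H i y.
have dG i y : is_derive y (w i) (G i) (drho (dotp y y) * (2 * dotp y (w i)) * H i y +
    rho (dotp y y) * 'D_(w i) (H i) y).
  by apply: is_derive_radial e0 dr r0 _ => y0; exact/diff_derivable/dH.
have cH i y : y != 0 -> {for y, continuous (H i)}.
  by move=> y0; apply: differentiable_continuous; exact: dH.
have cG i : continuous (G i) by apply: continuous_radial e0 cr r0 (cH i).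
have GL i v : 1 < `|v| -> G i v = 0.
  by move=> /norm_gt1_dotp/ltW v1; rewrite /G r1 ?mul0r.
have DG i : (fun y => 'D_(w i) (G i) y) = (fun y => drho (dotp y y) * (2 * dotp y (w i) * H i y) +
    rho (dotp y y) * 'D_(w i) (H i) y).
  by rewrite funeqE => y; have := dG i y => D; rewrite derive_val -mulrA.
have cdG i : continuous (fun y => 'D_(w i) (G i) y).
  rewrite DG => y; apply: (@cvgD _ _ _ (nbhs y)).
    apply: (continuous_radial e0 cdr dr0) => {}y y0.
    apply: (@cvgM _ _ (nbhs y)); last exact: cH.
    apply: (@cvgMl_tmp _ _ (nbhs y)).
    exact: continuous_dotpl.
  exact: (continuous_radial e0 cr r0 (cdH i)).
have DGL i v : 1 < `|v| -> 'D_(w i) (G i) v = 0.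
  move=> /norm_gt1_dotp v1; rewrite [LHS](congr1 (fun f => f v) (DG i)) dr1// r1 ?ltW//.
  by rewrite !mul0r addr0.
have bdG i : exists K, bounded_supp K 1 (fun y => 'D_(w i) (G i) y).
  exact: continuous_bounded_supp (cdG i) (DGL i).
have mdG i : iter_measurable (fun y => 'D_(w i) (G i) y).
  by have [K b] := bdG i; exact: (iter_measurable_continuous ler01 (cdG i) b).
have idG i : integralR_rV (fun y => 'D_(w i) (G i) y) = 0.
  have [K b] := bdG i.
  by apply: (integralR_rV_derive ler01 (cG i) (GL i) _ b.1) => v; have := dG i v.
have [_ _ tot] := integralR_rV_sum0 (index_enum I) ler01 mdG bdG idG.
rewrite -[RHS]tot.
congr integralR_rV; apply/funext => y.
rewrite (eq_bigr _ (fun i _ => congr1 (fun f => f y) (DG i))).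
rewrite big_split /= -!mulr_sumr.
have [y0|/tan t] := eqVneq y 0.
  have d0 : dotp y y = 0 by apply/eqP; rewrite dotpp_eq0 y0.
  by rewrite d0 dr0// mul0r add0r.
under [X in drho _ * X]eq_bigr do rewrite -mulrA.
by rewrite -mulr_sumr t !mulr0 add0r.
Qed.

End Radial.

(** * Integration over the sphere *)

Section SphereIntegral.
Variables (R : realType) (n : nat).
Notation V := 'rV[R]_n.+1.
Implicit Types (f g : V -> R) (x y v : V).

(** Continuity on the sphere, tested on the extension of [f] which is constant on
    rays. *)
Definition sphere_cont f :=
  forall y, y != 0 -> {for y, continuous (fun z => f (retract z))}.

(** The integrand of [integral_sphere], made continuous by a radial cutoff near the
    origin and near the sphere. *)
Definition annulus (k : nat) f y := bump01 (k.+1%:R : R) (dotp y y) * f (retract y).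

(** The value of the integrand of [integral_sphere] at the origin, [f 0], is missed
    by the functions [annulus k f].  Since iterated integrals are compared through
    pointwise limits, this one point has to be accounted for: [f 0 * tent k]
    supplies the value and has an integral tending to zero. *)
Definition tent (k : nat) y : R := pospart (1 - k.+1%:R * `|y|).

Lemma tent0 k : tent k 0 = 1.
Proof. by rewrite /tent normr0 mulr0 subr0 pospart_ge0. Qed.

Lemma tent_eq0 k y : k.+1%:R^-1 < `|y| -> tent k y = 0.
Proof.
move=> h; rewrite /tent pospart_le0// subr_le0 ltW//.
by rewrite -ltr_pdivrMl ?ltr0Sn// mulr1.
Qed.

Lemma tent_norm k y : `|tent k y| <= 1.
Proof.
rewrite /tent; have [h|h] := leP 0 (1 - k.+1%:R * `|y|).
  by rewrite pospart_ge0// ger0_norm// gerBl mulr_ge0.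
by rewrite (pospart_le0 (ltW h)) normr0.
Qed.

Lemma tent_continuous k : continuous (tent k).
Proof.
move=> y.
have c : 1 - k.+1%:R * `|z| @[z --> y] --> 1 - k.+1%:R * `|y|.
  apply: (@cvgB _ _ _ (nbhs y)); first exact: (@cvg_cst _ _ _ (nbhs y)).
  by apply: (@cvgMl_tmp _ _ (nbhs y)); exact: norm_continuous.
exact: (cvg_comp _ _ c (@continuous_pospart R _)).
Qed.

Lemma tent_supp k : bounded_supp 1 (k.+1%:R^-1) (tent k).
Proof. by split=> v; [exact: tent_norm|exact: tent_eq0]. Qed.

Lemma invSn_le1 (k : nat) : k.+1%:R^-1 <= 1 :> R.
Proof. by rewrite invf_le1// ?ler1n// ltr0Sn. Qed.

Lemma tent_supp1 k : bounded_supp 1 1 (tent k).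
Proof.
split=> v; first exact: tent_norm.
by move=> v1; rewrite tent_eq0// (le_lt_trans (invSn_le1 k)).
Qed.

Lemma integral_tent_cvg0 : integralR_rV (tent k) @[k --> \oo] --> (0 : R).
Proof.
have h (k : nat) : 0 <= integralR_rV (tent k) <= 2 ^+ n.+1 * k.+1%:R^-1.
  have m := iter_measurable_continuous ler01 (@tent_continuous k) (tent_supp1 k).
  apply/andP; split.
    have b0 : bounded_supp 0 1 (fun _ : V => 0 : R) by split=> // v; rewrite normr0.
    have m0 : iter_measurable (fun _ : V => 0 : R).
      by apply: (iter_measurable_continuous ler01 _ b0); exact: cst_continuous.
    rewrite -(integralR_rV0 R n.+1); apply: (integralR_rV_mono ler01 m0 b0 m (tent_supp1 k)) => v.
    rewrite /tent; have [h|h] := leP 0 (1 - k.+1%:R * `|v|); first by rewrite pospart_ge0.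
    by rewrite (pospart_le0 (ltW h)).
  have L0 : 0 <= k.+1%:R^-1 :> R by rewrite invr_ge0.
  rewrite (le_trans (ler_norm _))// (le_trans (integralR_rV_le L0 m (tent_supp k)))//.
  rewrite mul1r -[_^-1 *+ 2]mulr_natl exprMn ler_wpM2l ?exprn_ge0//.
  by rewrite exprS ler_piMr// exprn_ile1// invSn_le1.
apply: (squeeze_cvgr (nearW _ h)); first exact: cvg_cst.
rewrite -(mulr0 (2 ^+ n.+1)); apply: cvgMl_tmp; exact: cvg_harmonic.
Qed.

Lemma annulus_continuous k f : sphere_cont f -> continuous (annulus k f).
Proof.
move=> cf; apply: (@continuous_radial _ _ _ k.+1%:R^-1).
- by rewrite invr_gt0.
- exact: C1_continuous (C1_bump01 _).
- by move=> s /ltW sk; rewrite bump01_small.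
- exact: cf.
Qed.

(** The function [f], extended along rays and cut off to a shell around the
    sphere, is continuous with compact support. *)
Lemma sphere_bounded f : sphere_cont f -> exists K, forall x, sphere x -> `|f x| <= K.
Proof.
(* [bump01 4 (s / 2)] is 1 at [s = 1] and vanishes for [2 <= s]. *)
move=> cf; pose rho : R -> R := bump01 4 \o (fun s => 2^-1 * s + 0).
have crho : C1 rho by apply: C1_comp; [exact: C1_bump01|exact: C1_affine].
have rhoE s : rho s = bump01 4 (2^-1 * s) by rewrite /rho /= addr0.
pose F y := rho (dotp y y) * f (retract y).
have cF : continuous F.
  apply: (@continuous_radial _ _ rho 2^-1) => //.
  - exact: C1_continuous.
  - by move=> s s1; rewrite rhoE bump01_small//; lra.
have [|K [bK _]] := @continuous_bounded_supp _ _ 2 F cF.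
  move=> v v2; rewrite /F rhoE bump01_ge1 ?mul0r//.
  have : 2 < enorm v by exact: lt_le_trans (norm_le_enorm v).
  by rewrite -enorm_sqr; nra.
exists K => x Sx; have := bK x.
by rewrite /F rhoE retractK// sphere_dotp// bump01_eq1 ?mul1r//; lra.
Qed.

Lemma annulus_supp K k f : 0 <= K -> (forall x, sphere x -> `|f x| <= K) ->
  bounded_supp K 1 (annulus k f).
Proof.
move=> K0 fK; split=> v; last first.
  by move=> /norm_gt1_dotp/ltW v1; rewrite /annulus bump01_ge1 ?mul0r.
rewrite /annulus; have [v0|v0] := eqVneq v 0.
  have -> : dotp v v = 0 by apply/eqP; rewrite dotpp_eq0 v0.
  by rewrite bump01_small ?mul0r ?normr0// invr_ge0.
rewrite normrM (ger0_norm (bump01_ge0 _ _)) (le_trans (ler_piMl _ (bump01_le1 _ _)))//.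
exact/fK/retract_sphere.
Qed.

(** Every fact about integrals over the sphere is transferred through this limit
    from integrals of continuous functions of compact support. *)
Lemma integral_annulus_cvg f : sphere_cont f ->
  n.+1%:R * integralR_rV (annulus k f) @[k --> \oo] --> integral_sphere f.
Proof.
move=> cf; have [K fK] := sphere_bounded cf.
have K0 : 0 <= K.
  exact: le_trans (fK _ (sphere_delta R 0)).
pose F y := if enorm y < 1 then f (retract y) else 0.
(* At the origin [F] takes the value [f 0], because [retract 0 = 0]. *)
pose F_ k y := 1 * annulus k f y + f 0 * tent k y.
have mA k := iter_measurable_continuous ler01 (annulus_continuous (k := k) cf) (annulus_supp k K0 fK).
have mT k := iter_measurable_continuous ler01 (@tent_continuous k) (tent_supp1 k).
have lin k := iter_measurable_lin 1 (f 0) ler01 (mA k) (annulus_supp k K0 fK) (mT k) (tent_supp1 k).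
have bF k : bounded_supp (K + `|f 0|) 1 (F_ k).
  split=> v; last first.
    by move=> v1; rewrite /F_ (annulus_supp k K0 fK).2// (tent_supp1 k).2// !mulr0 addr0.
  rewrite /F_ mul1r (le_trans (ler_normD _ _))// lerD ?(annulus_supp k K0 fK).1//.
  by rewrite normrM ler_piMr// tent_norm.
have cF y : F_ k y @[k --> \oo] --> F y.
  have [->|y0] := eqVneq y 0.
    rewrite (_ : (fun k => _) = cst (f 0)).
      by rewrite /F enorm0 ltr01 retract0; exact: cvg_cst.
    apply/funext => k; rewrite /F_ /annulus tent0 mulr1 bump01_small ?mul0r ?mulr0 ?add0r//.
    by rewrite (eqP (_ : dotp 0 0 == 0)) ?dotpp_eq0 ?invr_ge0.
  have sqlt : (dotp y y < 1) = (enorm y < 1).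
    by rewrite -enorm_sqr expr_lt1// enorm_ge0.
  have ny0 : 0 < `|y| by rewrite normr_gt0.
  have sy0 := dotpp_gt0 y0.
  have E : \forall k \near \oo, F y = F_ k y.
    have near_tent : \forall k \near \oo, k.+1%:R^-1 < `|y|.
      exact: (cvgr_lt _ cvg_harmonic).
    have [y1|y1] := ltP (dotp y y) 1; last first.
      near=> k; rewrite /F_ tent_eq0; last by near: k.
      by rewrite mulr0 addr0 mul1r /annulus /F -sqlt ltNge y1/= bump01_ge1 ?mul0r.
    near=> k; rewrite /F_ tent_eq0; last by near: k.
    rewrite mulr0 addr0 mul1r /annulus /F -sqlt y1 bump01_eq1 ?mul1r//.
      rewrite -ler_pdivrMr// -(invrK (2 / _)) -[leRHS]invrK lef_pV2 ?posrE ?invr_gt0 ?divr_gt0//.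
      rewrite -[X in X <= _]/(harmonic k); near: k; apply: (cvgr_le _ cvg_harmonic).
      by rewrite invr_gt0 divr_gt0.
    rewrite -ler_pdivrMr ?subr_gt0// -(invrK (1 / _)) -[leRHS]invrK lef_pV2 ?posrE ?invr_gt0 ?divr_gt0 ?subr_gt0//.
    rewrite -[X in X <= _]/(harmonic k); near: k; apply: (cvgr_le _ cvg_harmonic).
    by rewrite invr_gt0 divr_gt0// subr_gt0.
  by apply: cvg_trans (near_eq_cvg E) _; exact: cvg_cst.
have [mF limF] := integralR_rV_cvg ler01 (fun k => (lin k).1) bF cF.
have bFl : bounded_supp (K + `|f 0|) 1 F.
  split=> v; rewrite /F.
    case: ifP => _; last by rewrite normr0 addr_ge0.
    have [->|v0] := eqVneq v 0; first by rewrite retract0 lerDr.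
    by rewrite (le_trans (fK _ (retract_sphere v0)))// lerDl.
  by move=> v1; rewrite ltNge (ltW (lt_le_trans v1 (norm_le_enorm v))).
rewrite /integral_sphere (integral_rVE ler01 mF bFl) /=.
apply: cvgMl_tmp.
have lt : f 0 * integralR_rV (tent k) @[k --> \oo] --> f 0 * 0.
  by apply: cvgMl_tmp; exact: integral_tent_cvg0.
have := cvgB limF lt.
rewrite mulr0 subr0 => l; suff -> : (fun k => integralR_rV (annulus k f)) =
  (fun k => integralR_rV (fun v => 1 * annulus k f v + f 0 * tent k v) -
            f 0 * integralR_rV (tent k)) by exact: l.
by apply/funext => k; rewrite (lin k).2 mul1r addrK.
Unshelve. all: by end_near. Qed.

Lemma sphere_contD a b f g : sphere_cont f -> sphere_cont g ->
  sphere_cont (fun x => a * f x + b * g x).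
Proof.
move=> cf cg y y0; apply: (@cvgD _ _ _ (nbhs y)); apply: (@cvgMl_tmp _ _ (nbhs y)).
  exact: cf.
exact: cg.
Qed.

Lemma sphere_contM f g : sphere_cont f -> sphere_cont g ->
  sphere_cont (fun x => f x * g x).
Proof. by move=> cf cg y y0; apply: (@cvgM _ _ (nbhs y)); [exact: cf|exact: cg]. Qed.

Lemma sphere_cont_cst c : sphere_cont (fun=> c).
Proof. by move=> y _; exact: (@cvg_cst _ _ _ (nbhs y)). Qed.

Lemma sphere_cont_comp (h : R -> R) f : (forall x, sphere x -> {for f x, continuous h}) ->
  sphere_cont f -> sphere_cont (fun x => h (f x)).
Proof.
move=> ch cf y y0; exact: (cvg_comp _ _ (cf y y0) (ch _ (retract_sphere y0))).
Qed.

Lemma sphere_cont_eq f g : (forall x, sphere x -> f x = g x) -> sphere_cont f -> sphere_cont g.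
Proof.
move=> fg cf y y0; have nz : \forall z \near y, z != 0 by exact: near_neq0.
have E : \forall z \near y, f (retract z) = g (retract z).
  by near=> z; rewrite fg//; apply: retract_sphere; near: z.
rewrite /prop_for /continuous_at [X in _ --> X](_ : _ = f (retract y)).
  exact: cvg_trans (near_eq_cvg E) (cf y y0).
by rewrite fg//; exact: retract_sphere.
Unshelve. all: by end_near. Qed.

Lemma annulus_bsupp k f : sphere_cont f ->
  exists K, iter_measurable (annulus k f) /\ bounded_supp K 1 (annulus k f).
Proof.
move=> cf; have [K fK] := sphere_bounded cf.
have fK' x : sphere x -> `|f x| <= Num.max 0 K by move=> Sx; rewrite le_max fK ?orbT.
have K0 : 0 <= Num.max 0 K by rewrite le_max lexx.
exists (Num.max 0 K); split; last exact: annulus_supp.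
exact: iter_measurable_continuous ler01 (annulus_continuous cf) (annulus_supp k K0 fK').
Qed.

Lemma integral_sphereD a b f g : sphere_cont f -> sphere_cont g ->
  integral_sphere (fun x => a * f x + b * g x) =
  a * integral_sphere f + b * integral_sphere g.
Proof.
move=> cf cg; have lh := integral_annulus_cvg (sphere_contD (a := a) (b := b) cf cg).
have lfg : a * (n.+1%:R * integralR_rV (annulus k f)) +
    b * (n.+1%:R * integralR_rV (annulus k g)) @[k --> \oo] -->
    a * integral_sphere f + b * integral_sphere g.
  by apply: cvgD; apply: cvgMl_tmp; exact: integral_annulus_cvg.
rewrite -(cvg_lim _ lfg)// -(cvg_lim _ lh)//; congr (limn _).
apply/funext => k /=.
have [Kf [mf bf]] := annulus_bsupp k cf; have [Kg [mg bg]] := annulus_bsupp k cg.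
rewrite mulrCA (mulrCA b) -mulrDr -(iter_measurable_lin a b ler01 mf bf mg bg).2.
congr (_ * _); apply: (congr1 (@integralR_rV R n.+1)).
by apply/funext => y; rewrite /annulus; ring.
Qed.

Lemma le_integral_sphere f g : sphere_cont f -> sphere_cont g ->
  (forall x, sphere x -> f x <= g x) -> integral_sphere f <= integral_sphere g.
Proof.
move=> cf cg fg; have lf := integral_annulus_cvg cf; have lg := integral_annulus_cvg cg.
rewrite -(cvg_lim _ lf)// -(cvg_lim _ lg)//; apply: ler_lim.
- by apply/cvg_ex; exists (integral_sphere f).
- by apply/cvg_ex; exists (integral_sphere g).
apply: nearW => k; rewrite ler_pM2l//.
have [Kf [mf bf]] := annulus_bsupp k cf; have [Kg [mg bg]] := annulus_bsupp k cg.
apply: (integralR_rV_mono ler01 mf bf mg bg) => y; rewrite /annulus.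
have [y0|y0] := eqVneq y 0; last by rewrite ler_wpM2l ?bump01_ge0// fg//; exact: retract_sphere.
have -> : dotp y y = 0 by apply/eqP; rewrite dotpp_eq0 y0.
by rewrite bump01_small ?mul0r// invr_ge0.
Qed.

Lemma eq_integral_sphere f g : sphere_cont f ->
  (forall x, sphere x -> f x = g x) -> integral_sphere f = integral_sphere g.
Proof.
move=> cf fg; have cg := sphere_cont_eq fg cf.
by apply/eqP; rewrite eq_le !le_integral_sphere// => x Sx; rewrite fg.
Qed.

(** The cutoff integrals increase with the cutoff, and one of them is already
    positive near a multiple of [x0] of length in the open unit interval. *)
Lemma integral_sphere_gt0 f x0 : sphere_cont f -> (forall x, sphere x -> 0 <= f x) ->
  sphere x0 -> 0 < f x0 -> 0 < integral_sphere f.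
Proof.
move=> cf f0 Sx0 fx0; have lf := integral_annulus_cvg cf.
(* The cutoff of [annulus 3] equals 1 where [|y|^2 = 1/2]. *)
have K3 : 0 < integralR_rV (annulus 3 f).
  have [K [_ b]] := annulus_bsupp 3 cf.
  apply: (integralR_rV_gt0 (v0 := Num.sqrt 2^-1 *: x0) ler01 (annulus_continuous cf) b).
    move=> v; rewrite /annulus; have [v0|v0] := eqVneq v 0.
      have -> : dotp v v = 0 by apply/eqP; rewrite dotpp_eq0 v0.
      by rewrite bump01_small ?mul0r// invr_ge0.
    by rewrite mulr_ge0 ?bump01_ge0// f0//; exact: retract_sphere.
  have s0 : 0 < Num.sqrt 2^-1 :> R by rewrite sqrtr_gt0 invr_gt0.
  rewrite /annulus /retract enormZ scalerA (gtr0_norm s0) Sx0 mulr1 mulVf ?gt_eqF// scale1r.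
  rewrite dotpZl dotpZr mulrA -expr2 sqr_sqrtr ?invr_ge0// sphere_dotp// mulr1.
  by rewrite bump01_eq1 ?mul1r//; lra.
apply: (@lt_le_trans _ _ (n.+1%:R * integralR_rV (annulus 3 f))); first by rewrite mulr_gt0.
apply: (cvgr_to_ge lf); near=> k; rewrite ler_pM2l//.
have [K [m b]] := annulus_bsupp 3 cf; have [K' [m' b']] := annulus_bsupp k cf.
apply: (integralR_rV_mono ler01 m b m' b') => y; rewrite /annulus.
have [y0|y0] := eqVneq y 0.
  have -> : dotp y y = 0 by apply/eqP; rewrite dotpp_eq0 y0.
  by rewrite !bump01_small ?invr_ge0.
rewrite ler_wpM2r ?f0//; first exact: retract_sphere.
rewrite bump01_mono ?dotpp_ge0// ler_nat ltnS; near: k; exact: nbhs_infty_ge.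
Unshelve. all: by end_near. Qed.

End SphereIntegral.

(** * The divergence theorem on the sphere *)

(** If [f], continued by a suitable degree of homogeneity, is the divergence of a
    field tangent to the spheres, then its integral vanishes: the factor
    [|y|^(2 p)] is absorbed in the radial cutoff. *)
Lemma integral_sphere_divergence (R : realType) (n : nat) (I : finType)
    (H : I -> 'rV[R]_n.+1 -> R) (w : I -> 'rV[R]_n.+1) p (f : 'rV[R]_n.+1 -> R) :
  sphere_cont f ->
  (forall i y, y != 0 -> differentiable (H i) y) ->
  (forall i y, y != 0 -> {for y, continuous (fun z => 'D_(w i) (H i) z)}) ->
  (forall y, y != 0 -> \sum_i dotp y (w i) * H i y = 0) ->
  (forall y, y != 0 -> f (retract y) = dotp y y ^+ p * \sum_i 'D_(w i) (H i) y) ->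
  integral_sphere f = 0.
Proof.
move=> cf dH cdH tan fE; have lf := integral_annulus_cvg cf.
suff e k : integralR_rV (annulus k f) = 0.
  by rewrite -(cvg_lim _ lf)//; under eq_fun do rewrite e mulr0; exact: lim_cst.
have k0 : 0 < k.+1%:R^-1 :> R by rewrite invr_gt0.
rewrite -(radial_divergence (rho := fun s => bump01 k.+1%:R s * s ^+ p) k0 _ _ _ dH cdH tan).
- congr integralR_rV; apply/funext => y; rewrite /annulus.
  have [y0|y0] := eqVneq y 0; last by rewrite fE// mulrA.
  have -> : dotp y y = 0 by apply/eqP; rewrite dotpp_eq0 y0.
  by rewrite bump01_small ?mul0r// invr_ge0.
- by apply: C1_mul; [exact: C1_bump01|exact: C1_exp].
- by move=> s /ltW sk; rewrite bump01_small ?mul0r.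
- by move=> s s1; rewrite bump01_ge1 ?mul0r.
Qed.

(** * Multilinear functions of the rows of a matrix *)

Section Multilinear.
Variables (R : numFieldType) (N : nat).
Implicit Types (u v : 'rV[R]_N).

Definition set_row p (i : 'I_p) u (W : 'M[R]_(p, N)) : 'M[R]_(p, N) :=
  \matrix_(k < p) (if k == i then u else row k W).

(** Multilinearity in the rows of arbitrary matrices, whereas [alternating_at]
    speaks of tangent rows only. *)
Definition multilinear p (A : 'M[R]_(p, N) -> R) :=
  forall i W b c u v,
    A (set_row i (b *: u + c *: v) W) = b * A (set_row i u W) + c * A (set_row i v W).

Definition basis_mx p (I : {ffun 'I_p -> 'I_N}) : 'M[R]_(p, N) :=
  \matrix_(k < p) (delta_mx 0 (I k) : 'rV_N).

Definition set_index p (i : 'I_p) (j : 'I_N) (I : {ffun 'I_p -> 'I_N}) :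
    {ffun 'I_p -> 'I_N} := [ffun k => if k == i then j else I k].

Lemma row_set_row p (i : 'I_p) u W : row i (set_row i u W) = u.
Proof. by rewrite rowK eqxx. Qed.

Lemma row_set_row_neq p (i k : 'I_p) u W : k != i -> row k (set_row i u W) = row k W.
Proof. by move=> ki; rewrite rowK (negbTE ki). Qed.

Lemma set_row_id p (i : 'I_p) (W : 'M[R]_(p, N)) : set_row i (row i W) W = W.
Proof.
by apply/row_matrixP => k; rewrite rowK; case: eqP => [->|].
Qed.

Lemma set_row_basis p (i : 'I_p) j I :
  set_row i (delta_mx 0 j) (basis_mx I) = basis_mx (set_index i j I).
Proof.
by apply/row_matrixP => k; rewrite !rowK ffunE; case: eqP.
Qed.

Lemma multilinear_sum p (A : 'M[R]_(p, N) -> R) i (J : Type) (r : seq J) c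
    (u : J -> 'rV_N) W : multilinear A ->
  A (set_row i (\sum_(j <- r) c j *: u j) W) = \sum_(j <- r) c j * A (set_row i (u j) W).
Proof.
move=> mA; elim: r => [|j r IH].
  by rewrite !big_nil -(scale0r (0 : 'rV_N)) -[0 *: 0]addr0 -[X in _ + X](scale0r (0 : 'rV_N)) mA !mul0r addr0.
by rewrite !big_cons -[X in _ + X]scale1r mA mul1r IH.
Qed.

Lemma multilinear0 p (A : 'M[R]_(p, N) -> R) i W : multilinear A -> A (set_row i 0 W) = 0.
Proof.
by move=> mA; have := multilinear_sum i [::] (fun _ : nat => 0) (fun=> 0) W mA; rewrite !big_nil.
Qed.

Lemma multilinear_row p (A : 'M[R]_(p, N) -> R) i v W : multilinear A ->
  A (set_row i v W) = \sum_j v 0 j * A (set_row i (delta_mx 0 j) W).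
Proof. by move=> mA; rewrite {1}[v]row_sum_delta multilinear_sum. Qed.

(** The rows are expanded one after the other; [s] bounds the number of rows not
    yet known to be basis vectors. *)
Lemma multilinear_eq0 p (A : 'M[R]_(p, N) -> R) : multilinear A ->
  (forall I, A (basis_mx I) = 0) -> forall W, A W = 0.
Proof.
move=> mA A0 W.
suff H s : (s <= p)%N -> forall W, (forall k : 'I_p, (s <= k)%N -> exists j, row k W = delta_mx 0 j) ->
    A W = 0.
  by apply: (H p (leqnn p)) => k; rewrite leqNgt ltn_ord.
elim: s => [_|s IH sp] {}W hW.
  have /fin_all_exists [I hI] k : exists j, row k W = delta_mx 0 j by exact: hW.
  rewrite -(A0 [ffun k => I k]); congr A; apply/row_matrixP => k.
  by rewrite rowK ffunE hI.
rewrite -(set_row_id (Ordinal sp) W) multilinear_row// big1// => j _.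
rewrite IH ?mulr0//; first exact: ltnW.
move=> k sk; have [->|ks] := eqVneq k (Ordinal sp); first by exists j; rewrite row_set_row.
rewrite row_set_row_neq//; apply: hW; rewrite ltn_neqAle sk andbT.
by apply: contraNneq ks => e; apply/eqP/val_inj.
Qed.

Lemma multilinear_expand p (A : 'M[R]_(p, N) -> R) W : multilinear A ->
  A W = \sum_(I : {ffun 'I_p -> 'I_N}) (\prod_k W k (I k)) * A (basis_mx I).
Proof.
move=> mA; apply/eqP; rewrite -subr_eq0; apply/eqP.
pose B W := A W - \sum_(I : {ffun 'I_p -> 'I_N}) (\prod_k W k (I k)) * A (basis_mx I).
apply: (@multilinear_eq0 _ B) => [i {}W b c u v|I].
  rewrite /B mA !mulrBr addrACA -opprD; congr (_ - _).
  rewrite !mulr_sumr -big_split; apply: eq_bigr => I _ /=.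
  rewrite !mulrA -mulrDl; congr (_ * _).
  have E x : \prod_k (set_row i x W) k (I k) = x 0 (I i) * \prod_(k | k != i) W k (I k).
    rewrite (bigD1 i)//= mxE eqxx; congr (_ * _).
    by apply: eq_bigr => k ki; rewrite mxE (negbTE ki) mxE.
  by rewrite !E !mxE; ring.
rewrite /B (bigD1 I)//= big1 ?mul1r; last first.
  by move=> k _; rewrite !mxE !eqxx.
rewrite big1 ?addr0 ?subrr// => J JI.
have [k hk] : exists k, I k != J k.
  apply/existsP; apply: contraNT JI; rewrite negb_exists => /forallP h.
  by apply/eqP/ffunP => k; apply/esym/eqP; have := h k; rewrite negbK.
by rewrite (bigD1 k)//= !mxE eqxx eq_sym (negbTE hk) !mul0r.
Qed.

Lemma basis_mulmx p (C : 'M[R]_N) (J : {ffun 'I_p -> 'I_N}) k j :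
  (basis_mx J *m C) k j = C (J k) j.
Proof.
rewrite mxE (bigD1 (J k))//= !mxE !eqxx mul1r big1 ?addr0// => i iJ.
by rewrite !mxE (negbTE iJ) andbF mul0r.
Qed.

(** Both sides expand to the same sum over two multi-indices, weighted by the
    product of the entries [M (I k) (J k)]. *)
Lemma contraction_mulmx p (A B : 'M[R]_(p, N) -> R) (M : 'M[R]_N) :
  multilinear A -> multilinear B ->
  \sum_(I : {ffun 'I_p -> 'I_N}) A (basis_mx I *m M) * B (basis_mx I) =
  \sum_(I : {ffun 'I_p -> 'I_N}) A (basis_mx I) * B (basis_mx I *m M^T).
Proof.
move=> mA mB.
under eq_bigr => J _ do rewrite (multilinear_expand _ mA) mulr_suml.
under [RHS]eq_bigr => I _ do rewrite (multilinear_expand _ mB) mulr_sumr.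
rewrite exchange_big; apply: eq_bigr => I _; apply: eq_bigr => J _ /=.
rewrite [RHS]mulrCA -mulrA; congr (_ * _).
by apply: eq_bigr => k _; rewrite !basis_mulmx mxE.
Qed.

Lemma multilinear_mulmx p (A : 'M[R]_(p, N) -> R) (M : 'M[R]_N) :
  multilinear A -> multilinear (fun W => A (W *m M)).
Proof.
move=> mA i W b c u v.
have E x : set_row i x W *m M = set_row i (x *m M) (W *m M).
  apply/row_matrixP => k; rewrite row_mul !rowK row_mul.
  by case: eqP.
by rewrite !E mulmxDl -!scalemxAl mA.
Qed.

Lemma set_index_swap p (i : 'I_p) j (I : {ffun 'I_p -> 'I_N}) :
  set_index i (I i) (set_index i j I) = I.
Proof. by apply/ffunP => k; rewrite !ffunE; case: eqP => [->|]. Qed.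

(** Exchanging the value [j] with the [i]-th entry of [I] is an involution of the
    set of pairs [(I, j)]. *)
Lemma sum_set_index p (i : 'I_p) (F : {ffun 'I_p -> 'I_N} -> R) :
  \sum_I \sum_j F (set_index i j I) = N%:R * \sum_I F I.
Proof.
rewrite pair_big /=.
pose h (t : {ffun 'I_p -> 'I_N} * 'I_N) := (set_index i t.2 t.1, t.1 i).
have hK : involutive h.
  by move=> [I j]; rewrite /h /= set_index_swap ffunE eqxx.
rewrite (reindex_inj (inv_inj hK)) /=.
under eq_bigr => t _ do rewrite set_index_swap.
rewrite -(pair_big predT predT (fun I _ => F I)) /= mulr_sumr.
by apply: eq_bigr => I _; rewrite sumr_const card_ord mulr_natl.
Qed.

Lemma sum_set_index_eq0 p (i : 'I_p) (F : {ffun 'I_p -> 'I_N} -> R) :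
  (forall I, \sum_j F (set_index i j I) = 0) -> \sum_I F I = 0.
Proof.
move=> F0; have := sum_set_index i F; rewrite big1// => /esym/eqP.
rewrite mulf_eq0 => /orP[|/eqP//]; rewrite pnatr_eq0 => /eqP N0.
by rewrite big1// => I _; have := ltn_ord (I i); move: (nat_of_ord _) => a; rewrite N0.
Qed.

Lemma multilinearZ p (A : 'M[R]_(p, N) -> R) c W : multilinear A ->
  A (c *: W) = c ^+ p * A W.
Proof.
move=> mA; rewrite (multilinear_expand (c *: W) mA) (multilinear_expand W mA) mulr_sumr.
apply: eq_bigr => I _; rewrite mulrA; congr (_ * _).
under eq_bigr do rewrite mxE.
by rewrite big_split /= prodr_const card_ord.
Qed.

Definition alternates p (A : 'M[R]_(p, N) -> R) :=
  forall i j W, i != j -> row i W = row j W -> A W = 0.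

Lemma alternates_swap p (A : 'M[R]_(p, N) -> R) i j u v W :
  multilinear A -> alternates A -> i != j ->
  A (set_row i u (set_row j v W)) = - A (set_row i v (set_row j u W)).
Proof.
move=> mA aA ij; apply/eqP; rewrite -addr_eq0; apply/eqP.
have C a b : set_row i a (set_row j b W) = set_row j b (set_row i a W).
  apply/row_matrixP => k; rewrite !rowK; case: eqP => [->|//].
  by rewrite (negbTE ij).
have Z a : A (set_row i a (set_row j a W)) = 0.
  by apply: (aA i j) => //; rewrite row_set_row row_set_row_neq 1?eq_sym// row_set_row.
have := Z (1 *: u + 1 *: v); rewrite mA !mul1r.
rewrite [in X in X + _]C [in X in _ + X]C !mA !mul1r -!C !Z.
by rewrite add0r addr0.
Qed.

Lemma set_row_col_mxu p q (i : 'I_p) u (U : 'M[R]_(p, N)) (W : 'M[R]_(q, N)) :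
  set_row (lshift q i) u (col_mx U W) = col_mx (set_row i u U) W.
Proof.
apply/row_matrixP => k; rewrite rowK; case: (split_ordP k) => l ->.
  by rewrite eq_lshift !rowKu rowK.
by rewrite eq_rlshift !rowKd.
Qed.

Lemma set_row_col_mxd p q (i : 'I_q) u (U : 'M[R]_(p, N)) (W : 'M[R]_(q, N)) :
  set_row (rshift p i) u (col_mx U W) = col_mx U (set_row i u W).
Proof.
apply/row_matrixP => k; rewrite rowK; case: (split_ordP k) => l ->.
  by rewrite eq_lrshift !rowKu.
by rewrite eq_rshift !rowKd rowK.
Qed.

Lemma multilinear_col_mxu p q (A : 'M[R]_(p + q, N) -> R) (W : 'M[R]_(q, N)) :
  multilinear A -> multilinear (fun U => A (col_mx U W)).
Proof. by move=> mA i U b c u v; rewrite -!set_row_col_mxu mA. Qed.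

Lemma multilinear_col_mxd p q (A : 'M[R]_(p + q, N) -> R) (U : 'M[R]_(p, N)) :
  multilinear A -> multilinear (fun W => A (col_mx U W)).
Proof. by move=> mA i W b c u v; rewrite -!set_row_col_mxd mA. Qed.

End Multilinear.

Section Volume.
Variables (R : numFieldType) (n : nat).
Implicit Types (x : 'rV[R]_n.+1) (T : 'M[R]_(n, n.+1)) (Q : 'M[R]_n.+1).

(** The extension of the volume form to the whole space, homogeneous of degree 1
    in [x]. *)
Definition detcol x T : R := \det (col_mx x T : 'M[R]_(1 + n, 1 + n)).

Lemma detcol_multilinear x : multilinear (detcol x).
Proof.
move=> i T b c u v; rewrite /detcol.
apply: (@determinant_multilinear _ _ _ _ _ (rshift 1 i)).
- by rewrite !rowKd !row_set_row.
- apply/row_matrixP => k; rewrite !row_rowsub -!set_row_col_mxd.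
  by rewrite !row_set_row_neq// eq_sym neq_lift.
- apply/row_matrixP => k; rewrite !row_rowsub -!set_row_col_mxd.
  by rewrite !row_set_row_neq// eq_sym neq_lift.
Qed.

Lemma detcol_linear b c x y T : detcol (b *: x + c *: y) T = b * detcol x T + c * detcol y T.
Proof.
rewrite /detcol; apply: (@determinant_multilinear _ _ _ _ _ (lshift n 0)).
- by rewrite !rowKu !row_id.
- apply/row_matrixP => k; rewrite !row_rowsub.
  have [l ->] : exists l, lift (lshift n 0) k = rshift 1 l.
    by exists k; apply: val_inj.
  by rewrite !rowKd.
- apply/row_matrixP => k; rewrite !row_rowsub.
  have [l ->] : exists l, lift (lshift n 0) k = rshift 1 l.
    by exists k; apply: val_inj.
  by rewrite !rowKd.
Qed.

Lemma detcol_alternates x : alternates (detcol x).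
Proof.
move=> i j T ij rT; apply: (determinant_alternate (_ : rshift 1 i != rshift 1 j)).
  by rewrite eq_rshift.
by move=> k; rewrite !col_mxEd; have /rowP/(_ k) := rT; rewrite !mxE.
Qed.

Lemma detcol_eq0 x T i : row i T = x -> detcol x T = 0.
Proof.
move=> <-; apply: (determinant_alternate (_ : lshift n 0 != rshift 1 i)).
  by rewrite eq_lrshift.
by move=> k; rewrite col_mxEu col_mxEd mxE.
Qed.

Lemma detcol_mulmx x T Q : detcol (x *m Q) (T *m Q) = \det Q * detcol x T.
Proof. by rewrite /detcol -mul_col_mx det_mulmx mulrC. Qed.

(** The projection subtracts multiples of the row [x] from the others. *)
Lemma detcol_proj x T (u : 'cV[R]_n.+1) : detcol x (T *m (1%:M - u *m x)) = detcol x T.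
Proof.
rewrite /detcol; have -> : col_mx x (T *m (1%:M - u *m x)) =
   block_mx (1%:M : 'M[R]_1) 0 (- (T *m u)) 1%:M *m col_mx x T.
  rewrite mul_block_col !mul1mx mul0mx addr0; congr col_mx.
  by rewrite mulmxBr mulmx1 mulmxA mulNmx addrC.
by rewrite det_mulmx det_lblock !det1 !mul1r.
Qed.

End Volume.

(** * Forms on the sphere and their coefficients *)

Section RowLemmas.
Variables (R : numFieldType) (N : nat).

Lemma row'_set_row q (i : 'I_q) (u : 'rV[R]_N) W : row' i (set_row i u W) = row' i W.
Proof.
by apply/row_matrixP => k; rewrite !row_rowsub row_set_row_neq// eq_sym neq_lift.
Qed.

Lemma row'_set_row_lift q (k : 'I_q.+1) (i : 'I_q) (u : 'rV[R]_N) W :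
  row' k (set_row (lift k i) u W) = set_row i u (row' k W).
Proof.
apply/row_matrixP => l; rewrite !row_rowsub [in RHS]rowK row_rowsub.
have [->|li] := eqVneq l i; first by rewrite row_set_row.
by rewrite row_set_row_neq// (inj_eq lift_inj).
Qed.

Lemma row'_mulmx q (k : 'I_q) (W : 'M[R]_(q, N)) (M : 'M[R]_N) :
  row' k (W *m M) = row' k W *m M.
Proof. by apply/row_matrixP => l; rewrite row_rowsub !row_mul row_rowsub. Qed.

End RowLemmas.

Section TangentProjection.
Variables (R : realType) (n : nat).
Implicit Types (x y v w : 'rV[R]_n.+1).

Definition tprojmx x : 'M[R]_n.+1 := 1%:M - x^T *m x.

Lemma tprojE x v : tproj x v = v *m tprojmx x.
Proof.
rewrite /tproj /tprojmx mulmxBr mulmx1 mulmxA; congr (_ - _).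
by rewrite [v *m x^T]mx11_scalar mul_scalar_mx.
Qed.

Lemma tprojmx_tr x : (tprojmx x)^T = tprojmx x.
Proof. by rewrite /tprojmx linearB/= trmx1 trmx_mul trmxK. Qed.

Lemma mul_tprojmx_tr x : sphere x -> tprojmx x *m x^T = 0.
Proof.
move=> Sx; rewrite /tprojmx mulmxBl mul1mx -mulmxA [x *m x^T]mx11_scalar.
by rewrite -/(dotp x x) sphere_dotp// mulmx1 subrr.
Qed.

Lemma tangent_tprojmx p x (W : 'M[R]_(p, n.+1)) : sphere x -> tangent x (W *m tprojmx x).
Proof. by move=> Sx; rewrite /tangent -mulmxA mul_tprojmx_tr// mulmx0. Qed.

Lemma tprojmx_id p x (W : 'M[R]_(p, n.+1)) : tangent x W -> W *m tprojmx x = W.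
Proof. by rewrite /tangent => t; rewrite mulmxBr mulmx1 mulmxA t mul0mx subr0. Qed.

Lemma frameE p x (I : {ffun 'I_p -> 'I_n.+1}) : frame x I = basis_mx R I *m tprojmx x.
Proof. by apply/row_matrixP => k; rewrite row_mul !rowK tprojE. Qed.

(** Composition with the tangential projection extends a form at [x] from tangent
    vectors to all vectors, where it is multilinear without restriction. *)
Definition tangential p (alpha : dform R n p) x (W : 'M[R]_(p, n.+1)) : R :=
  alpha x (W *m tprojmx x).

Lemma tangential_multilinear p (alpha : dform R n p) x : sphere x ->
  alternating_at x (alpha x) -> multilinear (tangential alpha x).
Proof.
move=> Sx [lin _] i W b c u v; rewrite /tangential.
apply: (lin i); do ?exact: tangent_tprojmx.
- by rewrite !row_mul !row_set_row mulmxDl -!scalemxAl.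
- by rewrite !row'_mulmx !row'_set_row.
- by rewrite !row'_mulmx !row'_set_row.
Qed.

Lemma pullbackE p (alpha : dform R n p) y W : y != 0 ->
  pullback alpha y W = alpha (retract y) ((enorm y)^-1 *: W *m tprojmx (retract y)).
Proof.
move=> y0; rewrite /pullback; congr (alpha _ _); apply/row_matrixP => i.
rewrite rowK row_mul linearZ/= -scalemxAl -tprojE.
by have := is_derive_retract (row i W) y0 => D; rewrite derive_val.
Qed.

Lemma pullback_sphere p (alpha : dform R n p) x W : sphere x ->
  pullback alpha x W = tangential alpha x W.
Proof.
move=> Sx; rewrite pullbackE ?sphere_neq0// retractK//.
by rewrite [enorm x]Sx invr1 scale1r.
Qed.

Lemma dform_frame p (alpha : dform R n p) x (I : {ffun 'I_p -> 'I_n.+1}) : sphere x ->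
  alpha x (frame x I) = pullback alpha x (basis_mx R I).
Proof. by move=> Sx; rewrite pullback_sphere// frameE. Qed.

Lemma pullback_multilinear p (alpha : dform R n p) y : smooth_dform alpha -> y != 0 ->
  multilinear (pullback alpha y).
Proof.
move=> [alt _] y0 i W b c u v; have Sy := retract_sphere y0.
have T := tangential_multilinear Sy (alt _ Sy).
have E x : pullback alpha y (set_row i x W) = (enorm y)^-1 ^+ p * tangential alpha (retract y) (set_row i x W).
  by rewrite pullbackE// -(multilinearZ _ _ T).
by rewrite !E T; ring.
Qed.

(** The retraction ignores scaling and its derivative is homogeneous of degree -1,
    once for each of the [p] vectors. *)
Lemma pullback_scale p (alpha : dform R n p) y W (c : R) : smooth_dform alpha ->
  y != 0 -> 0 < c -> pullback alpha (c *: y) W = c^-1 ^+ p * pullback alpha y W.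
Proof.
move=> [alt _] y0 c0; have Sy := retract_sphere y0.
have T := tangential_multilinear Sy (alt _ Sy).
have cy0 : c *: y != 0 by rewrite scaler_eq0 negb_or gt_eqF.
have rc : retract (c *: y) = retract y.
  rewrite /retract enormZ gtr0_norm// scalerA invfM mulrC mulrA mulfV ?gt_eqF//.
  by rewrite mul1r.
rewrite !pullbackE// rc enormZ (gtr0_norm c0) invfM -scalerA.
exact: (multilinearZ _ _ T).
Qed.

End TangentProjection.

Section SmoothForms.
Variables (R : realType) (n p : nat) (alpha : dform R n p).
Hypothesis sa : smooth_dform alpha.
Implicit Types (x y v w : 'rV[R]_n.+1) (W : 'M[R]_(p, n.+1)).

Notation coef W := (fun y => pullback alpha y W).

Lemma coef_differentiable W y : y != 0 -> differentiable (coef W) y.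
Proof. by move=> y0; have := sa.2 W [::] y y0. Qed.

Lemma coef_derive_differentiable v W y : y != 0 -> differentiable (fun z => 'D_v (coef W) z) y.
Proof. by move=> y0; have := sa.2 W [:: v] y y0. Qed.

Lemma coef_derive2_differentiable u v W y : y != 0 ->
  differentiable (fun z => 'D_u (fun z => 'D_v (coef W) z) z) y.
Proof. by move=> y0; have := sa.2 W [:: u; v] y y0. Qed.

End SmoothForms.

Lemma derive_linear (R : realType) (N : nat) (f : 'rV[R]_N -> R) y (b c : R) u v :
  differentiable f y -> 'D_(b *: u + c *: v) f y = b * 'D_u f y + c * 'D_v f y.
Proof. by move=> df; rewrite !deriveE// linearP/= linearZ. Qed.

Lemma derive_comb (R : realType) (N : nat) (f g : 'rV[R]_N -> R) y w (b c : R) :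
  derivable f y w -> derivable g y w ->
  'D_w (fun z => b * f z + c * g z) y = b * 'D_w f y + c * 'D_w g y.
Proof.
move=> df dg; have := deriveD (derivableZ (k := b) df) (derivableZ (k := c) dg).
by rewrite !deriveZ.
Qed.

Lemma near_derive_comb (R : realType) (N : nat) (F f g : 'rV[R]_N -> R) y w (b c : R) :
  derivable f y w -> derivable g y w ->
  (\forall z \near y, F z = b * f z + c * g z) ->
  'D_w F y = b * 'D_w f y + c * 'D_w g y.
Proof. by move=> df dg /near_eq_derive ->; exact: derive_comb. Qed.

Lemma extd_term_multilinear (R : realType) (n q : nat) (alpha : dform R n q) y (k : 'I_q.+1) :
  smooth_dform alpha -> y != 0 ->
  multilinear (fun W : 'M[R]_(q.+1, n.+1) => 'D_(row k W) (fun y => pullback alpha y (row' k W)) y).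
Proof.
move=> sa y0 i W b c u v; have [->|] := eqVneq k i.
  rewrite !row'_set_row !row_set_row derive_linear//; exact: coef_differentiable.
case: (unliftP k i) => [i' ->|->]; last by rewrite eqxx.
move=> ki; rewrite !row'_set_row_lift !row_set_row_neq//.
apply: near_derive_comb; do ?[by apply: diff_derivable; exact: coef_differentiable].
have nz := near_neq0 y0; near=> z; have z0 : z != 0 by near: z.
exact: (pullback_multilinear sa z0).
Unshelve. all: by end_near. Qed.

Lemma extd_multilinear (R : realType) (n q : nat) (alpha : dform R n q.-1) y :
  smooth_dform alpha -> y != 0 -> multilinear (extd (q := q) alpha y).
Proof.
case: q alpha => [|q] alpha sa y0 i W b c u v; first by case: i.
rewrite /extd !mulr_sumr -big_split; apply: eq_bigr => k _.
have comb (s X Y Z : R) : X = b * Y + c * Z -> s * X = b * (s * Y) + c * (s * Z).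
  by move=> ->; ring.
apply: comb; exact: (extd_term_multilinear k sa y0 i W b c u v).
Qed.

(** * Symmetry of mixed second derivatives *)

Section SymmetricDerivatives.
Variables (R : realType) (N : nat).
Implicit Types (f : 'rV[R]_N -> R) (y v w : 'rV[R]_N).

Lemma MVT_line f (df : 'rV[R]_N -> R) z v (h : R) : 0 <= h ->
  (forall s, 0 <= s <= h -> is_derive (z + s *: v) v f (df (z + s *: v))) ->
  exists2 s, 0 <= s <= h & f (z + h *: v) - f z = h * df (z + s *: v).
Proof.
move=> h0 dfl; pose phi (s : R) : R := f (z + s *: v).
have dphi (s : R) : 0 <= s <= h -> is_derive s (1 : R) phi (df (z + s *: v)).
  move=> /dfl D; have := @derive_line R N f z v s.
  by rewrite derive_val; apply; exact: ex_derive.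
have [s|s|s] := @MVT_segment R phi (fun s => df (z + s *: v)) 0 h h0.
- by rewrite in_itv/= => /andP[/ltW s0 /ltW sh]; apply: dphi; rewrite s0.
- apply: derivable_within_continuous => {}s; rewrite in_itv/= => /dphi D.
  exact: ex_derive.
- rewrite in_itv/= => sh; rewrite /phi scale0r addr0 subr0 mulrC => e.
  by exists s.
Qed.

Lemma is_derive_translate f z v c : derivable f (z + c) v ->
  is_derive z v (fun z => f (z + c)) ('D_v f (z + c)).
Proof.
have E : (fun k : R => k^-1 *: (((fun z => f (z + c)) \o shift z) (k *: v) - f (z + c))) =
    (fun k => k^-1 *: ((f \o shift (z + c)) (k *: v) - f (z + c))).
  by apply/funext => k /=; rewrite addrA.
by move=> df; apply: DeriveDef; rewrite /derivable /derive E.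
Qed.

Lemma near_dist_le f y e : {for y, continuous f} -> 0 < e ->
  \forall z \near y, `|f z - f y| <= e.
Proof.
by move=> cf e0; have /cvgrPdist_le/(_ _ e0) := cf; apply: filterS => z; rewrite distrC.
Qed.

Lemma near_ball (P : 'rV[R]_N -> Prop) y : (\forall z \near y, P z) ->
  exists2 d : R, 0 < d & forall z, `|y - z| < d -> P z.
Proof. by move=> /nbhs_normP[d /= d0 dP]; exists d. Qed.

(** The mean value theorem in the direction [v], then in the direction [w], turns
    the second difference into a mixed derivative at a nearby point. *)
Lemma second_difference f y v w a (e h : R) : 0 <= h ->
  (forall s t, 0 <= s <= h -> 0 <= t <= h ->
    [/\ derivable f (y + s *: v + t *: w) v,
        derivable (fun z => 'D_v f z) (y + s *: v + t *: w) w &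
        `|'D_w (fun z => 'D_v f z) (y + s *: v + t *: w) - a| <= e]) ->
  `|(f (y + h *: v + h *: w) - f (y + h *: w) - f (y + h *: v) + f y) - h ^+ 2 * a| <= h ^+ 2 * e.
Proof.
move=> h0 H.
have h00 : (0 : R) <= 0 <= h by rewrite lexx.
have hh : (0 : R) <= h <= h by rewrite lexx h0.
pose g z := f (z + h *: w) - f z.
have [s sh gE] : exists2 s, 0 <= s <= h & g (y + h *: v) - g y =
    h * ('D_v f (y + s *: v + h *: w) - 'D_v f (y + s *: v)).
  apply: (MVT_line (df := fun z => 'D_v f (z + h *: w) - 'D_v f z)) => // s sh.
  apply: is_deriveB.
    by have [D _ _] := H s h sh hh; exact: is_derive_translate D.
  by have [D _ _] := H s 0 sh h00; move: D; rewrite scale0r addr0 => /derivableP.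
have [t th e2] : exists2 t, 0 <= t <= h & 'D_v f (y + s *: v + h *: w) - 'D_v f (y + s *: v) =
   h * 'D_w (fun z => 'D_v f z) (y + s *: v + t *: w).
  apply: (MVT_line (f := fun z => 'D_v f z) (df := fun z => 'D_w (fun z => 'D_v f z) z)) => // t th.
  by apply: derivableP; have [] := H s t sh th.
have -> : f (y + h *: v + h *: w) - f (y + h *: w) - f (y + h *: v) + f y =
    g (y + h *: v) - g y by rewrite /g; ring.
rewrite gE e2 mulrA -expr2 -mulrBr normrM ger0_norm ?sqr_ge0//.
by rewrite ler_wpM2l ?sqr_ge0//; have [] := H s t sh th.
Qed.

(** Schwarz: the second difference does not depend on the order of [v] and [w],
    and its quotient by [h^2] tends to either mixed derivative. *)
Lemma derive_comm f y v w :
  (\forall z \near y, derivable f z v /\ derivable f z w) ->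
  (\forall z \near y, derivable (fun z => 'D_v f z) z w /\ derivable (fun z => 'D_w f z) z v) ->
  {for y, continuous (fun z => 'D_w (fun z => 'D_v f z) z)} ->
  {for y, continuous (fun z => 'D_v (fun z => 'D_w f z) z)} ->
  'D_w (fun z => 'D_v f z) y = 'D_v (fun z => 'D_w f z) y.
Proof.
move=> d1 d2 c1 c2.
set a := 'D_w _ y; set b := 'D_v _ y.
apply/eqP; rewrite -subr_eq0 -normr_le0; apply/ler_addgt0Pr => e e0; rewrite add0r.
have e20 : 0 < e / 2 by rewrite divr_gt0.
have n1 : \forall z \near y, `|'D_w (fun z => 'D_v f z) z - a| <= e / 2.
  exact: (near_dist_le c1 e20).
have n2 : \forall z \near y, `|'D_v (fun z => 'D_w f z) z - b| <= e / 2.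
  exact: (near_dist_le c2 e20).
have [r1 r10 q1] := near_ball d1; have [r2 r20 q2] := near_ball d2.
have [r3 r30 q3] := near_ball n1; have [r4 r40 q4] := near_ball n2.
pose d := Num.min (Num.min r1 r2) (Num.min r3 r4).
have d0 : 0 < d by rewrite !lt_min r10 r20 r30 r40.
(* With this [h] the parallelogram at [y] spanned by [h v] and [h w] lies in the
   ball of radius [d]. *)
pose h := d / 2 / (`|v| + `|w| + 1).
have D0 : 0 < `|v| + `|w| + 1 by rewrite ltr_wpDl// addr_ge0.
have h0 : 0 < h by rewrite !divr_gt0.
have near_h s t : 0 <= s <= h -> 0 <= t <= h -> `|y - (y + s *: v + t *: w)| < d.
  move=> /andP[s0 sh] /andP[t0 th]; rewrite opprD addrA opprD addrA subrr sub0r.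
  rewrite -opprD normrN (le_lt_trans (ler_normD _ _))// !normrZ (ger0_norm s0) (ger0_norm t0).
  apply: (@le_lt_trans _ _ (h * (`|v| + `|w| + 1))).
    by rewrite mulrDr mulrDr mulr1 -[leLHS]addr0 lerD ?(ltW h0)// lerD// ler_wpM2r.
  by rewrite /h mulfVK ?gt_eqF// ltr_pdivrMr// ltr_pMr// ltr1n.
have A : `|(f (y + h *: v + h *: w) - f (y + h *: w) - f (y + h *: v) + f y) - h ^+ 2 * a| <= h ^+ 2 * (e / 2).
  apply: second_difference; first exact: ltW.
  move=> s t sh th; have := near_h s t sh th; rewrite !lt_min => /andP[/andP[u1 u2] /andP[u3 u4]].
  by split; [exact: (q1 _ u1).1|exact: (q2 _ u2).1|exact: (q3 _ u3)].
have B : `|(f (y + h *: w + h *: v) - f (y + h *: v) - f (y + h *: w) + f y) - h ^+ 2 * b| <= h ^+ 2 * (e / 2).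
  apply: second_difference; first exact: ltW.
  move=> s t sh th; have := near_h t s th sh; rewrite addrAC.
  rewrite !lt_min => /andP[/andP[u1 u2] /andP[u3 u4]].
  by split; [exact: (q1 _ u1).2|exact: (q2 _ u2).2|exact: (q4 _ u4)].
rewrite (addrAC y (h *: w)) in B.
have h2 : 0 < h ^+ 2 by rewrite exprn_gt0.
rewrite -(ler_pM2l h2) -(ger0_norm (ltW h2)) -normrM (ger0_norm (ltW h2)).
set F1 := f (y + h *: v + h *: w) in A B; set F2 := f (y + h *: w) in A B.
set F3 := f (y + h *: v) in A B; set F4 := f y in A B.
have -> : h ^+ 2 * (a - b) = (F1 - F3 - F2 + F4 - h ^+ 2 * b) - (F1 - F2 - F3 + F4 - h ^+ 2 * a) by ring.
rewrite (le_trans (ler_normB _ _))//.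
have -> : h ^+ 2 * e = h ^+ 2 * (e / 2) + h ^+ 2 * (e / 2) by field.
exact: (lerD B A).
Qed.

End SymmetricDerivatives.

(** * Integration by parts for the wedge of two exact forms *)

Section LinearForm.
Variables (R : realType) (N : nat) (f : 'rV[R]_N -> R).
Hypothesis lin : forall b c u v, f (b *: u + c *: v) = b * f u + c * f v.

Lemma linear_form_sum y : f y = \sum_j y 0 j * f (delta_mx 0 j).
Proof.
rewrite {1}[y]row_sum_delta; elim: (index_enum _) => [|j r IH].
  by rewrite !big_nil -(scale0r (0 : 'rV[R]_N)) -[0 *: 0]addr0 -[X in _ + X](scale0r (0 : 'rV[R]_N)) lin !mul0r addr0.
by rewrite !big_cons -[X in _ + X]scale1r lin mul1r IH.
Qed.

Lemma linear_form_differentiable y : differentiable f y.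
Proof.
rewrite (_ : f = \sum_j (fun z : 'rV[R]_N => z 0 j * f (delta_mx 0 j))).
  apply: differentiable_sum => j.
  by apply: differentiableM => //; exact: differentiable_coord.
by apply/funext => z; rewrite fct_sumE linear_form_sum.
Qed.

Lemma linear_form_derive y w : 'D_w f y = f w.
Proof.
apply: cvg_lim => //.
have E : \forall h \near (0 : R)^', f w = h^-1 *: ((f \o shift y) (h *: w) - f y).
  near=> h; have h0 : h != 0 by near: h; exact: nbhs_dnbhs_neq.
  rewrite /= -[X in h *: w + X]scale1r lin mul1r addrK /GRing.scale/= mulKf//.
by apply: cvg_trans (near_eq_cvg E) _; exact: cvg_cst.
Unshelve. all: by end_near. Qed.

End LinearForm.

Lemma near_eq_continuous (R : realType) (N : nat) (f g : 'rV[R]_N -> R) (y : 'rV[R]_N) :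
  (\forall z \near y, f z = g z) -> {for y, continuous f} -> {for y, continuous g}.
Proof.
move=> fg cf; rewrite /prop_for /continuous_at -(nbhs_singleton fg).
exact: cvg_trans (near_eq_cvg fg) cf.
Qed.

Lemma derive_scale (R : realType) (N : nat) (f : 'rV[R]_N -> R) (c k : R) (y w : 'rV[R]_N) :
  (\forall z \near y, f (c *: z) = k * f z) ->
  differentiable f (c *: y) -> derivable f y w ->
  c * 'D_w f (c *: y) = k * 'D_w f y.
Proof.
move=> fE df dfy.
have E : (fun h : R => h^-1 *: (((fun z => f (c *: z)) \o shift y) (h *: w) - f (c *: y))) =
    (fun h => h^-1 *: ((f \o shift (c *: y)) (h *: (c *: w)) - f (c *: y))).
  by apply/funext => h /=; congr (_ *: (f _ - _)); rewrite scalerDr !scalerA; congr (_ *: _ + _); exact: mulrC.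
have D1 : 'D_w (fun z => f (c *: z)) y = 'D_(c *: w) f (c *: y).
  by rewrite /derive E.
have D2 : 'D_w (fun z => f (c *: z)) y = 'D_w (fun z => k * f z + 0 * f z) y.
  apply: near_eq_derive; apply: filterS fE => z ->.
  by rewrite mul0r addr0.
have := derive_linear c 0 w 0 df; rewrite scaler0 addr0 mul0r addr0 => <-.
by rewrite -D1 D2 derive_comb// mul0r addr0.
Qed.

Section FormIntegration.
Variables (R : realType) (m p : nat).
Notation n := (m + p)%N.
Notation V := 'rV[R]_n.+1.
Notation idx q := {ffun 'I_q -> 'I_n.+1}.
Implicit Types (y : V) (I : idx m) (J : idx p).

Notation ej j := (delta_mx 0 j : V).
Notation vol I J := (fun y : V => detcol y (col_mx (basis_mx R I) (basis_mx R J))).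

Lemma sum_quadruple (F : 'I_p * 'I_m * (idx m * idx p) -> R) :
  \sum_t F t = \sum_(k < p) \sum_(l < m) \sum_(I : idx m) \sum_(J : idx p) F (k, l, (I, J)).
Proof.
under [RHS]eq_bigr => k _ do under eq_bigr => l _ do rewrite pair_bigA.
by rewrite pair_bigA pair_bigA /=; apply: eq_bigr => -[[k l] [I J]].
Qed.

Lemma set_index_id q (k : 'I_q) (J : idx q) : set_index k (J k) J = J.
Proof. by apply/ffunP => i; rewrite ffunE; case: eqP => [->|]. Qed.

(** [a k J] stands for the coefficient of a form on the basis vectors listed by
    [J], the [k]-th one omitted, whence [a_indep]; likewise [e l I]. *)
Variables (a : 'I_p -> idx p -> V -> R) (e : 'I_m -> idx m -> V -> R).
Hypothesis a_indep : forall k J j, a k (set_index k j J) = a k J.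
Hypothesis e_indep : forall l I j, e l (set_index l j I) = e l I.
Hypothesis da : forall k J y, y != 0 -> differentiable (a k J) y.
Hypothesis dda : forall k J v y, y != 0 -> differentiable (fun z => 'D_v (a k J) z) y.
Hypothesis de : forall l I y, y != 0 -> differentiable (e l I) y.
Hypothesis dde : forall l I v y, y != 0 -> differentiable (fun z => 'D_v (e l I) z) y.
Hypothesis ddde : forall l I u v y, y != 0 ->
  differentiable (fun z => 'D_u (fun z => 'D_v (e l I) z) z) y.

Let b l I y : R := 'D_(ej (I l)) (e l I) y.

(** Summing over the entry [J k] puts [y] in the corresponding row of the
    determinant, whose first row is [y] already. *)
Lemma vol_tangential k l I y :
  \sum_(J : idx p) dotp y (ej (J k)) * (a k J y * (b l I y * vol I J y)) = 0.
Proof.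
apply: (sum_set_index_eq0 (i := k)) => J.
transitivity (a k J y * b l I y * \sum_j y 0 j *
    detcol y (col_mx (basis_mx R I) (basis_mx R (set_index k j J)))).
  rewrite mulr_sumr; apply: eq_bigr => j _; rewrite a_indep ffunE eqxx.
  by rewrite dotp_delta; ring.
under eq_bigr => j _ do rewrite -set_row_basis -set_row_col_mxd.
rewrite -(multilinear_row (A := detcol y) (rshift m k) y _ (detcol_multilinear y)).
by rewrite (detcol_eq0 (i := rshift m k)) ?mulr0// row_set_row.
Qed.

Lemma vol_swap (k : 'I_p) (l : 'I_m) I J y :
  detcol y (col_mx (basis_mx R (set_index l (J k) I)) (basis_mx R (set_index k (I l) J))) =
  - detcol y (col_mx (basis_mx R I) (basis_mx R J)).
Proof.
rewrite -!set_row_basis -set_row_col_mxu -set_row_col_mxd.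
rewrite (alternates_swap _ _ _ (detcol_multilinear y) (@detcol_alternates _ _ y)); last first.
  by rewrite eq_lrshift.
rewrite set_row_col_mxd set_row_col_mxu !set_row_basis.
by rewrite !set_index_id.
Qed.

(** This is [d d = 0]: exchanging the entries [I l] and [J k] preserves the mixed
    second derivative and changes the sign of the determinant. *)
Lemma mixed_derivatives_cancel k l y : y != 0 ->
  \sum_(I : idx m) \sum_(J : idx p) a k J y * ('D_(ej (J k)) (b l I) y * vol I J y) = 0.
Proof.
move=> y0.
have sym I u v : 'D_u (fun z => 'D_v (e l I) z) y = 'D_v (fun z => 'D_u (e l I) z) y.
  have nz := near_neq0 y0; apply: derive_comm.
  - by apply: filterS nz => z z0; split; apply: diff_derivable; exact: de.
  - by apply: filterS nz => z z0; split; apply: diff_derivable; exact: dde.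
  - by apply: differentiable_continuous; exact: ddde.
  - by apply: differentiable_continuous; exact: ddde.
rewrite pair_big /=.
set F := fun t : idx m * idx p => a k t.2 y * ('D_(ej (t.2 k)) (b l t.1) y * vol t.1 t.2 y).
pose h (t : idx m * idx p) := (set_index l (t.2 k) t.1, set_index k (t.1 l) t.2).
have hK : involutive h.
  by move=> [I J]; rewrite /h /= !ffunE !eqxx !set_index_swap.
have Fh t : F (h t) = - F t.
  have comb (x x' u u' z z' : R) : x = x' -> u = u' -> z = - z' -> x * (u * z) = - (x' * (u' * z')).
    by move=> -> -> ->; rewrite !mulrN.
  case: t => I J; apply: comb; last exact: vol_swap.
    by rewrite a_indep.
  have E (j j' : 'I_n.+1) (g : V -> R) : j = I l -> j' = J k -> g = e l I ->
      'D_(ej j) (fun z => 'D_(ej j') g z) y = 'D_(ej (J k)) (fun z => 'D_(ej (I l)) (e l I) z) y.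
    by move=> -> -> ->; exact: sym.
  by apply: E; [rewrite /= ffunE eqxx|rewrite /= ffunE eqxx|exact: e_indep].
have : \sum_t F t = - \sum_t F t.
  rewrite {1}(reindex_inj (inv_inj hK)) -sumrN.
  by apply: eq_bigr => t _; exact: Fh.
by move/eqP; rewrite -addr_eq0 -mulr2n mulrn_eq0/= => /eqP.
Qed.

Lemma derive_mul3 (s : R) (f g h : V -> R) y w :
  differentiable f y -> differentiable g y -> differentiable h y ->
  'D_w (fun z => s * (f z * (g z * h z))) y =
  s * ('D_w f y * (g y * h y)) + s * (f y * ('D_w g y * h y)) + s * (f y * (g y * 'D_w h y)).
Proof.
move=> /(@diff_derivable _ _ _ _ _ w) df /(@diff_derivable _ _ _ _ _ w) dg /(@diff_derivable _ _ _ _ _ w) dh.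
have E1 := deriveM dg dh; have D1 := derivableM dg dh.
have E2 := deriveM df D1; have D2 := derivableM df D1.
have := deriveZ s D2; rewrite E2 E1 => ->.
rewrite [(g * h) y](_ : _ = g y * h y)// /GRing.scale/=.
set Df := 'D_w f y; set Dg := 'D_w g y; set Dh := 'D_w h y.
by ring.
Qed.

(** The fields [a * b * vol] in the directions [e_(J k)] add up to a tangential
    one, and by the product rule its divergence is the integrand and two more
    terms: the one with [D b] cancels by [mixed_derivatives_cancel], and the one
    with [D vol] is a determinant in which the row [e_(J k)] occurs twice. *)
Lemma integral_exact_wedge (C : R) d (f : V -> R) : sphere_cont f ->
  (forall y, y != 0 -> f (retract y) = dotp y y ^+ d * (C * \sum_(k < p) \sum_(l < m) (-1) ^+ k * (-1) ^+ l *
     \sum_(I : idx m) \sum_(J : idx p) 'D_(ej (J k)) (a k J) y * (b l I y * vol I J y))) ->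
  integral_sphere f = 0.
Proof.
move=> cf fE.
pose s (t : 'I_p * 'I_m * (idx m * idx p)) : R := C * ((-1) ^+ t.1.1 * (-1) ^+ t.1.2).
pose H (t : 'I_p * 'I_m * (idx m * idx p)) z := s t * (a t.1.1 t.2.2 z * (b t.1.2 t.2.1 z * vol t.2.1 t.2.2 z)).
pose w (t : 'I_p * 'I_m * (idx m * idx p)) := ej (t.2.2 t.1.1).
have dvol I J y : differentiable (vol I J) y.
  by apply: linear_form_differentiable => *; exact: detcol_linear.
have db l I y : y != 0 -> differentiable (b l I) y by exact: dde.
have DH t y : y != 0 -> 'D_(w t) (H t) y =
   s t * ('D_(w t) (a t.1.1 t.2.2) y * (b t.1.2 t.2.1 y * vol t.2.1 t.2.2 y)) +
   s t * (a t.1.1 t.2.2 y * ('D_(w t) (b t.1.2 t.2.1) y * vol t.2.1 t.2.2 y)).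
  move=> y0; rewrite /H derive_mul3//; [|exact: da|exact: db].
  rewrite [X in _ + X](_ : _ = 0) ?addr0//.
  rewrite linear_form_derive; last by move=> *; exact: detcol_linear.
  rewrite (detcol_eq0 (i := rshift m t.1.1)) ?mulr0// rowKd rowK//.
apply: (integral_sphere_divergence (H := H) (w := w) (p := d)) => //.
- move=> t y y0; apply: differentiableM => //.
  apply: differentiableM; first exact: da.
  by apply: differentiableM; [exact: db|exact: dvol].
- move=> t y y0.
  pose G z : R := s t * ('D_(w t) (a t.1.1 t.2.2) z * (b t.1.2 t.2.1 z * vol t.2.1 t.2.2 z)) +
       s t * (a t.1.1 t.2.2 z * ('D_(w t) (b t.1.2 t.2.1) z * vol t.2.1 t.2.2 z)).
  have cG : {for y, continuous G}.
    apply: differentiable_continuous; apply: differentiableD.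
      apply: differentiableM => //; apply: differentiableM; first exact: dda.
      by apply: differentiableM; [exact: db|exact: dvol].
    apply: differentiableM => //; apply: differentiableM; first exact: da.
    by apply: differentiableM; [exact: ddde|exact: dvol].
  by apply: (near_eq_continuous _ cG); apply: filterS (near_neq0 y0) => z z0; rewrite DH.
- move=> y y0; rewrite sum_quadruple big1// => k _; rewrite big1// => l _; rewrite big1// => I _.
  transitivity (C * ((-1) ^+ k * (-1) ^+ l) * \sum_(J : idx p) dotp y (ej (J k)) * (a k J y * (b l I y * vol I J y))).
    by rewrite mulr_sumr; apply: eq_bigr => J _; rewrite /H /s /w /= mulrCA.
  by rewrite vol_tangential mulr0.
move=> y y0; rewrite fE//; congr (_ * _); rewrite mulr_sumr sum_quadruple.
apply: eq_bigr => k _; rewrite mulr_sumr; apply: eq_bigr => l _.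
transitivity (C * ((-1) ^+ k * (-1) ^+ l) * (\sum_(I : idx m) \sum_(J : idx p) 'D_(ej (J k)) (a k J) y * (b l I y * vol I J y)
   + \sum_(I : idx m) \sum_(J : idx p) a k J y * ('D_(ej (J k)) (b l I) y * vol I J y))).
  by rewrite mixed_derivatives_cancel// addr0 mulrA.
rewrite -big_split mulr_sumr; apply: eq_bigr => I _ /=.
rewrite -big_split mulr_sumr; apply: eq_bigr => J _ /=.
by rewrite DH// /s /w /= mulrDr.
Qed.

End FormIntegration.

(** * The Hodge star, and orthogonality of exact forms to curls *)

Lemma multilinear_sumf (R : numFieldType) (N p : nat) (I : Type) (r : seq I) (c : I -> R)
    (A : I -> 'M[R]_(p, N) -> R) :
  (forall i, multilinear (A i)) -> multilinear (fun W => \sum_(i <- r) c i * A i W).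
Proof.
move=> mA j W b d u v; rewrite !mulr_sumr -big_split; apply: eq_bigr => i _ /=.
by rewrite mA; ring.
Qed.

(** Contractions over the projected frame equal contractions over the canonical
    basis once one of the factors is invariant under the projection, as the volume
    form is. *)
Lemma contraction_proj2 (R : numFieldType) (N m p : nat) (A : 'M[R]_(p, N) -> R)
    (B : 'M[R]_(m, N) -> R) (G : 'M[R]_(m + p, N) -> R) (P : 'M[R]_N) :
  multilinear A -> multilinear B -> multilinear G -> P^T = P ->
  (forall T, G (T *m P) = G T) ->
  \sum_(J : {ffun 'I_p -> 'I_N}) A (basis_mx R J *m P) *
    \sum_(I : {ffun 'I_m -> 'I_N}) B (basis_mx R I *m P) *
      G (col_mx (basis_mx R I *m P) (basis_mx R J *m P)) =
  \sum_(J : {ffun 'I_p -> 'I_N}) A (basis_mx R J) *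
    \sum_(I : {ffun 'I_m -> 'I_N}) B (basis_mx R I) * G (col_mx (basis_mx R I) (basis_mx R J)).
Proof.
move=> mA mB mG PT GP.
pose C W := \sum_(I : {ffun 'I_m -> 'I_N}) B (basis_mx R I) * G (col_mx (basis_mx R I *m P) W).
have mC : multilinear C by apply: multilinear_sumf => I; exact: multilinear_col_mxd.
transitivity (\sum_(J : {ffun 'I_p -> 'I_N}) A (basis_mx R J *m P) * C (basis_mx R J)).
  apply: eq_bigr => J _; congr (_ * _).
  under eq_bigr => I _ do rewrite -mul_col_mx GP.
  rewrite (contraction_mulmx _ mB (multilinear_col_mxu (basis_mx R J) mG)).
  by rewrite PT.
rewrite (contraction_mulmx _ mA mC) PT; apply: eq_bigr => J _; congr (_ * _).
by apply: eq_bigr => I _; rewrite -mul_col_mx GP.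
Qed.

Section HodgeFormulas.
Variables (R : realType) (o : bool).

Lemma volume_formE n x (T : 'M[R]_(n, n.+1)) :
  volume_form o x T = (-1) ^+ o * detcol x T.
Proof. by rewrite /volume_form /detcol conform_mx_id. Qed.

Lemma hodgeE m p (beta : dform R (m + p) m) x W :
  hodge o (q := p) beta x W = (-1) ^+ o * (m`!%:R)^-1 *
    \sum_(I : {ffun 'I_m -> 'I_(m + p).+1}) beta x (frame x I) * detcol x (col_mx (frame x I) W).
Proof.
rewrite /hodge -mulrA mulrCA; congr (_ * _); rewrite mulr_sumr.
by apply: eq_bigr => I _; rewrite volume_formE mulrCA.
Qed.

Lemma dot_hodgeE m p (alpha : dform R (m + p) p) (beta : dform R (m + p) m) x :
  sphere x -> multilinear (alpha x) -> multilinear (beta x) ->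
  dform_dot alpha (hodge o (q := p) beta) x =
  (p`!%:R)^-1 * ((-1) ^+ o * (m`!%:R)^-1) *
    \sum_(J : {ffun 'I_p -> 'I_(m + p).+1}) alpha x (basis_mx R J) *
      \sum_(I : {ffun 'I_m -> 'I_(m + p).+1}) beta x (basis_mx R I) *
        detcol x (col_mx (basis_mx R I) (basis_mx R J)).
Proof.
move=> Sx ma mb; rewrite /dform_dot -mulrA; congr (_ * _).
have GP T : detcol x (T *m tprojmx x) = detcol x T by exact: detcol_proj.
rewrite -(contraction_proj2 ma mb (detcol_multilinear x) (tprojmx_tr x) GP) mulr_sumr.
apply: eq_bigr => J _; rewrite hodgeE mulrCA !frameE; congr (_ * (_ * _)).
by apply: eq_bigr => I _; rewrite frameE.
Qed.

End HodgeFormulas.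

Lemma sum_signed_terms (R : comRingType) (I J K L : finType) (sk : K -> R) (sl : L -> R)
    (A : K -> J -> R) (B : L -> I -> R) (v : I -> J -> R) :
  \sum_j (\sum_k sk k * A k j) * \sum_i (\sum_l sl l * B l i) * v i j =
  \sum_k \sum_l sk k * sl l * \sum_i \sum_j A k j * (B l i * v i j).
Proof.
under eq_bigr => j _ do rewrite mulr_suml.
rewrite exchange_big; apply: eq_bigr => k _ /=.
under eq_bigr => j _ do rewrite mulr_sumr.
rewrite exchange_big /=.
under eq_bigr => i _.
  under eq_bigr => j _ do rewrite mulr_suml mulr_sumr.
  rewrite exchange_big; over.
rewrite exchange_big; apply: eq_bigr => l _ /=.
rewrite mulr_sumr; apply: eq_bigr => i _; rewrite mulr_sumr; apply: eq_bigr => j _.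
by rewrite -!mulrA; congr (_ * _); rewrite mulrCA.
Qed.

Lemma mulf_exprV_swap (F : fieldType) (c d D : F) q : c != 0 ->
  c * d = c^-1 ^+ q * D -> d = c^-1 ^+ q.+1 * D.
Proof. by move=> c0 e; rewrite exprS -mulrA -e mulKf. Qed.

Lemma coef_derive_scale (R : realType) (n q : nat) (alpha : dform R n q) W (c : R)
    (y w : 'rV[R]_n.+1) : smooth_dform alpha -> y != 0 -> 0 < c ->
  'D_w (fun z => pullback alpha z W) (c *: y) =
  c^-1 ^+ q.+1 * 'D_w (fun z => pullback alpha z W) y.
Proof.
move=> sa y0 c0; have cy0 : c *: y != 0 by rewrite scaler_eq0 negb_or gt_eqF.
pose F z : R := pullback alpha z W.
have E : c * 'D_w F (c *: y) = c^-1 ^+ q * 'D_w F y.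
  apply: derive_scale; last by apply: diff_derivable; exact: coef_differentiable.
    by apply: filterS (near_neq0 y0) => z z0; exact: pullback_scale.
  exact: coef_differentiable.
exact: (mulf_exprV_swap (lt0r_neq0 c0) E).
Qed.

Lemma coef_derive_retract (R : realType) (n q d : nat) (alpha : dform R n q) W
    (y u w : 'rV[R]_n.+1) : smooth_dform alpha -> y != 0 -> q.+1 = d -> u = w ->
  'D_u (fun z => pullback alpha z W) (retract y) =
  enorm y ^+ d * 'D_w (fun z => pullback alpha z W) y.
Proof.
move=> sa y0 <- ->; have ri0 : 0 < (enorm y)^-1 by rewrite invr_gt0 enorm_gt0.
by rewrite -[X in X ^+ _]invrK; exact: coef_derive_scale.
Qed.

(** Stokes: [<d psi, * d eta> dV] is, up to sign, [d psi /\ d eta], which is exact.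
    It is written as the integrand of [integral_exact_wedge] by taking for [a] and
    [e] the coefficients of the pullbacks of [psi] and [eta]. *)
Lemma integral_exact_dot_curl (R : realType) (p : nat) (o : bool) (c : R)
    (psi : dform R (p.+1 + p) p.-1) (eta : dform R (p.+1 + p) p) (f : 'rV[R]_(p.+1 + p).+1 -> R) :
  smooth_dform psi -> smooth_dform eta -> sphere_cont f ->
  (forall x, sphere x -> f x = c * dform_dot (extd (q := p) psi) (curl o eta) x) ->
  integral_sphere f = 0.
Proof.
move=> sp se cf fE.
pose a (k : 'I_p) (J : {ffun 'I_p -> 'I_(p.+1 + p).+1}) z : R := pullback psi z (row' k (basis_mx R J)).
pose e (l : 'I_p.+1) (I : {ffun 'I_p.+1 -> 'I_(p.+1 + p).+1}) z : R := pullback eta z (row' l (basis_mx R I)).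
apply: (@integral_exact_wedge R p.+1 p a e _ _ _ _ _ _ _ (c * ((p`!%:R)^-1 * ((-1) ^+ o * ((p.+1)`!%:R)^-1))) p f cf).
- by move=> k J j; rewrite /a -set_row_basis row'_set_row.
- by move=> l I j; rewrite /e -set_row_basis row'_set_row.
- by move=> k J y y0; exact: coef_differentiable.
- by move=> k J v y y0; exact: coef_derive_differentiable.
- by move=> l I y y0; exact: coef_differentiable.
- by move=> l I v y y0; exact: coef_derive_differentiable.
- by move=> l I u v y y0; exact: coef_derive2_differentiable.
move=> y y0; have Sx := retract_sphere y0; have x0 := sphere_neq0 Sx.
have r0 := enorm_gt0 y0; set r := enorm y in r0.
have ri0 : 0 < r^-1 by rewrite invr_gt0.
rewrite fE// /curl dot_hodgeE//; do ?exact: extd_multilinear.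
rewrite [RHS]mulrCA [LHS]mulrA; congr (_ * _).
pose A (k : 'I_p) (J : {ffun 'I_p -> 'I_(p.+1 + p).+1}) : R := 'D_(delta_mx 0 (J k)) (a k J) y.
pose B (l : 'I_p.+1) (I : {ffun 'I_p.+1 -> 'I_(p.+1 + p).+1}) : R := 'D_(delta_mx 0 (I l)) (e l I) y.
pose v (I : {ffun 'I_p.+1 -> 'I_(p.+1 + p).+1}) (J : {ffun 'I_p -> 'I_(p.+1 + p).+1}) : R :=
  detcol y (col_mx (basis_mx R I) (basis_mx R J)).
have extA J : extd (q := p) psi (retract y) (basis_mx R J) =
    \sum_(k < p) (-1) ^+ k * (r ^+ p * A k J).
  apply: eq_bigr => k _; congr (_ * _).
  by apply: coef_derive_retract => //; [exact: ltn_predK (ltn_ord k)|rewrite rowK].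
have extB I : extd (q := p.+1) eta (retract y) (basis_mx R I) =
    \sum_(l < p.+1) (-1) ^+ l * (r ^+ p.+1 * B l I).
  apply: eq_bigr => l _; congr (_ * _).
  by apply: coef_derive_retract => //; rewrite rowK.
have extv I J : detcol (retract y) (col_mx (basis_mx R I) (basis_mx R J)) = r^-1 * v I J.
  have -> : retract y = r^-1 *: y + 0 *: y by rewrite scale0r addr0.
  by rewrite detcol_linear mul0r addr0.
transitivity (\sum_J (\sum_(k < p) (-1) ^+ k * (r ^+ p * A k J)) *
   \sum_I (\sum_(l < p.+1) (-1) ^+ l * (r ^+ p.+1 * B l I)) * (r^-1 * v I J)).
  apply: eq_bigr => J _; rewrite extA; congr (_ * _).
  by apply: eq_bigr => I _; rewrite extB extv.
rewrite (sum_signed_terms _ _ (fun k J => r ^+ p * A k J) (fun l I => r ^+ p.+1 * B l I)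
  (fun I J => r^-1 * v I J)).
rewrite mulr_sumr; apply: eq_bigr => k _; rewrite mulr_sumr; apply: eq_bigr => l _.
rewrite mulrCA; congr (_ * _).
rewrite mulr_sumr; apply: eq_bigr => I _; rewrite mulr_sumr; apply: eq_bigr => J _.
(* The coefficients of the two differentials are homogeneous of degrees [-p] and
   [-p-1] and the determinant of degree 1, in total [-2 p]. *)
have -> : dotp y y ^+ p = r ^+ p * (r ^+ p.+1 * r^-1).
  by rewrite -enorm_sqr -exprM mul2n -addnn exprD exprSr mulfK ?gt_eqF.
rewrite -/(A k J) -/(B l I) -/(v I J).
by move: (A k J) (B l I) (v I J) (r ^+ p) (r ^+ p.+1) (r^-1) => *; ring.
Qed.

(** * Pullback of forms by orthogonal maps *)

Lemma near_eq_differentiable (R : realType) (N : nat) (f g : 'rV[R]_N -> R) (y : 'rV[R]_N) :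
  (\forall z \near y, f z = g z) -> differentiable f y -> differentiable g y.
Proof.
move=> fg /diff_locallyP[cdf /eqaddoP fE].
have gE : g \o shift y = cst (g y) + 'd f y +o_ (0 : 'rV[R]_N) id.
  apply/eqaddoP => e e0; have fe := fE e e0.
  have sfg : \forall h \near (0 : 'rV[R]_N), f (h + y) = g (h + y).
    by move: fg; rewrite (near_shift 0 y); apply: filterS => h /=; rewrite subr0.
  apply: filterS2 fe sfg => h fh fgh; move: fh.
  by rewrite /= -[(f \o shift y - _) h]/(f (h + y) - (f y + 'd f y h))
    -[(g \o shift y - _) h]/(g (h + y) - (g y + 'd f y h)) fgh (nbhs_singleton fg).
have dgf := diff_unique cdf gE.
by apply/diff_locallyP; rewrite dgf.
Qed.

Section LinearChange.
Variables (R : realType) (N : nat) (Q : 'M[R]_N).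
Implicit Types (f : 'rV[R]_N -> R) (y v : 'rV[R]_N).

Lemma mulmxr_differentiable y : differentiable (fun y => y *m Q) y.
Proof.
rewrite (_ : (fun y => y *m Q) = \sum_j (fun y : 'rV[R]_N => y 0 j *: row j Q)).
  apply: differentiable_sum => j; apply: differentiableZl; exact: differentiable_coord.
by apply/funext => z; rewrite fct_sumE mulmx_sum_row.
Qed.

Lemma comp_mulmxr_differentiable f y : differentiable f (y *m Q) ->
  differentiable (fun z => f (z *m Q)) y.
Proof.
move=> df; apply: (@differentiable_comp _ _ _ _ (fun z => z *m Q) f) => //.
exact: mulmxr_differentiable.
Qed.

Lemma derive_mulmxr f y v : 'D_v (fun z => f (z *m Q)) y = 'D_(v *m Q) f (y *m Q).
Proof.
rewrite /derive.
have -> : (fun h : R => h^-1 *: (((fun z => f (z *m Q)) \o shift y) (h *: v) - f (y *m Q))) =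
  (fun h => h^-1 *: ((f \o shift (y *m Q)) (h *: (v *m Q)) - f (y *m Q))).
  by apply/funext => h /=; rewrite mulmxDl -scalemxAl.
by [].
Qed.

(** Derivatives of [f (y *m Q)] along [vs] are derivatives of [f] along the images
    of [vs]. *)
Lemma smooth_off0_mulmxr (s : R) f g :
  (forall y, y != 0 -> y *m Q != 0) -> (forall y, y != 0 -> g y = s * f (y *m Q)) ->
  smooth_off0 f -> smooth_off0 g.
Proof.
move=> Q0 gE sf vs.
pose Df vs := foldr (fun v (g : 'rV[R]_N -> R) => 'D_v g) f vs.
pose Dg vs := foldr (fun v (g : 'rV[R]_N -> R) => 'D_v g) g vs.
have dF us y : y != 0 -> differentiable (fun z => s * Df us (z *m Q)) y.
  move=> y0; apply: differentiableM => //; apply: comp_mulmxr_differentiable.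
  by apply: sf; exact: Q0.
have H us y : y != 0 -> Dg us y = s * Df [seq v *m Q | v <- us] (y *m Q).
  elim: us y => [|v us IH] y y0; first exact: gE.
  have E : \forall z \near y, Dg us z = s * Df [seq v *m Q | v <- us] (z *m Q).
    by apply: filterS (near_neq0 y0) => z; exact: IH.
  apply: (etrans (near_eq_derive v E)).
  have dq : derivable (fun z => Df [seq v *m Q | v <- us] (z *m Q)) y v.
    by apply: diff_derivable; apply: comp_mulmxr_differentiable; apply: sf; exact: Q0.
  apply: (etrans (deriveZ s dq)); rewrite derive_mulmxr //.
move=> y y0; apply: (near_eq_differentiable _ (dF [seq v *m Q | v <- vs] y y0)).
by apply: filterS (near_neq0 y0) => z z0; rewrite -H.
Qed.

End LinearChange.

Section Isometry.
Variables (R : realType) (n : nat) (Q : 'M[R]_n.+1) (s : R).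
Hypothesis QQ : Q *m Q^T = 1%:M.
Implicit Types (x y v w : 'rV[R]_n.+1).

(** The pullback by the isometry [x |-> x *m Q], with a factor [s] that will serve
    as a sign. *)
Definition isopull p (alpha : dform R n p) : dform R n p :=
  fun x W => s * alpha (x *m Q) (W *m Q).

Lemma dotp_isometry v w : dotp (v *m Q) (w *m Q) = dotp v w.
Proof. by rewrite /dotp trmx_mul mulmxA -(mulmxA v) QQ mulmx1. Qed.

Lemma enorm_isometry v : enorm (v *m Q) = enorm v.
Proof. by rewrite /enorm dotp_isometry. Qed.

Lemma retract_isometry v : retract (v *m Q) = retract v *m Q.
Proof. by rewrite /retract enorm_isometry -scalemxAl. Qed.

Lemma isometry_neq0 y : y != 0 -> y *m Q != 0.
Proof. by rewrite -!dotpp_eq0 dotp_isometry. Qed.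

Lemma sphere_isometry x : sphere x -> sphere (x *m Q).
Proof. by rewrite /sphere /= enorm_isometry. Qed.

Lemma tangent_isometry p x (W : 'M[R]_(p, n.+1)) : tangent x W -> tangent (x *m Q) (W *m Q).
Proof. by rewrite /tangent trmx_mul mulmxA -(mulmxA W) QQ mulmx1. Qed.

Lemma tprojmx_isometry x : tprojmx x *m Q = Q *m tprojmx (x *m Q).
Proof.
rewrite /tprojmx mulmxBl mulmxBr mul1mx mulmx1 trmx_mul; congr (_ - _).
by rewrite !mulmxA QQ mul1mx.
Qed.

Lemma pullback_isometry p (alpha : dform R n p) y W : y != 0 ->
  pullback (isopull alpha) y W = s * pullback alpha (y *m Q) (W *m Q).
Proof.
move=> y0; rewrite !pullbackE//; last exact: isometry_neq0.
rewrite /isopull retract_isometry enorm_isometry; congr (_ * alpha _ _).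
by rewrite -mulmxA tprojmx_isometry mulmxA scalemxAl.
Qed.

Lemma smooth_isopull p (alpha : dform R n p) : smooth_dform alpha -> smooth_dform (isopull alpha).
Proof.
move=> [alt sm]; split=> [x Sx|W].
  have [lin alt0] := alt _ (sphere_isometry Sx); split.
    move=> i b c A B C tA tB tC rA rB rC; rewrite /isopull.
    rewrite (lin i b c _ (B *m Q) (C *m Q)); first by ring.
    - exact: tangent_isometry.
    - exact: tangent_isometry.
    - exact: tangent_isometry.
    - by rewrite !row_mul rA mulmxDl -!scalemxAl.
    - by rewrite !row'_mulmx rB.
    - by rewrite !row'_mulmx rC.
  move=> i j A tA ij rij; rewrite /isopull (alt0 i j) ?mulr0//.
    exact: tangent_isometry.
  by rewrite !row_mul rij.
apply: (smooth_off0_mulmxr (Q := Q) (s := s) isometry_neq0 _ (sm (W *m Q))) => y y0.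
exact: pullback_isometry.
Qed.

Lemma extd_isopull q (alpha : dform R n q.-1) x W : smooth_dform alpha -> x != 0 ->
  extd (q := q) (isopull alpha) x W = s * extd (q := q) alpha (x *m Q) (W *m Q).
Proof.
move=> sa x0; rewrite /extd mulr_sumr; apply: eq_bigr => k _; rewrite [RHS]mulrCA; congr (_ * _).
have E : \forall z \near x, pullback (isopull alpha) z (row' k W) =
    s * pullback alpha (z *m Q) (row' k W *m Q).
  by apply: filterS (near_neq0 x0) => z; exact: pullback_isometry.
apply: (etrans (near_eq_derive _ E)).
have dq : derivable (fun z => pullback alpha (z *m Q) (row' k W *m Q)) x (row k W).
  apply: diff_derivable; apply: (comp_mulmxr_differentiable (f := fun z => pullback alpha z (row' k W *m Q))).
  by apply: coef_differentiable => //; exact: isometry_neq0.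
apply: (etrans (deriveZ s dq)).
by rewrite (derive_mulmxr Q (fun z => pullback alpha z (row' k W *m Q))) row'_mulmx row_mul.
Qed.

End Isometry.

(** The exterior derivative commutes with pullbacks, and the Hodge star picks up
    the factor [\det Q] because the volume form does. *)
Lemma curl_isopull (R : realType) (p : nat) (o : bool) (Q : 'M[R]_((p.+1 + p).+1)) (s : R)
    (alpha : dform R (p.+1 + p) p) x W :
  Q *m Q^T = 1%:M -> smooth_dform alpha -> sphere x ->
  curl o (isopull Q s alpha) x W = \det Q * isopull Q s (curl o alpha) x W.
Proof.
move=> QQ sa Sx; have SQ := sphere_isometry QQ Sx.
have dQ : \det Q * \det Q = 1 by rewrite -[X in _ * X]det_tr -det_mulmx QQ det1.
rewrite /isopull /curl !hodgeE.
have eA : multilinear (extd (q := p.+1) alpha (x *m Q)).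
  by apply: extd_multilinear => //; exact: sphere_neq0.
pose A U := extd (q := p.+1) alpha (x *m Q) (U *m tprojmx (x *m Q)).
pose B U := detcol (x *m Q) (col_mx (U *m tprojmx (x *m Q)) (W *m Q)).
have mA : multilinear A by exact: multilinear_mulmx.
have mB : multilinear B.
  exact: (multilinear_mulmx _ (multilinear_col_mxu (W *m Q) (detcol_multilinear _))).
have H : \sum_I A (basis_mx R I *m Q) * B (basis_mx R I *m Q) = \sum_I A (basis_mx R I) * B (basis_mx R I).
  rewrite (contraction_mulmx Q mA (multilinear_mulmx Q mB)).
  apply: eq_bigr => I _; congr (_ * B _).
  by rewrite -mulmxA (mulmx1C QQ) mulmx1.
rewrite [RHS]mulrA [RHS]mulrCA; congr (_ * _).
transitivity (\det Q * s * \sum_I A (basis_mx R I) * B (basis_mx R I)); last first.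
  by congr (_ * _); apply: eq_bigr => I _; rewrite frameE.
rewrite -H mulr_sumr; apply: eq_bigr => I _.
have E : basis_mx R I *m Q *m tprojmx (x *m Q) = frame x I *m Q.
  by rewrite frameE -!mulmxA tprojmx_isometry.
have comb (e e' g g' d : R) : d * d = 1 -> e' = s * e -> g' = d * g ->
    e' * g = d * s * (e * g').
  move=> dd -> ->; transitivity (d * d * (s * e * g)); first by rewrite dd mul1r.
  by ring.
apply: comb dQ _ _; first exact: (etrans (extd_isopull (q := p.+1) s QQ _ sa (sphere_neq0 Sx)) (congr1 (fun U => s * extd (q := p.+1) alpha (x *m Q) U) (esym E))).
by rewrite /B E -mul_col_mx detcol_mulmx.
Qed.

(** * A reflection under which a form correlates with itself *)

Lemma multilinear_diag (R : numFieldType) (N p : nat) (A : 'M[R]_(p, N) -> R) c W :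
  multilinear A -> A (diag_mx c *m W) = (\prod_k c 0 k) * A W.
Proof.
move=> mA; rewrite (multilinear_expand (_ *m _) mA) (multilinear_expand W mA) mulr_sumr.
apply: eq_bigr => I _; rewrite mulrA; congr (_ * _).
by rewrite -big_split; apply: eq_bigr => k _; rewrite mul_diag_mx mxE.
Qed.

(** The Householder reflection that exchanges the first basis vector with [x]. *)
Lemma exists_orthogonal_row0 (R : realType) (n : nat) (x : 'rV[R]_n.+1) : sphere x ->
  exists U : 'M[R]_n.+1, U *m U^T = 1%:M /\ row 0 U = x.
Proof.
move=> Sx; pose e0 : 'rV[R]_n.+1 := delta_mx 0 0; pose u := e0 - x.
have [u0|u0] := eqVneq u 0.
  exists 1%:M; rewrite trmx1 mulmx1; split=> //.
  by rewrite row1; apply/eqP; rewrite -subr_eq0; apply/eqP.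
have du := dotpp_gt0 u0; set d := dotp u u in du.
have ee : dotp e0 e0 = 1 by rewrite dotp_delta mxE !eqxx.
have dE : d = 2 * dotp e0 u.
  have dN (a b : 'rV[R]_n.+1) : dotp a (- b) = - dotp a b by rewrite -scaleN1r dotpZr mulN1r.
  rewrite /d /u !(dotpDl, dotpDr) -scaleN1r !(dotpZl, dotpZr) ee (dotpC x e0) sphere_dotp//.
  by ring.
pose U := 1%:M - (2 / d) *: (u^T *m u).
have UT : U^T = U by rewrite /U linearB/= trmx1 linearZ/= trmx_mul trmxK.
have uu : u *m u^T = d%:M by rewrite [u *m u^T]mx11_scalar.
exists U; split; last first.
  rewrite rowE -/e0 /U mulmxBr mulmx1 -scalemxAr mulmxA [e0 *m u^T]mx11_scalar.
  rewrite -/(dotp e0 u) mul_scalar_mx scalerA.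
  have -> : 2 / d * dotp e0 u = 1.
    by rewrite mulrAC -dE mulfV// gt_eqF.
  by rewrite scale1r /u opprB addrC subrK.
have sq (K : 'M[R]_n.+1) : K *m K = K + K -> (1%:M - K) *m (1%:M - K) = 1%:M.
  move=> KK; rewrite mulmxBl mul1mx mulmxBr mulmx1 KK.
  have -> : K - (K + K) = - K by rewrite opprD addrA subrr sub0r.
  by rewrite opprK subrK.
rewrite UT; apply: sq; rewrite -scalemxAl -scalemxAr mulmxA -(mulmxA u^T) uu.
rewrite mul_mx_scalar -scalemxAl !scalerA -scalerDl; congr (_ *: _).
by field; rewrite gt_eqF.
Qed.

(** At most one factor is -1. *)
Lemma prod_sign_injective (R : comRingType) (p N : nat) (I : 'I_p -> 'I_N) (i : 'I_N) :
  injective I ->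
  \prod_k (if I k == i then -1 else 1 : R) = 1 - 2 * \sum_k (I k == i)%:R.
Proof.
move=> inj; have [/existsP[k /eqP ki]|/existsPn none] := boolP [exists k, I k == i].
  rewrite (bigD1 k)//= [in RHS](bigD1 k)//= ki eqxx !big1 => [|j jk|j jk]; first by rewrite /= mulr1n addr0 !mulr1; ring.
    by case: eqP => // ji; case/eqP: jk; apply: inj; rewrite ji.
  by case: eqP => // ji; case/eqP: jk; apply: inj; rewrite ji.
rewrite !big1 => [|k _|k _]; first by ring.
  by rewrite (negbTE (none k)).
by rewrite (negbTE (none k)).
Qed.

Section ChooseReflection.
Variables (R : realType) (p : nat).
Notation n := (p.+1 + p)%N.
Variables (xi : dform R n p) (x0 : 'rV[R]_n.+1).
Hypothesis Sx : sphere x0.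
Hypothesis alt : alternating_at x0 (xi x0).

Let A := tangential xi x0.
Let mA : multilinear A. Proof. exact: tangential_multilinear. Qed.

Let A_radial (W : 'M[R]_(p, n.+1)) k : row k W = x0 -> A W = 0.
Proof.
move=> Wk; rewrite -(set_row_id k W) Wk -[RHS](multilinear0 k W mA).
rewrite /A /tangential; congr (xi _ _); apply/row_matrixP => i.
rewrite !row_mul !rowK; case: eqP => // _; rewrite mul0mx.
by rewrite -tprojE /tproj sphere_dotp// scale1r subrr.
Qed.

Let A_alternates (W : 'M[R]_(p, n.+1)) k l : k != l -> row k W = row l W -> A W = 0.
Proof.
move=> kl rW; apply: (alt.2 k l) => //; first exact: tangent_tprojmx.
by rewrite !row_mul rW.
Qed.

(** In an orthonormal basis with first vector [x0], the reflection in the [i]-th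
    vector multiplies the components of [xi] by -1 if their index contains [i] and
    by 1 otherwise.  Summed over the [2 p + 1] directions tangent at [x0], the
    inner products [<xi, Q_i^* xi>] give [(2 p + 1 - 2 p) |xi|^2], which is
    positive, so one of them does not vanish. *)
Lemma exists_reflection W0 : tangent x0 W0 -> xi x0 W0 != 0 ->
  exists Q : 'M[R]_n.+1, [/\ Q *m Q^T = 1%:M, \det Q = -1 &
    dform_dot xi (isopull Q 1 xi) x0 != 0].
Proof.
move=> tW xiW; have [U [UU Ux]] := exists_orthogonal_row0 Sx.
have UtU := mulmx1C UU.
pose D (i : 'I_n.+1) : 'M[R]_n.+1 := diag_mx (\row_j (if j == i then -1 else 1)).
have DT i : (D i)^T = D i by rewrite tr_diag_mx.
have DD i : D i *m D i = 1%:M.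
  rewrite /D mulmx_diag -diag_const_mx; congr diag_mx; apply/rowP => j; rewrite !mxE.
  by case: eqP; rewrite ?mulrNN mulr1.
(* The reflection in the [i]-th row of [U]. *)
pose Q i := U^T *m D i *m U.
have QQ i : Q i *m (Q i)^T = 1%:M.
  rewrite /Q !trmx_mul trmxK DT -!mulmxA (mulmxA U) UU mul1mx (mulmxA (D i)) DD mul1mx.
  exact: UtU.
have detQ i : \det (Q i) = -1.
  rewrite /Q !det_mulmx mulrAC -det_mulmx UtU det1 mul1r det_diag (bigD1 i)//= mxE eqxx.
  by rewrite big1 ?mulr1// => j ji; rewrite mxE (negbTE ji).
have xQ i : i != 0 -> x0 *m Q i = x0.
  move=> i0; rewrite -Ux /Q rowE !mulmxA -(mulmxA _ U) UU mulmx1; congr (_ *m _).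
  rewrite /D mul_mx_diag; apply/rowP => j; rewrite !mxE eqxx/=.
  by have [->|ji] := eqVneq j i; rewrite ?mulr1// (negbTE i0) mul0r.
pose B W := A (W *m U).
have mB : multilinear B by exact: multilinear_mulmx.
have dotE i : i != 0 -> dform_dot xi (isopull (Q i) 1 xi) x0 =
   (p`!%:R)^-1 * \sum_I A (basis_mx R I) * A (basis_mx R I *m Q i).
  move=> i0; rewrite /dform_dot; congr (_ * _); apply: eq_bigr => I _.
  rewrite /isopull mul1r frameE xQ// -mulmxA tprojmx_isometry// xQ// mulmxA.
  by [].
have contr i : \sum_I A (basis_mx R I) * A (basis_mx R I *m Q i) =
   \sum_I B (basis_mx R I) * B (basis_mx R I *m D i).
  rewrite (contraction_mulmx U mA (multilinear_mulmx (D i) mB)).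
  by apply: eq_bigr => I _; rewrite /B /Q !mulmxA.
have signs i I : B (basis_mx R I *m D i) =
    (\prod_k (if I k == i then -1 else 1)) * B (basis_mx R I).
  have -> : basis_mx R I *m D i = diag_mx (\row_k (if I k == i then -1 else 1)) *m basis_mx R I.
    apply/matrixP => k j; rewrite mul_mx_diag mul_diag_mx !mxE eqxx/= mulrC.
    by case: (eqVneq j (I k)) => [->//|_]; rewrite !mulr0.
  rewrite multilinear_diag//; congr (_ * _).
  by apply: eq_bigr => k _; rewrite mxE.
have total : \sum_(i | i != 0) \sum_I B (basis_mx R I) * B (basis_mx R I *m D i) =
   \sum_I B (basis_mx R I) ^+ 2.
  rewrite exchange_big; apply: eq_bigr => I _ /=.
  have [B0|B0] := eqVneq (B (basis_mx R I)) 0.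
    by rewrite B0 expr0n big1// => i _; rewrite mul0r.
  have injI : injective I.
    move=> k l kl; apply: contraNeq B0 => neq; apply/eqP; apply: (A_alternates neq).
    by rewrite !row_mul !rowK kl.
  have I0 k : I k != 0.
    apply: contraNneq B0 => Ik; apply/eqP; apply: (@A_radial _ k).
    by rewrite row_mul rowK Ik -rowE.
  under eq_bigr => i _ do rewrite signs mulrCA -expr2 prod_sign_injective//.
  rewrite -mulr_suml -[RHS]mul1r; congr (_ * _).
  rewrite sumrB -mulr_sumr exchange_big /= sumr_const.
  rewrite (eq_bigr (fun=> 1)) => [|k _]; last first.
    rewrite (bigD1 (I k))//= eqxx big1 ?addr0// => i /andP[_ ik].
    by rewrite eq_sym (negbTE ik).
  rewrite sumr_const card_ord cardC1 card_ord /=.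
  by rewrite natrD -[p.+1]addn1 natrD; ring.
have pos : 0 < \sum_I B (basis_mx R I) ^+ 2.
  rewrite lt_def sumr_ge0 ?andbT => [|I _]; last exact: sqr_ge0.
  apply: contra_neq xiW => /eqP; rewrite psumr_eq0 => [/allP h|I _]; last exact: sqr_ge0.
  have B0 : B (W0 *m U^T) = 0.
    apply: multilinear_eq0 => // I.
    by have := h I (mem_index_enum _); rewrite /= sqrf_eq0 => /eqP.
  by rewrite -B0 /B -mulmxA UtU mulmx1 /A /tangential tprojmx_id.
have [i /andP[i0 ci]] : exists i, (i != 0) && (dform_dot xi (isopull (Q i) 1 xi) x0 != 0).
  apply/existsP; apply: contraTT pos => /existsPn none.
  rewrite -total -leNgt; apply: sumr_le0 => i i0; have := none i; rewrite i0 negbK /= dotE//.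
  rewrite mulf_eq0 invr_eq0 pnatr_eq0 -leqn0 leqNgt fact_gt0 /= => /eqP e.
  by rewrite -contr e.
by exists (Q i); split.
Qed.

End ChooseReflection.

(** * Power means and Hoelder on the sphere *)

Section PowerInequalities.
Variable R : realType.
Implicit Types (t a b q theta : R).

Lemma continuous_norm_powR a : 0 < a -> continuous (fun t : R => `|t| `^ a).
Proof.
move=> a0 t; have [->|t0] := eqVneq t 0.
  rewrite /continuous_at normr0 powR0 ?gt_eqF//.
  apply/cvgrPdist_le => e e0; near=> s; rewrite sub0r normrN ger0_norm ?powR_ge0//.
  have -> : e = (e `^ a^-1) `^ a by rewrite -powRrM mulVf ?gt_eqF// powRr1// ltW.
  apply: ge0_ler_powR; rewrite ?nnegrE ?powR_ge0 ?(ltW a0)//.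
  near: s; exists (e `^ a^-1); first exact: powR_gt0.
  by move=> s /=; rewrite sub0r normrN => /ltW.
have nt0 : 0 < `|t| by rewrite normr_gt0.
have c : {for `|t|, continuous (fun s : R => s `^ a)}.
  apply: differentiable_continuous; apply/derivable1_diffP; apply: derivable_powR.
  by rewrite in_itv/= nt0.
exact: (cvg_comp _ _ (@norm_continuous _ _ t) c).
Unshelve. all: by end_near. Qed.

(** Strict concavity at the point 1.  In terms of [x = ln t] this is
    [1 < theta e^((1 - theta) x) + (1 - theta) e^(- theta x)], which follows from
    [1 + s < e^s] for both exponentials. *)
Lemma powR_lt_tangent t theta : 0 < theta < 1 -> 0 <= t -> t != 1 ->
  t `^ theta < theta * t + (1 - theta).
Proof.
move=> /andP[h0 h1]; rewrite le_eqVlt => /predU1P[<- _|t0 t1].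
  by rewrite powR0 ?gt_eqF// mulr0 add0r subr_gt0.
have lt0 : ln t != 0.
  by apply: contra_neq t1 => l0; rewrite -(lnK (t0 : t \is Num.pos)) l0 expR0.
rewrite /powR gt_eqF// -{2}(lnK (t0 : t \is Num.pos)); set x := ln t in lt0 *.
have e1 : 1 + (1 - theta) * x < expR ((1 - theta) * x).
  by rewrite expR_gt1Dx// mulf_neq0// subr_eq0 gt_eqF.
have e2 : 1 + (- theta) * x < expR ((- theta) * x).
  by rewrite expR_gt1Dx// mulf_neq0// oppr_eq0 gt_eqF.
have e3 : expR x = expR ((1 - theta) * x) * expR (theta * x).
  by rewrite -expRD -mulrDl subrK mul1r.
have e4 : expR ((- theta) * x) * expR (theta * x) = 1.
  by rewrite -expRD -mulrDl addNr mul0r expR0.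
have main : 1 < theta * expR ((1 - theta) * x) + (1 - theta) * expR ((- theta) * x).
  have h2 : theta * (1 + (1 - theta) * x) < theta * expR ((1 - theta) * x) by rewrite ltr_pM2l.
  have h3 : (1 - theta) * (1 + (- theta) * x) < (1 - theta) * expR ((- theta) * x).
    by rewrite ltr_pM2l// subr_gt0.
  apply: le_lt_trans (ltrD h2 h3).
  by rewrite le_eqVlt; apply/orP; left; apply/eqP; ring.
have -> : theta * expR x + (1 - theta) =
    (theta * expR ((1 - theta) * x) + (1 - theta) * expR ((- theta) * x)) * expR (theta * x).
  by rewrite mulrDl -(mulrA (1 - theta)) e4 mulr1 -mulrA -e3.
by rewrite -[ltLHS]mul1r ltr_pM2r ?expR_gt0.
Qed.

Lemma powR_le_tangent t theta : 0 < theta < 1 -> 0 <= t ->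
  t `^ theta <= theta * t + (1 - theta).
Proof.
move=> h t0; have [->|t1] := eqVneq t 1; last exact/ltW/powR_lt_tangent.
by rewrite powR1 mulr1 addrC subrK.
Qed.

End PowerInequalities.

Section SphereInequalities.
Variables (R : realType) (n : nat).
Notation V := 'rV[R]_n.+1.
Implicit Types (u v w : V -> R).

Lemma integral_sphereZ (c : R) u : sphere_cont u ->
  integral_sphere (fun x => c * u x) = c * integral_sphere u.
Proof.
move=> cu; rewrite -[RHS]addr0 -[X in _ + X](mul0r (integral_sphere u)) -integral_sphereD//.
apply: eq_integral_sphere => [|x _]; last by rewrite mul0r addr0.
have := sphere_contD (a := c) (b := 0) cu cu; apply: sphere_cont_eq => x _.
by rewrite mul0r addr0.
Qed.

Lemma integral_sphere0 : integral_sphere (fun _ : V => 0 : R) = 0.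
Proof.
have c0 : sphere_cont (fun _ : V => 0 : R) by exact: sphere_cont_cst.
by rewrite -[RHS](mul0r (integral_sphere (fun _ : V => 0 : R))) -integral_sphereZ//; congr integral_sphere; apply/funext => x; rewrite mul0r.
Qed.

Lemma integral_sphere_ge0 u : sphere_cont u -> (forall x, sphere x -> 0 <= u x) ->
  0 <= integral_sphere u.
Proof.
by move=> cu u0; rewrite -integral_sphere0; apply: le_integral_sphere => //; exact: sphere_cont_cst.
Qed.

Lemma integral_sphere_cst (c : R) : integral_sphere (fun _ : V => c) = c * sphere_volume R n.
Proof.
rewrite /sphere_volume -integral_sphereZ; last exact: sphere_cont_cst.
by congr integral_sphere; apply/funext => x; rewrite mulr1.
Qed.

Lemma sphere_volume_gt0 : 0 < sphere_volume R n.
Proof.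
apply: (integral_sphere_gt0 (x0 := delta_mx 0 0)) => //; first exact: sphere_cont_cst.
exact: sphere_delta.
Qed.

Lemma sphere_cont_powR u (a : R) : 0 < a -> sphere_cont u -> (forall x, sphere x -> 0 <= u x) ->
  sphere_cont (fun x => u x `^ a).
Proof.
move=> a0 cu u0; apply: (@sphere_cont_eq _ _ (fun x => `|u x| `^ a)).
  by move=> x Sx; rewrite ger0_norm// u0.
by apply: (sphere_cont_comp (h := fun t => `|t| `^ a)) => // x _; exact: continuous_norm_powR.
Qed.

(** The tangent inequality is integrated for the ratio of [u] to its mean value
    [A]. *)
Lemma power_mean u (theta : R) : 0 < theta < 1 -> sphere_cont u ->
  (forall x, sphere x -> 0 <= u x) -> 0 < integral_sphere u ->
  integral_sphere (fun x => u x `^ theta) `^ theta^-1 <=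
    sphere_volume R n `^ (theta^-1 - 1) * integral_sphere u /\
  ((exists x y, [/\ sphere x, sphere y & u x != u y]) ->
  integral_sphere (fun x => u x `^ theta) `^ theta^-1 <
    sphere_volume R n `^ (theta^-1 - 1) * integral_sphere u).
Proof.
move=> th cu u0 I0; have /andP[th0 th1] := th.
have V0 := sphere_volume_gt0; set vol := sphere_volume R n in V0 *.
set M := integral_sphere u in I0 *.
have [A A0 AE] : exists2 A : R, 0 < A & A = M / vol by exists (M / vol); rewrite ?divr_gt0.
have cp := sphere_cont_powR th0 cu u0.
pose T x := (A `^ theta * theta / A) * u x + (A `^ theta * (1 - theta)) * 1.
have cT : sphere_cont T by apply: sphere_contD => //; exact: sphere_cont_cst.
have uE x : sphere x -> u x `^ theta = A `^ theta * (u x / A) `^ theta.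
  move=> Sx; rewrite -powRM ?(ltW A0) ?divr_ge0 ?u0 ?(ltW A0)//.
  by rewrite mulrC mulfVK// gt_eqF.
have TE y : T y = A `^ theta * (theta * (u y / A) + (1 - theta)).
  rewrite /T mulr1 -!(mulrA (A `^ theta)) -mulrDr; congr (_ * (_ + _)).
  by rewrite -mulrA [_^-1 * _]mulrC.
have uT x : sphere x -> u x `^ theta <= T x.
  by move=> Sx; rewrite uE// TE ler_wpM2l ?powR_ge0// powR_le_tangent// divr_ge0 ?u0// ltW.
have IT : integral_sphere T = A `^ theta * vol.
  rewrite /T integral_sphereD//; last exact: sphere_cont_cst.
  rewrite -/M (_ : integral_sphere (fun=> 1) = vol)//; have -> : M = A * vol by rewrite AE mulfVK// gt_eqF.
  by field; rewrite gt_eqF.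
have rhsE : vol `^ (theta^-1 - 1) * M = (A `^ theta * vol) `^ theta^-1.
  rewrite powRM ?powR_ge0 ?(ltW V0)// -powRrM mulfV ?gt_eqF// powRr1 ?(ltW A0)//.
  rewrite powRB; last by rewrite (gt_eqF V0) implybT.
  by rewrite powRr1 ?(ltW V0)// AE; field; rewrite gt_eqF.
have Ip0 : 0 <= integral_sphere (fun x => u x `^ theta).
  by apply: integral_sphere_ge0 => // x _; exact: powR_ge0.
have Vi : 0 <= A `^ theta * vol by rewrite mulr_ge0 ?powR_ge0 ?ltW.
rewrite rhsE; split.
  apply: ge0_ler_powR; rewrite ?nnegrE ?invr_ge0 ?(ltW th0)//.
  by rewrite -IT; exact: le_integral_sphere.
move=> [x [y [Sx Sy xy]]]; apply: gt0_ltr_powR; rewrite ?nnegrE ?invr_gt0//.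
have [z Sz zA] : exists2 z, sphere z & u z / A != 1.
  have [xA|] := eqVneq (u x / A) 1; last by exists x.
  exists y => //; apply: contra_neq xy => yA.
  by rewrite -[u x](mulfVK (lt0r_neq0 A0)) xA -yA mulfVK// gt_eqF.
rewrite -IT -subr_gt0.
have -> : integral_sphere T - integral_sphere (fun x => u x `^ theta) =
  integral_sphere (fun x => 1 * T x + (-1) * u x `^ theta).
  by rewrite [RHS](integral_sphereD 1 (-1) cT cp) mul1r mulN1r.
apply: (integral_sphere_gt0 (x0 := z)) => //.
- exact: sphere_contD.
- by move=> w Sw; rewrite mul1r mulN1r subr_ge0 uT.
- rewrite mul1r mulN1r subr_gt0 uE// TE ltr_pM2l ?powR_gt0//.
  by apply: powR_lt_tangent => //; rewrite divr_ge0 ?u0// ltW.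
Qed.

(** Young's inequality is integrated for the functions divided by their norms,
    which are nonzero because the left-hand side is positive. *)
Lemma hoelder_sphere u v w (p q : R) : 0 < p -> 0 < q -> p^-1 + q^-1 = 1 ->
  sphere_cont u -> sphere_cont v -> sphere_cont w ->
  (forall x, sphere x -> 0 <= u x) -> (forall x, sphere x -> 0 <= v x) ->
  (forall x, sphere x -> w x <= u x * v x) -> 0 < integral_sphere w ->
  integral_sphere w <= integral_sphere (fun x => u x `^ p) `^ p^-1 *
                       integral_sphere (fun x => v x `^ q) `^ q^-1.
Proof.
move=> p0 q0 pq cu cv cw u0 v0 wuv Iw.
have cup := sphere_cont_powR p0 cu u0; have cvq := sphere_cont_powR q0 cv v0.
have [z Sz wz] : exists2 z, sphere z & 0 < w z.
  apply: contrapT => none; move: Iw; apply/negP; rewrite -leNgt -integral_sphere0.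
  apply: le_integral_sphere => //; first exact: sphere_cont_cst.
  by move=> x Sx; rewrite leNgt; apply/negP => wx; apply: none; exists x.
have uvz : 0 < u z * v z by exact: lt_le_trans (wuv z Sz).
have uz : 0 < u z by rewrite lt_def u0// andbT; apply: contraTneq uvz => ->; rewrite mul0r ltxx.
have vz : 0 < v z by rewrite lt_def v0// andbT; apply: contraTneq uvz => ->; rewrite mulr0 ltxx.
have Iu : 0 < integral_sphere (fun x => u x `^ p).
  by apply: (integral_sphere_gt0 (x0 := z)) => // [x _|]; [exact: powR_ge0|exact: powR_gt0].
have Iv : 0 < integral_sphere (fun x => v x `^ q).
  by apply: (integral_sphere_gt0 (x0 := z)) => // [x _|]; [exact: powR_ge0|exact: powR_gt0].
have root (c r : R) : 0 < c -> 0 < r -> exists X, [/\ 0 < X, X `^ r = c & c `^ r^-1 = X].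
  move=> c0 r0; exists (c `^ r^-1); split=> //; first exact: powR_gt0.
  by rewrite -powRrM mulVf ?gt_eqF// powRr1// ltW.
move: Iu Iv; move Ea : (integral_sphere (fun x => u x `^ p)) => a.
move Eb : (integral_sphere (fun x => v x `^ q)) => b Iu Iv.
have [X [X0 Xp ->]] := root a p Iu p0; have [Y [Y0 Yq ->]] := root b q Iv q0.
have XY : 0 < X * Y by rewrite mulr_gt0.
rewrite -[leRHS]mul1r -ler_pdivrMr// mulrC -integral_sphereZ//.
have -> : 1 = integral_sphere (fun x => (a * p)^-1 * u x `^ p + (b * q)^-1 * v x `^ q).
  rewrite integral_sphereD// Ea Eb !invfM mulrAC mulVf ?gt_eqF// mul1r.
  by rewrite mulrAC mulVf ?gt_eqF// mul1r pq.
apply: le_integral_sphere.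
- have := sphere_contD (a := (X * Y)^-1) (b := 0) cw cw; apply: sphere_cont_eq => x _.
  by rewrite mul0r addr0.
- exact: sphere_contD.
move=> x Sx; have ux := u0 x Sx; have vx := v0 x Sx.
apply: (@le_trans _ _ ((u x / X) * (v x / Y))).
  have -> : u x / X * (v x / Y) = (X * Y)^-1 * (u x * v x) by field; rewrite !gt_eqF.
  by rewrite ler_pM2l ?invr_gt0// wuv.
have ci (c : R) : 0 < c -> 0 <= c^-1 by move=> c0; rewrite invr_ge0 ltW.
apply: (le_trans (conjugate_powR (divr_ge0 ux (ltW X0)) (divr_ge0 vx (ltW Y0)) p0 q0 pq)).
have E (c d r s : R) : 0 <= c -> 0 < d -> d `^ r = s -> (c / d) `^ r / r = (s * r)^-1 * c `^ r.
  by move=> c0 d0 <-; rewrite powRM ?ci// -powR_inv1 ?(ltW d0)// powRAC powR_inv1 ?powR_ge0// invfM; ring.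
by rewrite (E _ _ _ _ ux X0 Xp) (E _ _ _ _ vx Y0 Yq).
Qed.

End SphereInequalities.

(** * Pointwise inner products of forms *)

Section FormIntegrands.
Variables (R : realType) (n : nat).
Notation V := 'rV[R]_n.+1.

Lemma sphere_cont_off0 (g : V -> R) :
  (forall y, y != 0 -> {for y, continuous g}) -> sphere_cont g.
Proof.
move=> cg y y0; exact: (cvg_comp _ _ (continuous_retract y0) (cg _ (sphere_neq0 (retract_sphere y0)))).
Qed.

Lemma sphere_cont_sum (I : Type) (r : seq I) (f : I -> V -> R) :
  (forall i, sphere_cont (f i)) -> sphere_cont (fun x => \sum_(i <- r) f i x).
Proof.
move=> cf; elim: r => [|i r IH].
  apply: (@sphere_cont_eq _ _ (fun=> 0)) => [x _|]; last exact: sphere_cont_cst.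
  by rewrite big_nil.
apply: (@sphere_cont_eq _ _ (fun x => 1 * f i x + 1 * \sum_(i <- r) f i x)) => [x _|].
  by rewrite big_cons !mul1r.
exact: sphere_contD.
Qed.

Lemma sphere_cont_prod (I : Type) (r : seq I) (f : I -> V -> R) :
  (forall i, sphere_cont (f i)) -> sphere_cont (fun x => \prod_(i <- r) f i x).
Proof.
move=> cf; elim: r => [|i r IH].
  apply: (@sphere_cont_eq _ _ (fun=> 1)) => [x _|]; last exact: sphere_cont_cst.
  by rewrite big_nil.
apply: (@sphere_cont_eq _ _ (fun x => f i x * \prod_(i <- r) f i x)) => [x _|].
  by rewrite big_cons.
exact: sphere_contM.
Qed.

Definition frame_cont p (alpha : dform R n p) :=
  forall I, sphere_cont (fun x => alpha x (frame x I)).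

Lemma smooth_frame_cont p (alpha : dform R n p) : smooth_dform alpha -> frame_cont alpha.
Proof.
move=> sa I; apply: (@sphere_cont_eq _ _ (fun x => pullback alpha x (basis_mx R I))).
  by move=> x Sx; rewrite dform_frame.
by apply: sphere_cont_off0 => y y0; apply: differentiable_continuous; exact: coef_differentiable.
Qed.

Lemma coord_sphere_cont (j : 'I_n.+1) : sphere_cont (fun x : V => x 0 j).
Proof.
apply: sphere_cont_off0 => y _; apply: differentiable_continuous.
exact: differentiable_coord.
Qed.

(** The frame moves with [x], so the values on it are expanded in the coefficients
    on the fixed basis, with polynomial weights. *)
Lemma extd_frame_cont q (psi : dform R n q.-1) : smooth_dform psi ->
  frame_cont (extd (q := q) psi).
Proof.
move=> sp J.
pose g (K : {ffun 'I_q -> 'I_n.+1}) (x : V) : R := extd (q := q) psi x (basis_mx R K).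
have cg K : sphere_cont (g K).
  apply: sphere_cont_sum => k.
  apply: (@sphere_contM R n (fun=> (-1) ^+ k) (fun y =>
     'D_(row k (basis_mx R K)) (fun z => pullback psi z (row' k (basis_mx R K))) y)).
    exact: sphere_cont_cst.
  apply: sphere_cont_off0 => y y0; apply: differentiable_continuous.
  exact: coef_derive_differentiable.
apply: (@sphere_cont_eq _ _ (fun x => \sum_(K : {ffun 'I_q -> 'I_n.+1})
    (\prod_k (basis_mx R J *m tprojmx x) k (K k)) * g K x)).
  move=> x Sx; rewrite frameE; apply/esym.
  by apply: (multilinear_expand _ (extd_multilinear sp (sphere_neq0 Sx))).
apply: sphere_cont_sum => K; apply: sphere_contM => //; apply: sphere_cont_prod => k.
have E x : (basis_mx R J *m tprojmx x) k (K k) = 1 * (J k == K k)%:R + (-1) * (x 0 (J k) * x 0 (K k)).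
  rewrite basis_mulmx.
  by rewrite !mxE big_ord1 !mxE mul1r mulN1r.
apply: (@sphere_cont_eq _ _ (fun x => 1 * (J k == K k)%:R + (-1) * (x 0 (J k) * x 0 (K k)))).
  by move=> x _; rewrite E.
apply: sphere_contD; first exact: sphere_cont_cst.
by apply: sphere_contM; exact: coord_sphere_cont.
Qed.

Section Dot.
Variable p : nat.
Implicit Types alpha beta gamma : dform R n p.

Lemma dform_dot_cont alpha beta : frame_cont alpha -> frame_cont beta ->
  sphere_cont (dform_dot alpha beta).
Proof.
move=> ca cb; apply: (@sphere_contM R n (fun=> (p`!%:R)^-1)); first exact: sphere_cont_cst.
by apply: sphere_cont_sum => I; exact: sphere_contM.
Qed.

Lemma dform_dotC alpha beta x : dform_dot alpha beta x = dform_dot beta alpha x.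
Proof. by rewrite /dform_dot; congr (_ * _); apply: eq_bigr => I _; rewrite mulrC. Qed.

Lemma dform_dot_comb (a b : R) alpha beta gamma delta x :
  (forall I, alpha x (frame x I) = a * beta x (frame x I) + b * gamma x (frame x I)) ->
  dform_dot alpha delta x = a * dform_dot beta delta x + b * dform_dot gamma delta x.
Proof.
move=> E; rewrite /dform_dot mulrCA (mulrCA b) -mulrDr; congr (_ * _).
by rewrite !mulr_sumr -big_split; apply: eq_bigr => I _ /=; rewrite E; ring.
Qed.

Lemma dform_dot_ge0 alpha x : 0 <= dform_dot alpha alpha x.
Proof.
rewrite mulr_ge0 ?invr_ge0 ?ler0n// sumr_ge0// => I _.
by rewrite -expr2 sqr_ge0.
Qed.

Lemma dform_norm_ge0 alpha x : 0 <= dform_norm alpha x.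
Proof. exact: sqrtr_ge0. Qed.

Lemma dform_norm_sqr alpha x : dform_norm alpha x ^+ 2 = dform_dot alpha alpha x.
Proof. by rewrite sqr_sqrtr// dform_dot_ge0. Qed.

Lemma dform_norm_cont alpha : frame_cont alpha -> sphere_cont (dform_norm alpha).
Proof.
move=> ca; apply: (sphere_cont_comp (h := Num.sqrt) _ (dform_dot_cont ca ca)) => x _.
exact: sqrt_continuous.
Qed.

Lemma dform_norm_powR alpha x (t : R) :
  dform_norm alpha x `^ (2 * t) = dform_dot alpha alpha x `^ t.
Proof. by rewrite powRrM powR_mulrn ?dform_norm_ge0// dform_norm_sqr. Qed.

Lemma dform_dot_sub_sqr (t : R) alpha beta x :
  0 <= dform_dot alpha alpha x - 2 * t * dform_dot alpha beta x + t ^+ 2 * dform_dot beta beta x.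
Proof.
have -> : dform_dot alpha alpha x - 2 * t * dform_dot alpha beta x + t ^+ 2 * dform_dot beta beta x =
  (p`!%:R)^-1 * \sum_I (alpha x (frame x I) - t * beta x (frame x I)) ^+ 2.
  rewrite /dform_dot [2 * t * _]mulrCA [t ^+ 2 * _]mulrCA -mulrBr -mulrDr; congr (_ * _).
  rewrite !mulr_sumr -sumrB -big_split; apply: eq_bigr => I _ /=.
  by rewrite sqrrB mulr2n; ring.
by rewrite mulr_ge0 ?invr_ge0 ?ler0n// sumr_ge0// => I _; rewrite sqr_ge0.
Qed.

Lemma dform_cauchy_schwarz alpha beta x :
  dform_dot alpha beta x <= dform_norm alpha x * dform_norm beta x.
Proof.
have a0 := dform_norm_ge0 alpha x; have b0 := dform_norm_ge0 beta x.
have H t : 0 <= dform_norm alpha x ^+ 2 - 2 * t * dform_dot alpha beta x + t ^+ 2 * dform_norm beta x ^+ 2.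
  by rewrite !dform_norm_sqr dform_dot_sub_sqr.
move: a0 b0 H; move: (dform_norm alpha x) (dform_norm beta x) (dform_dot alpha beta x).
move=> a b d a0 b0 H.
move: b0; rewrite le_eqVlt => /predU1P[b0|b0].
  rewrite -b0 mulr0 leNgt; apply/negP => d0.
  have := H ((a ^+ 2 + 1) / d); rewrite -b0 expr0n mulr0 addr0.
  have -> : 2 * ((a ^+ 2 + 1) / d) * d = 2 * (a ^+ 2 + 1) by field; rewrite gt_eqF.
  by have := sqr_ge0 a; lra.
move: a0; rewrite le_eqVlt => /predU1P[a0|a0].
  rewrite -a0 mul0r leNgt; apply/negP => d0.
  have := H (d / b ^+ 2); rewrite -a0 expr0n sub0r.
  have -> : - (2 * (d / b ^+ 2) * d) + (d / b ^+ 2) ^+ 2 * b ^+ 2 = - (d ^+ 2 / b ^+ 2).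
    by field; rewrite gt_eqF.
  by rewrite oppr_ge0 leNgt divr_gt0 ?exprn_gt0.
have := H (a / b).
have -> : a ^+ 2 - 2 * (a / b) * d + (a / b) ^+ 2 * b ^+ 2 = 2 * (a / b) * (a * b - d).
  by field; rewrite gt_eqF.
by rewrite pmulr_rge0 ?subr_ge0// mulr_gt0// divr_gt0.
Qed.

End Dot.

Lemma smooth_dform0 p : smooth_dform (0 : dform R n p).
Proof.
split=> [x _|W]; first by split=> [i b c A B C _ _ _ _ _ _|//]; rewrite /= !mulr0 addr0.
move=> vs y _; suff -> : foldr (fun v (g : V -> R) => 'D_v g) (fun y => pullback (0 : dform R n p) y W) vs = cst 0.
  exact: differentiable_cst.
elim: vs => [|v vs /= ->]; first by apply/funext.
by rewrite funeqE => z; exact: derive_cst.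
Qed.

End FormIntegrands.

(** * The denominator of the conformal quotient *)

Lemma power_mean_weak (R : realType) (n : nat) (u : 'rV[R]_n.+1 -> R) (theta : R) :
  0 < theta < 1 -> sphere_cont u -> (forall x, sphere x -> 0 <= u x) ->
  integral_sphere (fun x => u x `^ theta) `^ theta^-1 <=
    sphere_volume R n `^ (theta^-1 - 1) * integral_sphere u.
Proof.
move=> th cu u0; have := integral_sphere_ge0 cu u0; rewrite le_eqVlt => /predU1P[I0|]; last first.
  by move=> I0; have [] := power_mean th cu u0 I0.
have /andP[th0 _] := th.
have uz x : sphere x -> u x = 0.
  move=> Sx; apply/eqP; rewrite eq_le u0// andbT leNgt; apply/negP => ux.
  by have := integral_sphere_gt0 cu u0 Sx ux; rewrite -I0 ltxx.
have -> : integral_sphere (fun x => u x `^ theta) = 0.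
  rewrite -(integral_sphere0 R n); apply: eq_integral_sphere; first exact: sphere_cont_powR.
  by move=> x Sx; rewrite uz// powR0// gt_eqF.
by rewrite powR0 ?gt_eqF ?invr_gt0// -I0 mulr0.
Qed.

Lemma curlD (R : realType) (p : nat) (o : bool) (a b : dform R (p.+1 + p) p) x W :
  smooth_dform a -> smooth_dform b -> sphere x ->
  curl o (a + b) x W = curl o a x W + curl o b x W.
Proof.
move=> sa sb Sx; rewrite /curl !hodgeE -mulrDr; congr (_ * _).
rewrite -big_split; apply: eq_bigr => I _ /=; rewrite -mulrDl; congr (_ * _).
rewrite /extd -big_split; apply: eq_bigr => k _ /=.
have comb (s X Y Z : R) : X = Y + Z -> s * X = s * Y + s * Z by move=> ->; exact: mulrDr.
apply: comb; apply: deriveD.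
  by apply: diff_derivable; apply: coef_differentiable => //; exact: sphere_neq0.
by apply: diff_derivable; apply: coef_differentiable => //; exact: sphere_neq0.
Qed.

(** The quotient is at most [m * N1 * N2 / Sp ^+ 2], where [N1 * N2] is at most
    [K ^+ 2 * Sm * Sp], hence at most [K ^+ 2 * Sp ^+ 2]; one strict inequality in
    this chain suffices. *)
Lemma quotient_lt (R : realFieldType) (m K Sm Sp N1 N2 D : R) :
  0 < m -> 0 < K -> 0 < Sp -> 0 <= Sm -> Sm <= Sp -> 0 <= N1 -> 0 < N2 ->
  N1 <= K * Sm -> N2 <= K * Sp ->
  Sm < Sp \/ N1 < K * Sm \/ N2 < K * Sp ->
  Sp ^+ 2 / N2 <= D -> m * N1 / D < m * K ^+ 2.
Proof.
move=> m0 K0 Sp0 Sm0 SS N10 N20 h1 h2 strict hD.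
have L0 : 0 < Sp ^+ 2 / N2 by rewrite divr_gt0// exprn_gt0.
have D0 : 0 < D by exact: lt_le_trans hD.
rewrite -mulrA ltr_pM2l// ltr_pdivrMr//.
have KSp : 0 < K * Sp by rewrite mulr_gt0.
have prod : N1 * N2 < (K * Sp) ^+ 2.
  have h1' : N1 <= K * Sp by rewrite (le_trans h1)// ler_pM2l.
  have [e|[e|e]] := strict.
  - have {}e : N1 < K * Sp by rewrite (le_lt_trans h1)// ltr_pM2l.
    apply: (@lt_le_trans _ _ (K * Sp * N2)); first by rewrite ltr_pM2r.
    by rewrite expr2 ler_pM2l.
  - have {}e : N1 < K * Sp by rewrite (lt_le_trans e)// ler_pM2l.
    apply: (@lt_le_trans _ _ (K * Sp * N2)); first by rewrite ltr_pM2r.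
    by rewrite expr2 ler_pM2l.
  - apply: (@le_lt_trans _ _ (K * Sp * N2)); first by rewrite ler_pM2r.
    by rewrite expr2 ltr_pM2l.
apply: (@lt_le_trans _ _ (K ^+ 2 * (Sp ^+ 2 / N2))).
  by rewrite mulrA -exprMn ltr_pdivlMr.
by rewrite ler_pM2l// exprn_gt0.
Qed.

Lemma square_le_powR (R : realType) (S X Y a b c : R) : 0 < a -> 0 < b -> 0 < c -> 0 <= S ->
  S <= X `^ (2 * b / a)^-1 * Y `^ (2 * b / c)^-1 ->
  S ^+ 2 <= X `^ (a / b) * Y `^ (c / b).
Proof.
move=> a0 b0 c0 S0 H.
have sq (Z d : R) : 0 < d -> Z `^ (d / b) = (Z `^ (2 * b / d)^-1) ^+ 2.
  move=> d0; have -> : d / b = (2 * b / d)^-1 * 2 by field; rewrite !gt_eqF.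
  by rewrite powRrM powR_mulrn// powR_ge0.
by rewrite !sq// -exprMn ler_sqr ?nnegrE ?mulr_ge0 ?powR_ge0.
Qed.

Section Denominator.
Variables (R : realType) (p : nat) (o : bool).
Notation n := (p.+1 + p)%N.
Variables (xi phi : dform R n p).
Hypothesis p0 : (0 < p)%N.
Hypothesis sxi : smooth_dform xi.
Hypothesis sphi : smooth_dform phi.
Let m : R := n.+1%:R / 2.
Hypothesis exi : dform_eq (curl o xi) (fun x W => 1 * m * xi x W).
Hypothesis ephi : dform_eq (curl o phi) (fun x W => -1 * m * phi x W).

Let m0 : 0 < m. Proof. by rewrite divr_gt0// ltr0n. Qed.

Lemma frame_tangent q (x : 'rV[R]_n.+1) (I : {ffun 'I_q -> 'I_n.+1}) :
  sphere x -> tangent x (frame x I).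
Proof. by move=> Sx; rewrite frameE; exact: tangent_tprojmx. Qed.

(** An eigenform for a nonzero eigenvalue is a multiple of its own curl, so that
    Stokes applies. *)
Lemma exact_orthogonal_eigenform (psi : dform R n p.-1) (a : dform R n p) (s : R) : s != 0 ->
  smooth_dform psi -> smooth_dform a -> dform_eq (curl o a) (fun x W => s * m * a x W) ->
  integral_sphere (dform_dot (extd (q := p) psi) a) = 0.
Proof.
move=> s0 sp sa ea.
have cE : sphere_cont (dform_dot (extd (q := p) psi) a).
  by apply: dform_dot_cont; [exact: extd_frame_cont|exact: smooth_frame_cont].
apply: (integral_exact_dot_curl (c := (s * m)^-1) (o := o) sp sa cE) => x Sx.
have -> : dform_dot (extd (q := p) psi) (curl o a) x = (s * m) * dform_dot (extd (q := p) psi) a x.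
  rewrite dform_dotC [in RHS]dform_dotC -[RHS]addr0 -[X in _ + X](mul0r (dform_dot a (extd (q := p) psi) x)).
  apply: dform_dot_comb => I; rewrite mul0r addr0; apply: ea => //.
  exact: frame_tangent.
by rewrite mulKf// mulf_neq0// gt_eqF.
Qed.

Let alpha := xi + phi.
Let Sp := integral_sphere (dform_dot alpha alpha).

Lemma frame_contD : frame_cont alpha.
Proof.
move=> I; apply: (@sphere_cont_eq _ _ (fun x => 1 * xi x (frame x I) + 1 * phi x (frame x I))).
  by move=> x _; rewrite !mul1r.
by apply: sphere_contD; exact: smooth_frame_cont.
Qed.

Lemma frame_contB psi : smooth_dform psi -> frame_cont (alpha - extd (q := p) psi).
Proof.
move=> sp I; apply: (@sphere_cont_eq _ _
   (fun x => 1 * alpha x (frame x I) + (-1) * extd (q := p) psi x (frame x I))).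
  by move=> x _; rewrite mul1r mulN1r.
by apply: sphere_contD; [exact: frame_contD|exact: extd_frame_cont].
Qed.

Lemma pairing_exact_shift psi : smooth_dform psi ->
  integral_sphere (dform_dot (alpha - extd (q := p) psi) alpha) = Sp.
Proof.
move=> sp.
have ce := extd_frame_cont sp.
have cx := smooth_frame_cont sxi; have cp := smooth_frame_cont sphi.
transitivity (integral_sphere (fun x => 1 * dform_dot alpha alpha x +
    (-1) * dform_dot (extd (q := p) psi) alpha x)).
  apply: eq_integral_sphere; first by apply: dform_dot_cont; [exact: frame_contB|exact: frame_contD].
  by move=> x _; apply: dform_dot_comb => I; rewrite mul1r mulN1r.
rewrite integral_sphereD; [|by apply: dform_dot_cont; exact: frame_contD|by apply: dform_dot_cont; [|exact: frame_contD]].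
rewrite mul1r mulN1r -/Sp; apply/eqP; rewrite subr_eq addrC -subr_eq subrr eq_sym; apply/eqP.
transitivity (integral_sphere (fun x => 1 * dform_dot (extd (q := p) psi) xi x +
    1 * dform_dot (extd (q := p) psi) phi x)).
  apply: eq_integral_sphere; first by apply: dform_dot_cont; [|exact: frame_contD].
  move=> x _; rewrite dform_dotC (dform_dotC _ xi) (dform_dotC _ phi).
  by apply: dform_dot_comb => I; rewrite !mul1r.
rewrite integral_sphereD; [|exact: dform_dot_cont|exact: dform_dot_cont].
have -> : integral_sphere (dform_dot (extd (q := p) psi) xi) = 0.
  by apply: (@exact_orthogonal_eigenform _ _ 1) => //; rewrite oner_eq0.
have -> : integral_sphere (dform_dot (extd (q := p) psi) phi) = 0.
  by apply: (@exact_orthogonal_eigenform _ _ (-1)) => //; rewrite oppr_eq0 oner_eq0.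
by rewrite !mulr0 addr0.
Qed.

(** Subtracting an exact form does not change the pairing with [alpha], so
    Hoelder's inequality with the conjugate exponents [2 n / (n - 1)] and
    [2 n / (n + 1)] bounds the denominator from below. *)
Lemma denominator_bound psi : smooth_dform psi -> 0 < Sp ->
  0 < integral_sphere (fun x => dform_norm alpha x `^ (2 * n%:R / n.+1%:R)) `^ (n.+1%:R / n%:R) ->
  Sp ^+ 2 / integral_sphere (fun x => dform_norm alpha x `^ (2 * n%:R / n.+1%:R)) `^ (n.+1%:R / n%:R) <=
  integral_sphere (fun x => dform_norm (alpha - extd (q := p) psi) x `^ (2 * n%:R / n.-1%:R))
    `^ (n.-1%:R / n%:R).
Proof.
move=> sp S0 N20; rewrite ler_pdivrMr//.
have n0 : (0 : R) < n%:R by rewrite ltr0n.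
have n10 : (0 : R) < n.-1%:R by rewrite ltr0n/= addn_gt0 p0.
have nS : (0 : R) < n.+1%:R by rewrite ltr0n.
have nE : n%:R = n.-1%:R + 1 :> R by rewrite -[in LHS](prednK (_ : 0 < n)%N)// -natr1.
have nSE : n.+1%:R = n.-1%:R + 1 + 1 :> R by rewrite -natr1 nE.
have P0 : 0 < 2 * n%:R / n.-1%:R :> R by rewrite !mulr_gt0 ?invr_gt0.
have Q0 : 0 < 2 * n%:R / n.+1%:R :> R by rewrite !mulr_gt0 ?invr_gt0.
have PQ : (2 * n%:R / n.-1%:R)^-1 + (2 * n%:R / n.+1%:R)^-1 = 1 :> R.
  by rewrite nSE nE; field; rewrite -?nSE -?nE ?gt_eqF//; lra.
have cB := frame_contB sp; have cA := frame_contD.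
have H := hoelder_sphere P0 Q0 PQ (dform_norm_cont cB) (dform_norm_cont cA) (dform_dot_cont cB cA)
  (fun x _ => dform_norm_ge0 _ x) (fun x _ => dform_norm_ge0 _ x) (fun x _ => dform_cauchy_schwarz _ _ x).
rewrite pairing_exact_shift// in H; have {}H := H S0.
exact: (@square_le_powR R _ _ _ n.-1%:R n%:R n.+1%:R n10 n0 nS (ltW S0) H).
Qed.

End Denominator.

(** * The quotient at the sum of an eigenform and its mirror image *)

Lemma dot_sum_diff (R : realType) (n p : nat) (xi phi : dform R n p) x (s : R) :
  dform_dot (xi + s *: phi) (xi + s *: phi) x =
  dform_dot xi xi x + s ^+ 2 * dform_dot phi phi x + 2 * s * dform_dot xi phi x.
Proof.
have E (a : dform R n p) : dform_dot (xi + s *: phi) a x = 1 * dform_dot xi a x + s * dform_dot phi a x.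
  by apply: dform_dot_comb => I; rewrite mul1r.
by rewrite E (dform_dotC xi (xi + _)) (dform_dotC phi (xi + _)) !E (dform_dotC phi xi); ring.
Qed.

Lemma bound_constE (R : realType) (a b v : R) :
  a ^+ 2 / 4 * v `^ (2 / b) = (a / 2) ^+ 2 * (v `^ b^-1) ^+ 2.
Proof.
rewrite -[(v `^ _) ^+ 2]powR_mulrn ?powR_ge0// -powRrM [b^-1 * 2]mulrC; congr (_ * _).
by field.
Qed.

Lemma sum_diff_order (R : realFieldType) (A c : R) : 0 < A -> 0 <= c ->
  [/\ 0 < A + 2 * 1 * c, A + 2 * (-1) * c <= A + 2 * 1 * c,
      0 < c -> A + 2 * (-1) * c < A + 2 * 1 * c & c = 0 -> 0 < A + 2 * (-1) * c].
Proof. by move=> A0 c0; split=> *; lra. Qed.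

Lemma integral_sphere_powR_gt0 (R : realType) (n : nat) (u : 'rV[R]_n.+1 -> R) (a : R) :
  0 < a -> sphere_cont u -> (forall x, sphere x -> 0 <= u x) -> 0 < integral_sphere u ->
  0 < integral_sphere (fun x => u x `^ a).
Proof.
move=> a0 cu u0 I0; have [[x [Sx ux]]|none] := pselect (exists x, sphere x /\ 0 < u x).
  apply: (@integral_sphere_gt0 _ _ _ x) => //; first exact: sphere_cont_powR.
    by move=> y _; exact: powR_ge0.
  exact: powR_gt0.
move: I0; rewrite (@eq_integral_sphere _ _ _ (fun=> 0) cu) ?integral_sphere0 ?ltxx// => x Sx.
by apply/eqP; rewrite eq_le u0// andbT leNgt; apply/negP => ux; apply: none; exists x.
Qed.

Lemma cross_term_eq (R : realFieldType) (a b d a' b' d' : R) :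
  a + (-1) ^+ 2 * b + 2 * (-1) * d = a' + (-1) ^+ 2 * b' + 2 * (-1) * d' ->
  a + 1 ^+ 2 * b + 2 * 1 * d = a' + 1 ^+ 2 * b' + 2 * 1 * d' -> d = d'.
Proof. by rewrite sqrrN expr1n; lra. Qed.

Section Quotient.
Variables (R : realType) (p : nat) (o : bool).
Notation n := (p.+1 + p)%N.
Variables (xi phi : dform R n p).
Hypothesis p0 : (0 < p)%N.
Hypothesis sxi : smooth_dform xi.
Hypothesis sphi : smooth_dform phi.
Hypothesis exi : dform_eq (curl o xi) (fun x W => 1 * (n.+1%:R / 2) * xi x W).
Hypothesis ephi : dform_eq (curl o phi) (fun x W => -1 * (n.+1%:R / 2) * phi x W).

Let cx := smooth_frame_cont sxi.
Let cp := smooth_frame_cont sphi.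

Lemma dot_curl_sum x : sphere x ->
  dform_dot (curl o (xi + phi)) (curl o (xi + phi)) x =
  (n.+1%:R / 2) ^+ 2 * dform_dot (xi + -1 *: phi) (xi + -1 *: phi) x.
Proof.
move=> Sx; set m : R := n.+1%:R / 2.
have E (a : dform R n p) : dform_dot (curl o (xi + phi)) a x = m * dform_dot (xi + -1 *: phi) a x.
  transitivity (m * dform_dot (xi + -1 *: phi) a x + 0 * dform_dot xi a x).
    2: by rewrite mul0r addr0.
  apply: dform_dot_comb => I.
  rewrite curlD//; have tI := frame_tangent I Sx.
  have -> := exi Sx tI; have -> := ephi Sx tI; rewrite -/m mul0r addr0.
  have -> : (xi + -1 *: phi) x (frame x I) = xi x (frame x I) + -1 * phi x (frame x I) by [].
  by ring.
by rewrite E dform_dotC E mulrA.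
Qed.

Let c := integral_sphere (dform_dot xi phi).

Lemma integral_dot_comb (s : R) : s ^+ 2 = 1 ->
  integral_sphere (dform_dot (xi + s *: phi) (xi + s *: phi)) =
  integral_sphere (dform_dot xi xi) + integral_sphere (dform_dot phi phi) + 2 * s * c.
Proof.
move=> s2.
have cxx := dform_dot_cont cx cx; have cpp := dform_dot_cont cp cp; have cxp := dform_dot_cont cx cp.
have cS := sphere_contD (a := 1) (b := 1) cxx cpp.
transitivity (integral_sphere (fun x =>
    1 * (1 * dform_dot xi xi x + 1 * dform_dot phi phi x) + 2 * s * dform_dot xi phi x)).
  have E x : 1 * (1 * dform_dot xi xi x + 1 * dform_dot phi phi x) + 2 * s * dform_dot xi phi x =
      dform_dot (xi + s *: phi) (xi + s *: phi) x by rewrite dot_sum_diff s2; ring.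
  apply: eq_integral_sphere => [|x _]; last exact/esym/E.
  by apply: (sphere_cont_eq _ (sphere_contD (a := 1) (b := 2 * s) cS cxp)) => x _; exact: E.
have e := integral_sphereD 1 1 cxx cpp.
apply: (etrans (integral_sphereD 1 (2 * s) cS cxp)).
have comb (I X Y t d : R) : I = 1 * X + 1 * Y -> 1 * I + t * d = X + Y + t * d.
  by move=> ->; rewrite !mul1r.
exact: comb e.
Qed.

Lemma frame_cont_comb s : frame_cont (xi + s *: phi).
Proof.
move=> I; apply: (@sphere_cont_eq _ _ (fun x => 1 * xi x (frame x I) + s * phi x (frame x I))).
  by move=> x _; rewrite mul1r.
by apply: sphere_contD.
Qed.

(** For the strict inequality: if [0 < c], then [|xi - phi|] has a smaller [L^2] norm
    than [|xi + phi|].  If [c = 0] and the power mean inequality were an equality for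
    both [xi + phi] and [xi - phi], then both norms would be constant on the
    sphere, hence also [<xi, phi>], by polarization; its integral being zero, it
    would vanish identically, contrary to its value at [x0]. *)
Lemma quotient_bound (x0 : 'rV[R]_n.+1) : sphere x0 -> dform_dot xi phi x0 != 0 -> 0 <= c ->
  integral_sphere (fun x => dform_norm (curl o (xi + phi)) x `^ (2 * n%:R / n.+1%:R))
    `^ (n.+1%:R / n%:R)
  / inf [set (integral_sphere (fun x =>
               dform_norm (xi + phi - extd (q := p) psi) x `^ (2 * n%:R / n.-1%:R)))
               `^ (n.-1%:R / n%:R)
        | psi in @smooth_dform R n p.-1]
  < n.+1%:R ^+ 2 / 4 * sphere_volume R n `^ (2 / n%:R).
Proof.
move=> Sx0 d0 c0.
have n0 : (0 : R) < n%:R by rewrite ltr0n.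
have nSE : n.+1%:R = n%:R + 1 :> R by rewrite -natr1.
have nS : (0 : R) < n.+1%:R by rewrite ltr0n.
pose theta : R := n%:R / n.+1%:R.
have th : 0 < theta < 1 by rewrite divr_gt0//= ltr_pdivrMr// mul1r nSE ltrDl.
have thV : theta^-1 = n.+1%:R / n%:R by rewrite invf_div.
have thV1 : theta^-1 - 1 = n%:R^-1 by rewrite thV nSE; field; rewrite gt_eqF.
have V0 : 0 < sphere_volume R n := sphere_volume_gt0 R n.
have [m2 m2E] : exists m2 : R, (n.+1%:R / 2) ^+ 2 = m2 by eexists.
have m20 : 0 < m2 by rewrite -m2E exprn_gt0// divr_gt0.
have alphaE : xi + phi = xi + 1 *: phi by rewrite scale1r.
have [dS dSE] : exists dS : R -> 'rV[R]_n.+1 -> R,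
    forall s, dS s = dform_dot (xi + s *: phi) (xi + s *: phi) by eexists.
have cS s : sphere_cont (dS s) by rewrite dSE; apply: dform_dot_cont; exact: frame_cont_comb.
have S0 s x : sphere x -> 0 <= dS s x by move=> _; rewrite dSE; exact: dform_dot_ge0.
pose A := integral_sphere (dform_dot xi xi) + integral_sphere (dform_dot phi phi).
have A0 : 0 < A.
  apply: ltr_pwDl.
    apply: (integral_sphere_gt0 (x0 := x0)); [exact: dform_dot_cont|by move=> x _; exact: dform_dot_ge0|exact: Sx0|].
    rewrite lt_def dform_dot_ge0 andbT; apply/eqP => e.
    have := dform_dot_sub_sqr ((dform_dot phi phi x0 + 1) / (2 * dform_dot xi phi x0)) phi xi x0.
    rewrite e mulr0 addr0 (dform_dotC phi xi); move: (dform_dot phi phi x0) (dform_dot xi phi x0) d0 => a b b0.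
    by have -> : a - 2 * ((a + 1) / (2 * b)) * b = -1 by [field]; rewrite oppr_ge0 ler10.
  by apply: integral_sphere_ge0 => [|x _]; [exact: dform_dot_cont|exact: dform_dot_ge0].
have Int s : s ^+ 2 = 1 -> integral_sphere (dS s) = A + 2 * s * c.
  by rewrite dSE; exact: integral_dot_comb.
have e2 : 2 * n%:R / n.+1%:R = 2 * theta by rewrite mulrA.
pose Ns (s : R) := integral_sphere (fun x => dS s x `^ theta) `^ theta^-1.
pose K : R := sphere_volume R n `^ (theta^-1 - 1).
have cth s : sphere_cont (fun x => dS s x `^ theta).
  by apply: sphere_cont_powR; [exact: (andP th).1|exact: cS|exact: S0].
have numE : integral_sphere (fun x => dform_norm (curl o (xi + phi)) x `^ (2 * n%:R / n.+1%:R))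
    `^ (n.+1%:R / n%:R) = m2 * Ns (-1).
  have E x : sphere x -> m2 `^ theta * dS (-1) x `^ theta =
      dform_norm (curl o (xi + phi)) x `^ (2 * n%:R / n.+1%:R).
    by move=> Sx; rewrite e2 dform_norm_powR dot_curl_sum// m2E -dSE powRM// ?S0// ltW.
  rewrite -(eq_integral_sphere _ E); last by apply: sphere_contM => //; exact: sphere_cont_cst.
  have I0 : 0 <= integral_sphere (fun x => dS (-1) x `^ theta).
    by apply: integral_sphere_ge0 => // x _; exact: powR_ge0.
  rewrite (integral_sphereZ _ (cth (-1))) -thV (powRM _ (powR_ge0 _ _) I0) -powRrM mulfV ?powRr1 ?ltW//.
  by rewrite gt_eqF// (andP th).1.
have N2E : integral_sphere (fun x => dform_norm (xi + phi) x `^ (2 * n%:R / n.+1%:R))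
    `^ (n.+1%:R / n%:R) = Ns 1.
  have powE (u v : 'rV[R]_n.+1 -> R) (a b : R) : u =1 v -> a = b ->
      integral_sphere u `^ a = integral_sphere v `^ b by move=> /funext -> ->.
  by apply: powE (esym thV) => x; rewrite e2 dform_norm_powR dSE -alphaE.
have KE : n.+1%:R ^+ 2 / 4 * sphere_volume R n `^ (2 / n%:R) = m2 * K ^+ 2.
  by apply: (etrans (bound_constE _ _ _)); rewrite -thV1 m2E.
have reduce (X Y D B C : R) : X = Y -> B = C -> Y / D < C -> X / D < B by move=> -> ->.
apply: (reduce _ _ _ _ _ numE KE).
have I1 := Int 1 (expr1n _ 2); have I2 := Int (-1) (sqrr_sign _ 1).
have [] := sum_diff_order A0 c0; rewrite -I1 -I2 => Sp0 Smp lt_c eq_c.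
have weak s : Ns s <= K * integral_sphere (dS s) by exact: power_mean_weak th (cS s) (S0 s).
have Ns0 s : 0 <= Ns s by exact: powR_ge0.
have N20 : 0 < Ns 1.
  exact/powR_gt0/(integral_sphere_powR_gt0 (andP th).1 (cS 1) (S0 1) Sp0).
have K0 : 0 < K by exact: powR_gt0.
have Sm0 : 0 <= integral_sphere (dS (-1)) by exact: integral_sphere_ge0 (cS _) (S0 _).
apply: (quotient_lt m20 K0 Sp0 Sm0 Smp (Ns0 _) N20 (weak _) (weak _)).
- have [c1|c1] := ltP 0 c; first by left; exact: lt_c.
  have {c0 c1}c0 : c = 0 by apply/eqP; rewrite eq_le c1 c0.
  right; have [cst1|ncst1] := pselect (forall x, sphere x -> dS (-1) x = dS (-1) x0); last first.
    left; apply: (power_mean th (cS _) (S0 _) (eq_c c0)).2.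
    have [x] := (existsNP _).2 ncst1.
    move=> /not_implyP[Sx].
    move=> /eqP ne.
    exists x, x0; split; [exact: Sx|exact: Sx0|exact: ne].
  right; apply: (power_mean th (cS _) (S0 _) Sp0).2.
  apply: contrapT => cst2; case/eqP: d0.
  have dE x : sphere x -> dform_dot xi phi x = dform_dot xi phi x0.
    move=> Sx; have e1 := cst1 x Sx.
    have e3 : dS 1 x = dS 1 x0.
      apply: contrapT => /eqP ne; apply: cst2; exists x, x0; split; [exact: Sx|exact: Sx0|exact: ne].
    by move: e1 e3; rewrite !dSE !dot_sum_diff; exact: cross_term_eq.
  have : c = dform_dot xi phi x0 * sphere_volume R n.
    rewrite -integral_sphere_cst; exact: eq_integral_sphere (dform_dot_cont cx cp) dE.
  by rewrite c0 => /esym/eqP; rewrite mulf_eq0 (gt_eqF V0) orbF => /eqP.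
- apply: lb_le_inf.
    by eexists; exists 0; [exact: smooth_dform0|reflexivity].
  move=> _ [psi sp <-].
  have e : integral_sphere (dS 1) = integral_sphere (dform_dot (xi + phi) (xi + phi)).
    by rewrite dSE -alphaE.
  have reduce2 (a b u v D : R) : a = b -> u = v -> a ^+ 2 / u <= D -> b ^+ 2 / v <= D by move=> -> ->.
  apply: (reduce2 _ _ _ _ _ (esym e) N2E).
  apply: (denominator_bound p0 sxi sphi exi ephi sp); first by rewrite -e.
  by rewrite N2E.
Qed.

End Quotient.

(** The degree [p] and the dimension [n] are independent variables here, so that
    [n] can be replaced by [p.+1 + p] in the types. *)
Lemma exists_opposite_eigenform (R : realType) (n p : nat) (o : bool) (xi : dform R n p) :
  n = (p.+1 + p)%N -> (0 < p)%N -> smooth_dform xi ->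
  dform_eq (curl o xi) (fun x W => 1 * (n.+1%:R / 2) * xi x W) -> ~ dform_eq xi 0 ->
  exists phi : dform R n p, (smooth_dform phi /\
    dform_eq (curl o phi) (fun x W => -1 * (n.+1%:R / 2) * phi x W)) /\
  integral_sphere (fun x => dform_norm (curl o (xi + phi)) x `^ (2 * n%:R / n.+1%:R))
    `^ (n.+1%:R / n%:R)
  / inf [set (integral_sphere (fun x =>
               dform_norm (xi + phi - extd (q := p) psi) x `^ (2 * n%:R / n.-1%:R)))
               `^ (n.-1%:R / n%:R)
        | psi in @smooth_dform R n p.-1]
  < n.+1%:R ^+ 2 / 4 * sphere_volume R n `^ (2 / n%:R).
Proof.
move=> nE; subst n => p0 sxi exi xi0.
have [x0 [W0 [Sx0 tW0 xiW0]]] : exists x W, [/\ sphere x, tangent x W & xi x W != 0].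
  apply: contrapT => none; apply: xi0 => x W Sx tW; apply: contrapT => /eqP ne.
  by apply: none; exists x, W.
have [Q [QQ dQ d1]] := exists_reflection Sx0 (sxi.1 x0 Sx0) tW0 xiW0.
pose c1 := integral_sphere (dform_dot xi (isopull Q 1 xi)).
have eig s : smooth_dform (isopull Q s xi) /\ dform_eq (curl o (isopull Q s xi))
    (fun x W => -1 * ((p.+1 + p).+1%:R / 2) * isopull Q s xi x W).
  split=> [|x W Sx tW]; first exact: smooth_isopull.
  rewrite curl_isopull// dQ /isopull.
  have -> := exi _ _ (sphere_isometry QQ Sx) (tangent_isometry QQ tW).
  by rewrite mul1r !mulN1r mulNr; congr (- _); exact: mulrCA.
have dotZ s x : dform_dot xi (isopull Q s xi) x = s * dform_dot xi (isopull Q 1 xi) x.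
  rewrite dform_dotC (dform_dotC xi) -[RHS]addr0 -(mul0r (dform_dot xi xi x)); apply: dform_dot_comb => I.
  by rewrite mul0r addr0 /isopull mul1r.
have [s s0 sc1] : exists2 s : R, s != 0 & 0 <= s * c1.
  have [c0|/ltW c0] := leP 0 c1; first by exists 1; rewrite ?oner_eq0 ?mul1r.
  by exists (-1); rewrite ?oppr_eq0 ?oner_eq0 ?mulN1r ?oppr_ge0.
exists (isopull Q s xi); split; first exact: eig.
apply: (quotient_bound p0 sxi (eig s).1 exi (eig s).2 Sx0).
  by rewrite dotZ mulf_neq0.
have c1cont : sphere_cont (dform_dot xi (isopull Q 1 xi)).
  by apply: dform_dot_cont; apply: smooth_frame_cont => //; exact: (eig 1).1.
rewrite -(eq_integral_sphere (f := fun x => s * dform_dot xi (isopull Q 1 xi) x)).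
- by rewrite integral_sphereZ.
- by apply: sphere_contM => //; exact: sphere_cont_cst.
- by move=> x _; exact/esym/dotZ.
Qed.

Theorem proposition5p1 (R : realType) (n : nat) (o : bool)
    (xi : dform R n (middeg n)) :
  (n %% 4 = 3)%N ->
  eigenforms o 1 xi ->
  ~ dform_eq xi 0 ->
  exists phi : dform R n (middeg n),
    eigenforms o (-1) phi /\
    J2 o (xi + phi) < n.+1%:R ^+ 2 / 4 * sphere_volume R n `^ (2 / n%:R).
Proof.
move=> n3 [sxi exi] xi0.
have nE : n = ((middeg n).+1 + middeg n)%N by rewrite /middeg; lia.
have p0 : (0 < middeg n)%N by rewrite /middeg; lia.
exact: (exists_opposite_eigenform nE p0 sxi exi xi0).
Qed.
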